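(* The following hold. (i) For every even integer $d\geq 2$, there is an infinite set $X_d\subset\mathbb{Q}^d$ in affine general position, all of whose pairwise Euclidean distances are rational. (ii) For every integer $d\geq 1$ with $d\equiv 1\pmod 4$, there is an infinite set $X_d\subset\mathbb{Q}^d$ in general position, all of whose pairwise Euclidean distances are rational.
   Context: $\mathbb{Q}^d\subset\mathbb{R}^d$ carries the standard Euclidean metric. A set $P\subset\mathbb{R}^d$ is in affine general position if every $d+1$ distinct points of $P$ are affinely independent. It is in general position if it is in affine general position and no $d+2$ distinct points of $P$ are cospherical, i.e. lie on a common sphere in $\mathbb{R}^d$. *)

(* Defs.v *)
From mathcomp Require Import all_boot all_order all_algebra.
From mathcomp Require Import all_classical all_reals.

Set Implicit Arguments.
Unset Strict Implicit.
Unset Printing Implicit Defensive.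

Import Order.TTheory GRing.Theory Num.Theory.

Local Open Scope classical_set_scope.
Local Open Scope ring_scope.

(* The library norm on ['rV[R]_d] is the sup norm, hence this definition. *)
Definition edist (R : realType) (d : nat) (x y : 'rV[R]_d) : R :=
  Num.sqrt (\sum_(i < d) (x ord0 i - y ord0 i) ^+ 2).

Definition rational_points (R : realType) (d : nat) : set 'rV[R]_d :=
  [set x | forall i : 'I_d, rational (x ord0 i)].

Definition rational_distances (R : realType) (d : nat) (P : set 'rV[R]_d) :
    Prop :=
  forall x y : 'rV[R]_d, P x -> P y -> rational (edist x y).

Definition affinely_independent (R : realType) (d n : nat)
    (p : 'I_n -> 'rV[R]_d) : Prop :=
  forall c : 'I_n -> R,
    \sum_(i < n) c i = 0 -> \sum_(i < n) c i *: p i = 0 ->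
    forall i : 'I_n, c i = 0.

Definition sphere (R : realType) (d : nat) (a : 'rV[R]_d) (r : R) :
    set 'rV[R]_d :=
  [set x | edist x a = r].

Definition cospherical (R : realType) (d n : nat) (p : 'I_n -> 'rV[R]_d) :
    Prop :=
  exists (a : 'rV[R]_d) (r : R), 0 < r /\ forall i : 'I_n, sphere a r (p i).

Definition affine_general_position (R : realType) (d : nat)
    (P : set 'rV[R]_d) : Prop :=
  forall p : 'I_d.+1 -> 'rV[R]_d,
    injective p -> (forall i, P (p i)) -> affinely_independent p.

Definition general_position (R : realType) (d : nat) (P : set 'rV[R]_d) :
    Prop :=
  affine_general_position P /\
  forall p : 'I_d.+2 -> 'rV[R]_d,
    injective p -> (forall i, P (p i)) -> ~ cospherical p.

(* Main.v *)
Require Import Defs.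
From mathcomp Require Import all_classical all_reals complex.
From mathcomp Require Import all_boot all_order all_algebra all_solvable all_field.
From mathcomp Require Import ring lra zify.
Set Implicit Arguments.
Unset Strict Implicit.
Unset Printing Implicit Defensive.
Import Order.TTheory GRing.Theory Num.Theory.
Local Open Scope ring_scope.

(** The points come from the curve with coordinates Re w^n and Im w^n / sqrt D, for n in an interval,
    where w runs through the numbers of absolute value 1 in K = Q(sqrt(-D)); these coordinates are
    rational. Give the two coordinates of frequency n the weights B_n and D B_n. If
    w / w' = exp (2 i alpha), the weighted squared distance of two points of the curve is the sum of
    2 B_n (1 - cos (2 n alpha)). When the B_n come from squaring a sine polynomial
    f = sum a_i sin ((2 i + 1) alpha), this sum is 4 f(alpha)^2 ([curve_identity]). Moreover f(alpha)
    is sqrt D times a rational number, divided by the absolute value of an element of K with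
    argument alpha ([curve_dist]). So there are three tasks: to find f with positive B_n, to identify
    the weighted form with a multiple of the sum of squares over Q, and to get rid of the absolute
    values.

    The weighted form, with k pairs of weights, is a hermitian form over K. Positive hermitian planes
    over K represent all positive rationals ([binary_hermitian_universal]), hence only the product of
    the weights matters. If k is divisible by 4, the form is a multiple of the sum of squares for D
    equal to the product. If k is even but not divisible by 4, this still works for a suitable D
    provided the product is a sum of three squares, and by [three_squares] it is enough that the
    product is 1 modulo 4 up to squares ([isometric_sum_squares]). If k is odd, one direction is
    split off first, and k - 1 pairs remain ([odd_frame]).

    Signs and classes of the B_n are controlled by choosing the coefficients of f among values of
    rational functions at powers of 25 / 4, a square that is large both in the real and in the 2-adic
    sense: then only leading coefficients matter ([odd_coefficients], [even_coefficients]).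

    The absolute values disappear in one of three ways. Let k be even, with frequencies
    2, ..., k + 1, and let w be the square of a number of absolute value 1 in K. Then alpha is the
    argument of such a number, and the dimension is 2 k; general position is obtained by selecting
    the points one after the other ([even_family]). Let k be odd, with frequencies 1, ..., k and with
    the sum of the weights a square. The stereographic projection from the curve point w = 1 divides
    distances by the distances to that point, which contain the same absolute values. One coordinate
    is lost, the dimension is 2 k - 1, and general position follows from the Vandermonde determinant
    ([odd_family]). Finally, an inversion centred outside of the hyperplane containing this second
    family puts infinitely many of its points in dimension 2 k; affine general position there follows
    from general position before the inversion ([inverted_family]).

    The two arithmetic facts used above are proved by elementary means. The first one says that
    symbols of length three over Q vanish up to a sign condition, and is proved by induction over the
    primes ([qsym_pos]). For sums of three squares one needs primes with prescribed quadratic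
    characters; [two_characters] finds them by a comparison of a divergent and a bounded sum. *)

(** * Quadratic residues in finite fields *)

Definition qhalf (F : finFieldType) : nat := (#|F|.-1)./2.

Lemma card_field_gt1 (F : finFieldType) : (1 < #|F|)%N.
Proof. exact: finNzRing_gt1. Qed.

Lemma qhalfE (F : finFieldType) : odd #|F| -> #|F|.-1 = (qhalf F).*2.
Proof.
by rewrite /qhalf; case: #|F| => //= n /negbTE e; rewrite -[LHS]odd_double_half e.
Qed.

Lemma qhalf_gt0 (F : finFieldType) : odd #|F| -> (0 < qhalf F)%N.
Proof.
move=> o; rewrite lt0n; apply/eqP => z; have := card_field_gt1 F.
by rewrite -ltn_predRL qhalfE // z.
Qed.

Lemma expf_card_pred (F : finFieldType) (x : F) : x != 0 -> x ^+ #|F|.-1 = 1.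
Proof.
move=> x0; apply: (mulfI x0); rewrite -exprS prednK ?mulr1 ?expf_card //.
by have := card_field_gt1 F; lia.
Qed.

Lemma qchar_pm1 (F : finFieldType) (x : F) : odd #|F| -> x != 0 ->
  (x ^+ qhalf F == 1) || (x ^+ qhalf F == -1).
Proof.
move=> o x0; rewrite -eqf_sqr expr1n -exprM muln2 -qhalfE //.
by rewrite expf_card_pred.
Qed.

Lemma finField_generator (F : finFieldType) :
  exists g : F, (#|F|.-1).-primitive_root g.
Proof.
have n0 : (0 < #|F|.-1)%N by have := card_field_gt1 F; lia.
pose rs := [seq x <- enum F | x != 0].
have : has (#|F|.-1).-primitive_root rs.
  apply: has_prim_root => //.
  - apply/allP => x; rewrite mem_filter => /andP[x0 _].
    by apply/unity_rootP; apply: expf_card_pred.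
  - by rewrite filter_uniq // enum_uniq.
  - rewrite size_filter; have := count_predC (fun x : F => x != 0) (enum F).
    rewrite -cardE => e.
    have : (count (predC (fun x : F => (x != 0)%R)) (enum F) <= 1)%N.
      rewrite (@eq_count F _ (pred1 0%R)); last by move=> x /=; rewrite negbK.
      by rewrite count_uniq_mem ?enum_uniq //; case: (_ \in _).
    by move=> c1; rewrite -e -subn1 leq_subLR addnC leq_add2r.
by case/hasP => g _ pg; exists g.
Qed.

Lemma one_neqN1 (F : finFieldType) : odd #|F| -> (1 : F) != -1.
Proof.
move=> o; have [g pg] := finField_generator F.
apply/eqP => e; have hh := qhalf_gt0 o.
have : (g ^+ qhalf F) ^+ 2 = 1 by rewrite -exprM muln2 -qhalfE // prim_expr_order.
move/eqP; rewrite sqrf_eq1 -e orbb => /eqP.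
move/eqP; rewrite -(prim_order_dvd pg) qhalfE // => /dvdn_leq.
by rewrite hh => /(_ isT); lia.
Qed.

Lemma qchar_square (F : finFieldType) (x : F) : odd #|F| -> x != 0 ->
  x ^+ qhalf F = 1 -> exists s, x = s ^+ 2.
Proof.
move=> o x0 e; have [g pg] := finField_generator F.
have [[i /= _] xi] := prim_rootP pg (expf_card_pred x0).
have : (i %% 2 == 0)%N.
  move/eqP: e; rewrite xi -exprM -(prim_order_dvd pg) qhalfE // -muln2 mulnC.
  by rewrite dvdn_pmul2r ?qhalf_gt0.
move/eqP=> i2; exists (g ^+ (i %/ 2)).
by rewrite xi -exprM {1}(divn_eq i 2) i2 addn0.
Qed.

Lemma qchar_nonsquare (F : finFieldType) : odd #|F| ->
  exists g : F, g ^+ qhalf F = -1.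
Proof.
move=> o; have [g pg] := finField_generator F; exists g.
have g0 : g != 0.
  apply/eqP => z; have := prim_expr_order pg.
  rewrite z expr0n qhalfE //; have := qhalf_gt0 o; case: (qhalf F) => //= n _.
  by move/eqP; rewrite eq_sym oner_eq0.
case/orP: (qchar_pm1 o g0) => /eqP // /eqP.
rewrite -(prim_order_dvd pg) qhalfE // => /dvdn_leq.
by have := qhalf_gt0 o; lia.
Qed.

(** If there were no such x, then x |-> 1 - x would map the nonresidues into the residues, hence
    onto them since both classes have the same size; but the residue 1 = 1 - 0 is not reached. *)
Lemma qchar_steinberg (F : finFieldType) : odd #|F| ->
  exists x : F, x ^+ qhalf F = -1 /\ (1 - x) ^+ qhalf F = -1.
Proof.
move=> o; have hh := qhalf_gt0 o.
pose N := [set x : F | x ^+ qhalf F == -1].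
pose S := [set x : F | x ^+ qhalf F == 1].
have [/existsP[x /andP[/eqP x1 /eqP x2]]|/existsPn no] :=
  boolP [exists x : F, (x ^+ qhalf F == -1) && ((1 - x) ^+ qhalf F == -1)].
  by exists x.
have [g gN] := qchar_nonsquare o.
have g0 : g != 0.
  apply/eqP => z; move: gN; rewrite z expr0n; move: hh; case: (qhalf F) => //= n _.
  by move/eqP; rewrite eq_sym oppr_eq0 oner_eq0.
have cNS : #|S| = #|N|.
  apply/eqP; rewrite eqn_leq; apply/andP; split.
    rewrite -(card_imset (mem S) (mulfI g0)); apply/subset_leq_card/subsetP => y.
    by case/imsetP => x; rewrite !inE => /eqP xe ->; rewrite exprMn xe gN mulr1.
  rewrite -(card_imset (mem N) (mulfI g0)); apply/subset_leq_card/subsetP => y.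
  by case/imsetP => x; rewrite !inE => /eqP xe ->; rewrite exprMn xe gN mulrNN mulr1.
pose T := [set 1 - x | x in N].
have cT : #|T| = #|N| by apply: card_imset => x y /= /addrI /oppr_inj.
have TS : T \subset S.
  apply/subsetP => y /imsetP[x xN ->]; rewrite inE.
  have x1 : 1 - x != 0.
    rewrite subr_eq0; apply/eqP => e; move: xN; rewrite inE -e expr1n.
    by rewrite (negbTE (one_neqN1 o)).
  case/orP: (qchar_pm1 o x1) => // e; move: (no x); rewrite e andbT.
  by move: xN; rewrite inE => ->.
have : 1 \in S by rewrite inE expr1n.
have -> : S = T by apply/esym/eqP; rewrite eqEcard TS cT cNS leqnn.
case/imsetP => x; rewrite inE => /eqP xe e.
have z : x = 0 by move/eqP: e; rewrite -subr_eq0 => /eqP <-; ring.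
move: xe; rewrite z expr0n; move: hh; case: (qhalf F) => //= n _.
by move/eqP; rewrite eq_sym oppr_eq0 oner_eq0.
Qed.

(** * Values of quaternion norm forms *)

(** The number ga is a reduced norm from the quaternion algebra (al, be) over Q. *)
Definition quat_rep (al be ga : rat) : Prop :=
  exists x y z w : rat,
    ga = (x ^+ 2 - al * y ^+ 2) - be * (z ^+ 2 - al * w ^+ 2).

Lemma quat_repC al be ga : quat_rep al be ga -> quat_rep be al ga.
Proof. by case=> x [y [z [w ->]]]; exists x, z, y, w; ring. Qed.

(** If be is a norm from Q(sqrt al), the quaternion algebra splits and its norm form is
    hyperbolic. *)
Lemma quat_rep_norm al be ga x y :
  be != 0 -> be = x ^+ 2 - al * y ^+ 2 -> quat_rep al be ga.
Proof.
move=> be0 e.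
exists ((ga + 1) / 2), 0, ((ga - 1) / 2 * x / be), ((ga - 1) / 2 * y / be).
transitivity (((ga + 1) / 2) ^+ 2 - ((ga - 1) / 2) ^+ 2); first by field.
suff -> : be * (((ga - 1) / 2 * x / be) ^+ 2 - al * ((ga - 1) / 2 * y / be) ^+ 2)
  = ((ga - 1) / 2) ^+ 2 * ((x ^+ 2 - al * y ^+ 2) / be) by rewrite -e divff //; ring.
by field.
Qed.

(** Solve the equation for be: quotients of norms from Q(sqrt al) are norms. *)
Lemma quat_rep_swap al be ga : ga != 0 -> be != 0 ->
  quat_rep al be ga -> quat_rep al ga be.
Proof.
move=> ga0 be0 [x [y [z [w e]]]].
have [n0|n0] := eqVneq (z ^+ 2 - al * w ^+ 2) 0.
  apply: (@quat_rep_norm _ _ _ x y) => //.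
  by rewrite e n0; ring.
set n := z ^+ 2 - al * w ^+ 2 in e n0.
exists ((x * z - al * y * w) / n), ((y * z - x * w) / n), (z / n), (w / n).
have -> : ((x * z - al * y * w) / n) ^+ 2 - al * ((y * z - x * w) / n) ^+ 2
   = (x ^+ 2 - al * y ^+ 2) / n by rewrite /n; field.
have -> : (z / n) ^+ 2 - al * (w / n) ^+ 2 = n^-1 by rewrite /n; field.
by rewrite e; field.
Qed.

Lemma quat_repM al be ga ga' :
  quat_rep al be ga -> quat_rep al be ga' -> quat_rep al be (ga * ga').
Proof.
case=> x [y [z [w ->]]] [x' [y' [z' [w' ->]]]].
exists (x * x' + al * y * y' + be * (z * z' - al * w * w')),
  (x * y' + y * x' + be * (w * z' - z * w')),
  (x * z' + al * y * w' + z * x' - al * w * y'),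
  (x * w' + y * z' + w * x' - z * y').
by ring.
Qed.

Lemma quat_repX2 al be ga s : quat_rep al be ga -> quat_rep al be (s ^+ 2 * ga).
Proof.
by case=> x [y [z [w ->]]]; exists (s * x), (s * y), (s * z), (s * w); ring.
Qed.

Lemma quat_rep_divl al be ga ga' : ga != 0 ->
  quat_rep al be ga -> quat_rep al be (ga * ga') -> quat_rep al be ga'.
Proof.
move=> ga0 h h'.
have -> : ga' = ga^-1 ^+ 2 * (ga * (ga * ga')) by field.
exact/quat_repX2/quat_repM.
Qed.

(** Triviality of the symbol {u, v, w} in Milnor K-theory modulo 2. The lemmas below are its
    relations: symmetry, multiplicativity and the Steinberg relation. *)
Definition qsym (u v w : int) : Prop := quat_rep u%:~R v%:~R w%:~R.

Lemma qsymC u v w : qsym u v w -> qsym v u w.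
Proof. exact: quat_repC. Qed.

Lemma qsym_swap u v w : v != 0 -> w != 0 -> qsym u v w -> qsym u w v.
Proof. by move=> v0 w0; apply: quat_rep_swap; rewrite intr_eq0. Qed.

Lemma qsym_rot u v w : u != 0 -> v != 0 -> w != 0 -> qsym u v w -> qsym v w u.
Proof. by move=> u0 v0 w0 /qsymC /(qsym_swap u0 w0). Qed.

Lemma qsymM u v w w' : qsym u v w -> qsym u v w' -> qsym u v (w * w').
Proof. by rewrite /qsym rmorphM; apply: quat_repM. Qed.

Lemma qsymMl u u' v w : u != 0 -> u' != 0 -> v != 0 -> w != 0 ->
  qsym u v w -> qsym u' v w -> qsym (u * u') v w.
Proof.
move=> u0 u'0 v0 w0 /(qsym_rot u0 v0 w0) h1 /(qsym_rot u'0 v0 w0) h2.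
apply: qsym_rot => //; first by rewrite mulf_neq0.
by apply: qsym_rot => //; [rewrite mulf_neq0 | apply: qsymM].
Qed.

Lemma qsym_divl u v w w' : w != 0 -> qsym u v w -> qsym u v (w * w') -> qsym u v w'.
Proof.
by move=> w0; rewrite /qsym rmorphM; apply: quat_rep_divl; rewrite intr_eq0.
Qed.

Lemma qsymMl_div u u' v w : u != 0 -> u' != 0 -> v != 0 -> w != 0 ->
  qsym u v w -> qsym (u * u') v w -> qsym u' v w.
Proof.
move=> u0 u'0 v0 w0 /(qsym_rot u0 v0 w0) h1 h2.
have uu0 : u * u' != 0 by rewrite mulf_neq0.
apply: qsym_rot => //; apply: qsym_rot => //.
by apply: (qsym_divl u0 h1); apply: qsym_rot.
Qed.

Lemma qsym_square s v w : s != 0 -> qsym (s * s) v w.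
Proof.
move=> s0; exists ((w%:~R + 1) / 2), ((w%:~R - 1) / 2 / s%:~R), 0, 0.
have : (s%:~R : rat) != 0 by rewrite intr_eq0.
by rewrite rmorphM /= => s0'; field.
Qed.

(** For s = u + v the entries are u / s and v / s, which add up to 1, times s^2. *)
Lemma qsym_steinberg u v w : v != 0 -> u + v != 0 ->
  qsym (u * (u + v)) (v * (u + v)) w.
Proof.
move=> v0 w0; apply: (@quat_rep_norm _ _ _ (u + v)%:~R 1).
  by rewrite intr_eq0 mulf_neq0.
by rewrite !rmorphM !rmorphD /=; ring.
Qed.

Lemma qsym_opp u w : u != 0 -> qsym u (- u) w.
Proof.
move=> u0; apply: (@quat_rep_norm _ _ _ 0 1); first by rewrite intr_eq0 oppr_eq0.
by rewrite rmorphN /=; ring.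
Qed.

Lemma qsym_norm1 u v : u != 0 -> v != 0 -> qsym u (1 - u) v.
Proof.
move=> u0 v0; have [->|n] := eqVneq u 1.
  by have := @qsym_square 1 (1 - 1) v isT; rewrite mulr1.
apply: (@quat_rep_norm _ _ _ 1 1); first by rewrite intr_eq0 subr_eq0 eq_sym.
by rewrite rmorphB /=; ring.
Qed.

(** The symbol is shown to vanish by induction on the largest prime occurring in its entries;
    [smooth N] is the range of step N. *)
Definition smooth (N : nat) (u : int) : Prop :=
  u != 0 /\ forall p : nat, prime p -> (p %| `|u|)%N -> (p <= N)%N.

Lemma smoothM N u v : smooth N u -> smooth N v -> smooth N (u * v).
Proof.
move=> [u0 hu] [v0 hv]; split; first by rewrite mulf_neq0.
by move=> p pp; rewrite abszM Euclid_dvdM // => /orP[]; [apply: hu | apply: hv].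
Qed.

Lemma smooth_small N (a : nat) : (0 < a <= N)%N -> smooth N a.
Proof.
move=> /andP[a0 aN]; split; first by rewrite -lt0n in a0 *; lia.
by move=> p pp /= /dvdn_leq => /(_ a0); lia.
Qed.

Lemma smoothN1 N : smooth N (-1).
Proof. by split => // p pp; rewrite dvdn1 => /eqP e; rewrite e in pp. Qed.

Lemma smooth_ind N (P : int -> Prop) :
  (forall u v, smooth N u -> smooth N v -> P u -> P v -> P (u * v)) ->
  P 1 -> P (-1) -> (forall p : nat, prime p -> (p <= N)%N -> P p) ->
  forall u, smooth N u -> P u.
Proof.
move=> PM P1 PN1 Pp u.
have key (n : nat) : smooth N n -> P n.
  elim/ltn_ind: n => n IH sn.
  have [n1|n1] := leqP n 1.
    have [n0 _] := sn; have -> : n = 1%N by case: n n0 n1 {sn IH} => [|[]].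
    exact: P1.
  have pp := pdiv_prime n1; have pd := pdiv_dvd n.
  have [n0 hn] := sn.
  have pN := hn _ pp pd.
  have e : n = (pdiv n * (n %/ pdiv n))%N by rewrite mulnC divnK.
  have q0 : (0 < n %/ pdiv n)%N by rewrite divn_gt0 ?pdiv_gt0 // dvdn_leq // ltnW.
  have sq : smooth N (n %/ pdiv n)%N.
    split; first by lia.
    by move=> p' pp' /= d; apply: hn => //=; rewrite e dvdn_mull.
  rewrite e PoszM; apply: PM => //.
  - by apply: smooth_small; rewrite prime_gt0.
  - exact: Pp.
  - by apply: IH => //; rewrite ltn_Pdiv ?prime_gt1 // ltnW.
move=> su; have [u0 hu] := su.
case: (intP u) su u0 hu => [|n|n] su u0 hu //; first exact: key.
rewrite -mulN1r; apply: PM.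
- exact: smoothN1.
- by case: su => _ h; split => // p pp d; apply: h => //; rewrite abszN.
- exact: PN1.
- by apply: key; case: su => _ h; split => // p pp d; apply: h => //; rewrite abszN.
Qed.

Lemma Fp_nat (p : nat) (x : 'F_p) : prime p ->
  exists a : nat, (a < p)%N /\ (a%:R : 'F_p) = x.
Proof.
move=> pp; exists (val x); split; last by rewrite natr_Zp.
by apply: (leq_trans (ltn_ord x)); rewrite Fp_cast.
Qed.

Lemma Fp_nat_eq (p a b : nat) : prime p ->
  ((a%:R : 'F_p) == b%:R) = (a == b %[mod p])%N.
Proof. by move=> pp; rewrite -val_eqE /= !val_Fp_nat. Qed.

Section PrimeStep.
Variable p : nat.
Hypothesis pp : prime p.
Hypothesis IH : forall u v w, smooth p.-1 u -> smooth p.-1 v -> smooth p.-1 w ->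
  0 < w -> qsym u v w.

Let p0 : (p : int) != 0.
Proof. by have := prime_gt0 pp; lia. Qed.

Lemma smooth_lt (a : nat) : (0 < a < p)%N -> smooth p.-1 a.
Proof. by move=> h; apply: smooth_small; lia. Qed.

(** The Steinberg relation for a b = c + p r contains p only multiplied by r < p, and the symbol
    with r in place of p vanishes by induction. *)
Lemma step_congr (a b c r : nat) v : (0 < a < p)%N -> (0 < b < p)%N ->
  (0 < c < p)%N -> (a * b = c + p * r)%N -> smooth p.-1 v ->
  qsym (a * b * c)%N v p.
Proof.
move=> ha hb hc e sv; have v0 := sv.1.
have [r0|r0] := posnP r.
  have -> : ((a * b * c)%N : int) = (c : int) * c by rewrite e r0; lia.
  by apply: qsym_square; lia.
have rp : (r < p)%N.
  have : (a * b < p * p)%N by apply: ltn_mul; lia.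
  by rewrite e; nia.
set A := (a * b)%N.
have A0 : (0 < A)%N by rewrite muln_gt0; lia.
have := @qsym_steinberg c (p * r)%N v.
have -> : (c : int) + (p * r)%N = A by rewrite /A e PoszD.
move=> /(_ ltac:(have := prime_gt0 pp; nia) ltac:(lia)) H.

have cA0 : (c : int) * A != 0 by lia.
have prA0 : ((p * r)%N : int) * A != 0 by have := prime_gt0 pp; rewrite mulf_neq0; lia.
have {}H := qsym_swap prA0 v0 H.
have -> : ((A * c)%N : int) = (c : int) * A by lia.
have sA : smooth p.-1 A by rewrite PoszM; apply: smoothM; apply: smooth_lt.
apply: (@qsym_divl _ _ ((r * A)%N : int)); first by lia.
  apply: IH => //; last by lia.
    by apply: smoothM => //; apply: smooth_lt.
  by rewrite PoszM; apply: smoothM => //; apply: smooth_lt; lia.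
by have -> : ((r * A)%N : int) * p = (p * r)%N * A by lia.
Qed.

Let euler (a : nat) : 'F_p := (a%:R : 'F_p) ^+ qhalf 'F_p.

Lemma Fp_neq0 (a : nat) : (0 < a < p)%N -> (a%:R : 'F_p) != 0.
Proof.
move=> h; rewrite (Fp_nat_eq a 0 pp) mod0n modn_small; lia.
Qed.

(** Choose s with s^2 = a modulo p and apply [step_congr] to s * s. *)
Lemma step_residue (a : nat) v : odd p -> (0 < a < p)%N -> euler a = 1 ->
  smooth p.-1 v -> qsym a v p.
Proof.
move=> op ha la sv.
have oF : odd #|'F_p| by rewrite card_Fp.
have [s' es] := qchar_square oF (Fp_neq0 ha) la.
have [s [sp e]] := Fp_nat s' pp.
rewrite -e in es.
have s0 : (0 < s)%N.
  rewrite lt0n; apply/eqP => z; move: (Fp_neq0 ha); by rewrite es z expr0n.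
have : (a%:R : 'F_p) == (s * s)%:R by rewrite es natrM expr2.
rewrite Fp_nat_eq // (modn_small (_ : a < p)%N); last lia.
move=> /eqP ea.
have eq1 : (s * s = a + p * (s * s %/ p))%N.
  by rewrite ea addnC [(p * _)%N]mulnC -divn_eq.
have H := @step_congr s s a _ v ltac:(lia) ltac:(lia) ha eq1 sv.
apply: (@qsymMl_div ((s * s)%N : int)) => //; try lia.
- by case: sv.
- by rewrite PoszM; apply: qsym_square; lia.
Qed.

(** The Steinberg relation for (p - 1) + 1 = p, together with {p, -p, v} = 0. *)
Lemma step_negpred v : v != 0 -> qsym (- (p.-1 : int)) v p.
Proof.
move=> v0; have p1 := prime_gt1 pp.
have H := @qsym_steinberg p.-1 1 v isT.
have e : (p.-1 : int) + 1 = p by lia.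
rewrite e in H; have {}H := H p0; rewrite mul1r in H.
have n0 : (p.-1 : int) * p != 0 by nia.
have {}H := qsym_rot n0 p0 v0 H.
have H2 := qsym_swap (_ : - (p : int) != 0) v0 (qsym_opp v p0).
have {}H2 := H2 ltac:(lia).
apply: qsymC; apply: qsym_rot => //; first by lia.
apply: (qsym_divl _ H2); first by lia.
by have -> : - (p : int) * - (p.-1 : int) = p.-1 * p by lia.
Qed.

Lemma eulerM a b : euler (a * b) = euler a * euler b.
Proof. by rewrite /euler natrM exprMn. Qed.

Lemma euler_mod a : euler (a %% p) = euler a.
Proof.
rewrite /euler; congr (_ ^+ _); apply/eqP.
by rewrite Fp_nat_eq // modn_mod.
Qed.

(** The product a x is congruent to a residue, so {a, v, p} and {x, v, p} agree. *)
Lemma step_nonresidue (a x : nat) v : odd p -> (0 < a < p)%N -> (0 < x < p)%N ->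
  euler a = -1 -> euler x = -1 -> smooth p.-1 v -> qsym x v p -> qsym a v p.
Proof.
move=> op ha hx la lx sv hq.
pose c := ((a * x) %% p)%N.
have c0 : (0 < c)%N.
  rewrite lt0n; apply/negP; rewrite -/(dvdn p _) Euclid_dvdM //.
  by case/orP => /dvdn_leq; lia.
have lc : euler c = 1 by rewrite euler_mod eulerM la lx mulrNN mulr1.
have cp : (c < p)%N by rewrite ltn_mod prime_gt0.
have hc : qsym c v p by apply: step_residue => //; lia.
have eq1 : (a * x = c + p * (a * x %/ p))%N.
  by rewrite addnC [(p * _)%N]mulnC -divn_eq.
have H := @step_congr a x c _ v ha hx ltac:(lia) eq1 sv.
have v0 := sv.1.
apply: (@qsymMl_div ((x : int) * c)) => //; try lia.
- by apply: qsymMl => //; lia.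
- by have -> : (x : int) * c * a = (a * x * c)%N by lia.
Qed.

(** If one of a, b is a residue this is [step_residue]. Two nonresidues may be replaced by any
    two others, and [qchar_steinberg] provides two that add up to 1 modulo p. *)
Lemma step_units (a b : nat) : (0 < a < p)%N -> (0 < b < p)%N -> qsym a b p.
Proof.
move=> ha hb.
have [p2|op] : p = 2%N \/ odd p by case: (even_prime pp); [left|right].
  have -> : a = 1%N by lia.
  exact: (@qsym_square 1).
have oF : odd #|'F_p| by rewrite card_Fp.
have ap c : (0 < c < p)%N -> euler c = 1 \/ euler c = -1.
  by move=> hc; case/orP: (qchar_pm1 oF (Fp_neq0 hc)) => /eqP; [left|right].
have [la|la] := ap a ha; first exact: step_residue (smooth_lt hb).
have [lb|lb] := ap b hb.
  by apply: qsymC; apply: step_residue (smooth_lt ha).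
have [x' [lx ly]] := qchar_steinberg oF.
have [x [xp ex]] := Fp_nat x' pp.
rewrite -ex in lx ly.
have qh := qhalf_gt0 oF.
have x0 : (0 < x)%N.
  rewrite lt0n; apply/eqP => z; move: lx; rewrite z expr0n eqn0Ngt qh /=.
  by move/eqP; rewrite eq_sym oppr_eq0 oner_eq0.
have x1 : x != 1%N.
  apply/eqP => z; move: ly; rewrite z subrr expr0n eqn0Ngt qh /=.
  by move/eqP; rewrite eq_sym oppr_eq0 oner_eq0.
pose y := (p + 1 - x)%N.
have yE : (y%:R : 'F_p) = 1 - x%:R.
  rewrite /y natrB; last lia.
  by rewrite natrD pchar_Fp_0 // add0r.
have hx : (0 < x < p)%N by lia.
have hy : (0 < y < p)%N by rewrite /y; lia.
have {}ly : euler y = -1 by rewrite /euler yE.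
have {}lx : euler x = -1 by [].
have sx := smooth_lt hx.
have hxy : qsym y x p.
  (* (p - 1) (x - 1) = y + p (x - 2), while the symbols of -(p - 1) and of 1 - x with x and p
     vanish. *)
  have H1 := @step_congr p.-1 x.-1 y (x - 2)%N x ltac:(lia) ltac:(lia) hy
    ltac:(rewrite /y; nia) sx.
  have H2 := step_negpred sx.1.
  have H3 := qsymC (@qsym_norm1 x p ltac:(lia) p0).
  have n1 : - (p.-1 : int) != 0 by lia.
  have n2 : 1 - (x : int) != 0 by lia.
  have n3 : ((p.-1 * x.-1 * y)%N : int) != 0 by nia.
  have H4 := qsymMl n1 n2 sx.1 p0 H2 H3.
  have H5 := qsymMl n3 (mulf_neq0 n1 n2) sx.1 p0 H1 H4.
  have n4 : ((p.-1 * x.-1)%N : int) != 0 by nia.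
  have H6 := @qsym_square _ x p n4.
  have n5 : (y : int) != 0 by lia.
  apply: (qsymMl_div (mulf_neq0 n4 n4) n5 sx.1 p0 H6).
  have e1 : 1 - (x : int) = - (x.-1 : int) by lia.
  by move: H5; rewrite e1 mulrNN !PoszM; congr qsym; ring.
have sy := smooth_lt hy; have sa := smooth_lt ha.
apply: qsymC; apply: (@step_nonresidue b y) => //.
by apply: qsymC; apply: (@step_nonresidue a x) => //; apply: qsymC.
Qed.

Lemma step_smooth u v : smooth p.-1 u -> smooth p.-1 v -> qsym u v p.
Proof.
have p1 := prime_gt1 pp.
have N1 (v' : int) : v' = -1 \/ (exists2 b : nat, v' = b & (0 < b < p)%N) ->
    qsym (-1) v' p.
  move=> hv.
  have v0 : v' != 0 by case: hv => [->|[b -> hb]] //; lia.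
  have H : qsym p.-1 v' p.
    case: hv => [->|[b -> hb]]; last by apply: step_units => //; lia.
    have H2 := @step_negpred p.-1 ltac:(lia).
    have H3 := @step_units p.-1 p.-1 ltac:(lia) ltac:(lia).
    apply: qsymC; apply: (@qsymMl_div p.-1) => //; try lia.
    by have -> : (p.-1 : int) * -1 = - (p.-1 : int) by lia.
  have H2 := step_negpred v0.
  apply: (@qsymMl_div p.-1) => //; try lia.
  by have -> : (p.-1 : int) * -1 = - (p.-1 : int) by lia.
have hq (q : nat) : prime q -> (q <= p.-1)%N -> (0 < q < p)%N.
  by move=> /prime_gt0; lia.
move=> su sv; elim/smooth_ind: su => {u} [u u' su su' hu hu'|||q pq qp].
- by apply: qsymMl => //; [case: su|case: su'|case: sv].
- exact: (@qsym_square 1).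
- elim/smooth_ind: sv => {v} [v v' sv sv' hv hv'|||q pq qp].
  + by apply: qsymC; apply: qsymMl; [case: sv|case: sv'| |lia|exact: qsymC|exact: qsymC].
  + by apply: N1; right; exists 1%N => //; lia.
  + by apply: N1; left.
  + by apply: N1; right; exists q => //; apply: hq.
- elim/smooth_ind: sv => {v} [v v' sv sv' hv hv'|||q' pq' qp'].
  + have q0 : (q : int) != 0 by have := hq _ pq qp; lia.
    by apply: qsymC; apply: qsymMl; [case: sv|case: sv'| |lia|exact: qsymC|exact: qsymC].
  + by apply: step_units; [exact: hq|lia].
  + by apply: qsymC; apply: N1; right; exists q => //; apply: hq.
  + by apply: step_units; exact: hq.
Qed.

(** {p, u, p} = {p, u, -1} because {p, -p} = 0. *)
Lemma step_self u : smooth p.-1 u -> qsym p u p.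
Proof.
move=> su; have u0 := su.1.
have H1 : qsym p u (- (p : int)) by apply: qsym_swap; [lia| |exact: qsym_opp].
have H2 : qsym p u (-1).
  have H := step_smooth su (smoothN1 _).
  exact: (qsym_rot _ p0 u0 (qsym_rot u0 _ p0 H)).
by have := qsymM H1 H2; have -> : - (p : int) * -1 = p by lia.
Qed.

Lemma smooth_ind_top (P : int -> Prop) :
  (forall u v, smooth p u -> smooth p v -> P u -> P v -> P (u * v)) ->
  (forall u, smooth p.-1 u -> P u) -> P p -> forall u, smooth p u -> P u.
Proof.
move=> PM Ps Pp u; apply: (@smooth_ind p P) => {u} [u v|||].
- exact: PM.
- by apply: Ps; apply: (@smooth_small _ 1); have := prime_gt1 pp; lia.
- by apply: Ps; exact: smoothN1.
- move=> q pq qp; have [->|n] := eqVneq q p; first exact: Pp.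
  by apply: Ps; apply: smooth_small; have := prime_gt0 pq; lia.
Qed.

Lemma step_top u v : smooth p u -> smooth p v -> qsym u v p.
Proof.
move=> su sv; elim/smooth_ind_top: su => {u} [u u' su su' hu hu'|u su|].
- by apply: qsymMl => //; [case: su|case: su'|case: sv].
- elim/smooth_ind_top: sv => {v} [v v' sv sv' hv hv'|v sv|].
  + by apply: qsymC; apply: qsymMl; [case: sv|case: sv'|case: su|lia|exact: qsymC|exact: qsymC].
  + exact: step_smooth.
  + by apply: qsymC; apply: step_self.
- elim/smooth_ind_top: sv => {v} [v v' sv sv' hv hv'|v sv|].
  + by apply: qsymC; apply: qsymMl; [case: sv|case: sv'| |lia|exact: qsymC|exact: qsymC]; lia.
  + exact: step_self.
  + have H1 := @qsym_opp p p p0.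
    have H2 : qsym p p (- (p : int)) by apply: qsym_swap => //; lia.
    have H3 : qsym p p (-1).
      apply: qsym_swap => //; apply: step_self; exact: smoothN1.
    by have := qsymM H2 H3; have -> : - (p : int) * -1 = p by lia.
Qed.

Lemma step_all u v w : smooth p u -> smooth p v -> smooth p w -> 0 < w ->
  qsym u v w.
Proof.
move=> su sv; case: w => // w sw w0.
have {}w0 : (0 < w)%N by lia.
elim/ltn_ind: w w0 sw => w IHw w0 sw.
have [pw|pw] := boolP (p %| w)%N.
  have e : w = (p * (w %/ p))%N by rewrite mulnC divnK.
  have q0 : (0 < w %/ p)%N by rewrite divn_gt0 ?prime_gt0 // dvdn_leq.
  rewrite e PoszM; apply: qsymM; first exact: step_top.
  apply: IHw => //; first by rewrite ltn_Pdiv ?prime_gt1.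
  split; first by lia.
  by move=> q pq d; apply: sw.2 => //=; rewrite e dvdn_mull.
have {sw IHw}sw : smooth p.-1 w.
  split; first by lia.
  move=> q pq d; have := sw.2 q pq d; rewrite leq_eqVlt => /orP[/eqP eq|]; last lia.
  by move: d pw; rewrite eq /= => ->.
have w0' : (w : int) != 0 by lia.
have sw' : smooth p w by split => // q pq d; have := sw.2 q pq d; lia.
elim/smooth_ind_top: su => {u} [u u' su su' hu hu'|u su|].
- by apply: qsymMl => //; [case: su|case: su'|case: sv].
- elim/smooth_ind_top: sv => {v} [v v' sv sv' hv hv'|v sv|].
  + by apply: qsymC; apply: qsymMl; [case: sv|case: sv'|case: su| |exact: qsymC|exact: qsymC].
  + by apply: IH => //; lia.
  + apply: qsym_swap => //; apply: step_top => //.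
    by case: su => u0 h; split => // q pq d; have := h q pq d; lia.
- by apply: qsymC; apply: qsym_swap => //; apply: step_top.
Qed.

End PrimeStep.

Lemma qsym_smooth N u v w : smooth N u -> smooth N v -> smooth N w -> 0 < w ->
  qsym u v w.
Proof.
elim: N u v w => [|N IH] u v w su sv sw w0.
  have -> : w = 1.
    case: sw w0; case: w => // -[//|[//|n]] _ h _.
    have pp : prime (pdiv n.+2) by exact: pdiv_prime.
    by have := h _ pp (pdiv_dvd _); have := prime_gt0 pp; lia.
  by exists 1, 0, 0, 0; ring.
have [pN|npN] := boolP (prime N.+1); first exact: (@step_all N.+1).
suff red x : smooth N.+1 x -> smooth N x by apply: IH; rewrite ?red //; apply: red.
move=> [x0 h]; split => // q pq d.
have := h q pq d; rewrite leq_eqVlt => /orP[/eqP eq|]; last by lia.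
by move: npN; rewrite -eq pq.
Qed.

(** Symbols of length three over Q only have an obstruction at the real place, and w > 0 removes
    it. *)
Theorem qsym_pos u v w : u != 0 -> v != 0 -> 0 < w -> qsym u v w.
Proof.
move=> u0 v0 w0; pose N := (`|u| + `|v| + `|w|)%N.
have sm x : x != 0 -> (`|x| <= N)%N -> smooth N x.
  move=> x0 xN; split=> // p pp /dvdn_leq; rewrite absz_gt0 => /(_ x0); lia.
by apply: (@qsym_smooth N) => //; apply: sm => //; rewrite /N; lia.
Qed.

Lemma rat_sqr_int (a : rat) : exists m : int, exists2 s : rat, s != 0 & m%:~R = a * s ^+ 2.
Proof.
exists (numq a * denq a), (denq a)%:~R; first by rewrite intr_eq0 denq_neq0.
rewrite -[X in _ = X * _](divq_num_den a) rmorphM /=.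
have : ((denq a)%:~R : rat) != 0 by rewrite intr_eq0 denq_neq0.
by move=> d0; field.
Qed.

Lemma quat_rep_pos al be ga : al != 0 -> be != 0 -> 0 < ga -> quat_rep al be ga.
Proof.
move=> al0 be0 ga0.
have [a [s s0 ea]] := rat_sqr_int al; have [b [t t0 eb]] := rat_sqr_int be.
have [c [r r0 ec]] := rat_sqr_int ga.
have a0 : a != 0 by rewrite -(intr_eq0 rat) ea mulf_neq0 // expf_neq0.
have b0 : b != 0 by rewrite -(intr_eq0 rat) eb mulf_neq0 // expf_neq0.
have c0 : 0 < c by rewrite -(ltr0z rat) ec pmulr_rgt0 // exprn_even_gt0 // r0.
have [x [y [z [w e]]]] := qsym_pos a0 b0 c0.
rewrite ea eb ec in e.
exists (x / r), (y * s / r), (z * t / r), (w * s * t / r).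
apply: (mulIf (expf_neq0 2 r0)); rewrite e.
by field.
Qed.

(** The quotient c / a is a reduced norm from the quaternion algebra (-D, -b / a). In other
    words, positive definite hermitian planes over Q(sqrt(-D)) represent all positive rationals. *)
Theorem binary_hermitian_universal (D a b c : rat) :
  0 < D -> 0 < a -> 0 < b -> 0 < c ->
  exists x y z w : rat,
    a * (x ^+ 2 + D * y ^+ 2) + b * (z ^+ 2 + D * w ^+ 2) = c.
Proof.
move=> D0 a0 b0 c0.
have ba0 : - (b / a) != 0 by rewrite oppr_eq0 gt_eqF // divr_gt0.
have DN0 : - D != 0 by rewrite oppr_eq0 gt_eqF.
have [x [y [z [w e]]]] := quat_rep_pos DN0 ba0 (divr_gt0 c0 a0).
exists x, y, z, w.
have a0' : a != 0 by rewrite gt_eqF.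
have -> : c = a * (c / a) by field.
by rewrite e; field.
Qed.

Corollary four_squares (c : rat) : 0 < c ->
  exists x y z w : rat, x ^+ 2 + y ^+ 2 + z ^+ 2 + w ^+ 2 = c.
Proof.
move=> c0; have [x [y [z [w e]]]] := @binary_hermitian_universal 1 1 1 c isT isT isT c0.
by exists x, y, z, w; rewrite -e; ring.
Qed.

(** * Quadratic reciprocity *)

Definition qchar (F : finFieldType) (x : F) : int :=
  if x == 0 then 0 else if x ^+ qhalf F == 1 then 1 else -1.

Lemma qchar0 (F : finFieldType) : qchar (0 : F) = 0.
Proof. by rewrite /qchar eqxx. Qed.

Lemma qchar_exp (F : finFieldType) (x : F) : odd #|F| ->
  (qchar x)%:~R = x ^+ qhalf F.
Proof.
move=> o; rewrite /qchar; have [->|x0] := eqVneq x 0.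
  by rewrite expr0n eqn0Ngt qhalf_gt0.
by case/orP: (qchar_pm1 o x0) => /eqP ->; rewrite ?eqxx // eq_sym (negbTE (one_neqN1 o)) rmorphN.
Qed.

Lemma qchar_cases (F : finFieldType) (x : F) : x != 0 ->
  qchar x = 1 \/ qchar x = -1.
Proof. by rewrite /qchar => /negbTE ->; case: ifP; [left|right]. Qed.

Lemma pm1_inj (F : finFieldType) (K : fieldType) (m n : int) :
  (1 : K) != -1 -> (m = 1 \/ m = -1) -> (n = 1 \/ n = -1) ->
  (m%:~R : K) = n%:~R -> m = n.
Proof.
move=> n1 [->|->] [->|->] //; rewrite !rmorphN /= ?rmorph1 => /eqP.
  by rewrite (negbTE n1).
by rewrite eq_sym (negbTE n1).
Qed.

Lemma qcharM (F : finFieldType) (x y : F) : odd #|F| ->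
  qchar (x * y) = qchar x * qchar y.
Proof.
move=> o; have [->|x0] := eqVneq x 0; first by rewrite mul0r qchar0 mul0r.
have [->|y0] := eqVneq y 0; first by rewrite mulr0 qchar0 mulr0.
apply: (@pm1_inj F F) => //; first exact: one_neqN1.
- by apply: qchar_cases; rewrite mulf_neq0.
- by case: (qchar_cases x0) => ->; case: (qchar_cases y0) => ->; rewrite ?mulrNN; [left|right|right|left].
by rewrite rmorphM /= !qchar_exp // exprMn.
Qed.

Lemma qchar_sum (F : finFieldType) : odd #|F| -> \sum_(x : F) qchar x = 0.
Proof.
move=> o; have [g gN] := qchar_nonsquare o.
have g0 : g != 0.
  apply/eqP => z; move: gN; rewrite z expr0n eqn0Ngt qhalf_gt0 //= => /eqP.
  by rewrite eq_sym oppr_eq0 oner_eq0.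
have cg : qchar g = -1.
  by rewrite /qchar (negbTE g0) gN eq_sym (negbTE (one_neqN1 o)).
have e : \sum_(x : F) qchar x = - \sum_(x : F) qchar x.
  rewrite {1}(reindex_inj (mulfI g0)) /= -sumrN; apply: eq_bigr => x _.
  by rewrite qcharM // cg mulN1r.
by lia.
Qed.

Section GaussSum.
Variables (p q : nat).
Hypotheses (pp : prime p) (pq : prime q) (op : odd p) (oq : odd q) (npq : p != q).

(** Let z be a p-th root of unity in an algebraic closure of F_q, and tau the Gauss sum of the
    quadratic character modulo p. Frobenius multiplies tau by the symbol of q modulo p, while
    tau^2 is p up to sign; so the symbol decides whether that number is a square in F_q. *)
Lemma gauss_reciprocity : qchar (q%:R : 'F_p) = qchar (((-1) ^+ qhalf 'F_p * p%:R) : 'F_q).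
Proof.
have oFp : odd #|'F_p| by rewrite card_Fp.
have oFq : odd #|'F_q| by rewrite card_Fp.
have [K [f _]] := countable_algebraic_closure 'F_q.
have chK : q \in [pchar K] by rewrite (rmorph_pchar f) // pchar_Fp.
have K1N1 : (1 : K) != -1.
  rewrite -(rmorph1 f) -rmorphN (inj_eq (fmorph_inj f)); exact: one_neqN1.
have pK0 : (p%:R : K) != 0.
  rewrite -(dvdn_pcharf chK); apply/negP; rewrite dvdn_prime2 // eq_sym.
  by apply/negP.
have [z [z1 zp]] : exists z : K, z != 1 /\ z ^+ p = 1.
  have /closed_rootP[z rz] : size (\poly_(i < p) (1 : K)) != 1%N.
    rewrite size_poly_eq ?oner_eq0 //; by apply/eqP => e; move: pp; rewrite e.
  have zs : \sum_(i < p) z ^+ i = 0.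
    move: rz; rewrite rootE horner_poly => /eqP rz; rewrite -[RHS]rz.
    by apply: eq_bigr => i _; rewrite mul1r.
  exists z; split.
    apply/eqP => e; move: zs pK0; rewrite e.
    rewrite (eq_bigr (fun=> 1)) => [|i _]; last by rewrite expr1n.
    by rewrite sumr_const card_ord => ->; rewrite eqxx.
  by apply/eqP; rewrite -subr_eq0 subrX1 zs mulr0.
pose e (a : 'F_p) : K := z ^+ (val a).
have zmod n : z ^+ (n %% p) = z ^+ n by rewrite [in RHS](divn_eq n p) exprD mulnC exprM zp expr1n mul1r.
have enat n : e n%:R = z ^+ n by rewrite /e (_ : val _ = n %% p)%N ?zmod // -val_Fp_nat.
have eD a b : e (a + b) = e a * e b.
  have [m [_ <-]] := Fp_nat a pp; have [n [_ <-]] := Fp_nat b pp.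
  by rewrite -natrD !enat exprD.
have e0 : e 0 = 1 by rewrite -[0]/(0%:R) enat.
have e1 : e 1 = z by rewrite -[1]/(1%:R) enat.
have esum (c : 'F_p) : \sum_(a : 'F_p) e (a * c) = if c == 0 then p%:R else 0.
  have [->|c0] := eqVneq c 0.
    rewrite (eq_bigr (fun=> 1)) => [|a _]; last by rewrite mulr0 e0.
    by rewrite sumr_const card_Fp.
  rewrite -(reindex_inj (mulIf c0) (P := xpredT) (F := e)) /=.
  have : (z - 1) * \sum_(a : 'F_p) e a = 0.
    rewrite mulrBl mul1r mulr_sumr.
    rewrite (eq_bigr (fun a => e (1 + a))) => [|a _]; last by rewrite eD e1.
    by rewrite -(reindex_inj (addrI 1) (P := xpredT) (F := e)) subrr.
  by move/eqP; rewrite mulf_eq0 subr_eq0 (negbTE z1) => /eqP.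
pose ch (a : 'F_p) : K := (qchar a)%:~R.
have chM a b : ch (a * b) = ch a * ch b by rewrite /ch qcharM // rmorphM.
have ch0 : ch 0 = 0 by rewrite /ch qchar0.
have chsum : \sum_(a : 'F_p) ch a = 0 by rewrite -rmorph_sum /= qchar_sum.
pose tau (t : 'F_p) := \sum_(a : 'F_p) ch a * e (a * t).
have chq (a : 'F_p) : ch a ^+ q = ch a.
  have [->|a0] := eqVneq a 0; first by rewrite ch0 expr0n eqn0Ngt prime_gt0.
  rewrite /ch; case: (qchar_cases a0) => ->; rewrite ?rmorphN rmorph1 ?expr1n //.
  by rewrite -signr_odd oq expr1.
have ch2 (a : 'F_p) : a != 0 -> ch a * ch a = 1.
  by move=> a0; rewrite /ch; case: (qchar_cases a0) => ->; rewrite ?rmorphN rmorph1 ?mulrNN mulr1.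
have q0 : (q%:R : 'F_p) != 0.
  have : p \in [pchar 'F_p] by rewrite pchar_Fp.
  move=> h; rewrite -(dvdn_pcharf h) dvdn_prime2 //.
have chq0 : ch q%:R * ch q%:R = 1 by exact: ch2.
(* Frobenius replaces z by z^q, which amounts to a |-> q a in the sum. *)
have tauq : tau 1 ^+ q = ch q%:R * tau 1.
  rewrite -(pFrobenius_autE chK) rmorph_sum /=.
  rewrite (eq_bigr (fun a => ch a * e (a * q%:R))) => [|a _]; last first.
    rewrite rmorphM /= !pFrobenius_autE chq mulr1; congr (_ * _).
    have [m [_ <-]] := Fp_nat a pp.
    by rewrite -natrM !enat exprM.
  rewrite -[LHS]mul1r -chq0 -mulrA; congr (_ * _).
  rewrite mulr_sumr /tau [RHS](reindex_inj (mulIf q0)) /=.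
  by apply: eq_bigr => a _; rewrite mulr1 mulrA -chM mulrC [q%:R * _]mulrC mulrC.
(* Substitute b = a c in the double sum over a and b; the sum over a then detects c = -1. *)
have tau2 : tau 1 * tau 1 = ch (-1) * p%:R.
  transitivity (\sum_(a : 'F_p) \sum_(c : 'F_p)
      (if a == 0 then 0 else ch c * e (a * (1 + c)))).
    rewrite {1}/tau mulr_suml; apply: eq_bigr => a _.
    have [->|a0] := eqVneq a 0; first by rewrite ch0 !mul0r big1.
    rewrite /tau mulr_sumr (reindex_inj (mulfI a0)) /=; apply: eq_bigr => c _.
    rewrite !mulr1 chM mulrDr mulr1 eD.
    transitivity (ch a * ch a * (ch c * (e a * e (a * c)))); first by ring.
    by rewrite ch2 // mul1r.
  rewrite exchange_big /=.
  transitivity (\sum_(c : 'F_p) ch c * ((if c == -1 then p%:R else 0) - 1)).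
    apply: eq_bigr => c _.
    have -> : (if c == -1 then p%:R else 0) = \sum_(a : 'F_p) e (a * (1 + c)).
      by rewrite esum addrC addr_eq0.
    rewrite [in RHS](bigD1 (0 : 'F_p)) //= mul0r e0 addrAC subrr add0r mulr_sumr.
    rewrite (bigD1 (0 : 'F_p)) //= ?eqxx add0r.
    by apply: eq_bigr => a /negbTE ->.
  rewrite (eq_bigr (fun c => (if c == -1 then ch (-1) * p%:R else 0) - ch c)).
    by rewrite sumrB chsum subr0 -big_mkcond big_pred1_eq.
  by move=> c _; case: eqP => [->|_]; rewrite mulrBr ?mulr0 mulr1.
have chN1 : ch (-1) = f ((-1) ^+ qhalf 'F_p).
  rewrite /ch rmorphXn rmorphN rmorph1 /=.
  have n0 : (-1 : 'F_p) != 0 by rewrite oppr_eq0 oner_eq0.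
  rewrite /qchar (negbTE n0) -signr_odd -[in RHS]signr_odd.
  case: (odd _); rewrite ?expr0 ?expr1 ?eqxx ?rmorph1 //.
  by rewrite eq_sym (negbTE (one_neqN1 oFp)) rmorphN.
set ps : 'F_q := (-1) ^+ qhalf 'F_p * p%:R.
have tau2' : tau 1 ^+ 2 = f ps by rewrite expr2 tau2 chN1 rmorphM /= rmorph_nat.
have ps0 : ps != 0.
  rewrite mulf_neq0 ?expf_neq0 ?oppr_eq0 ?oner_eq0 //.
  have : q \in [pchar 'F_q] by rewrite pchar_Fp.
  move=> h; rewrite -(dvdn_pcharf h) dvdn_prime2 // eq_sym //.
have tau0 : tau 1 != 0 by rewrite -sqrf_eq0 tau2' fmorph_eq0.
apply: (@pm1_inj 'F_p K) => //.
- exact: qchar_cases.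
- exact: qchar_cases.
apply: (mulIf tau0); rewrite -/(ch _) -tauq.
have -> : ((qchar ps)%:~R : K) = f (ps ^+ qhalf 'F_q).
  by rewrite -qchar_exp // rmorph_int.
rewrite rmorphXn /= -tau2' -exprM -exprSr; congr (_ ^+ _).
by rewrite mul2n -qhalfE // card_Fp // prednK ?prime_gt0.
Qed.
End GaussSum.

(** * A prime at which two characters take the value -1 *)

(** Dirichlet convolution. *)
Definition dconv (f g : nat -> int) (m : nat) : int :=
  \sum_(d <- divisors m) f d * g (m %/ d)%N.

Lemma divisors_coprime_mul (u v : nat) : (0 < u)%N -> (0 < v)%N -> coprime u v ->
  perm_eq (divisors (u * v)) [seq (a * b)%N | a <- divisors u, b <- divisors v].
Proof.
move=> u0 v0 cuv; have uv0 : (0 < u * v)%N by rewrite muln_gt0 u0.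
apply: uniq_perm; first exact: divisors_uniq.
  apply: allpairs_uniq; rewrite ?divisors_uniq // => -[a b] [c d] /=.
  move=> /allpairsP[[a' b'] /= [ha hb [-> ->]]] /allpairsP[[c' d'] /= [hc hd [-> ->]]].
  rewrite -!dvdn_divisors // in ha hb hc hd *.
  move=> e; have co x y : (x %| u)%N -> (y %| v)%N -> coprime x y.
    by move=> xu yv; apply: (coprime_dvdl xu); apply: (coprime_dvdr yv).
  have ac : a' = c'.
    apply/eqP; rewrite eqn_dvd -(Gauss_dvdl _ (co _ _ ha hd)) -e dvdn_mulr //=.
    by rewrite -(Gauss_dvdl _ (co _ _ hc hb)) e dvdn_mulr.
  have bd : b' = d'.
    apply/eqP; rewrite eqn_dvd.
    have := co _ _ hc hb; have := co _ _ ha hd; rewrite coprime_sym => h1; rewrite coprime_sym => h2.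
    by rewrite -(Gauss_dvdr _ h2) -e dvdn_mull //= -(Gauss_dvdr _ h1) e dvdn_mull.
  by rewrite ac bd.
move=> d; rewrite -dvdn_divisors //; apply/idP/allpairsP => [duv|[[a b] /= [ha hb ->]]].
  exists (gcdn d u, gcdn d v); rewrite /= -!dvdn_divisors // !dvdn_gcdr; split=> //.
  apply/eqP; rewrite eqn_dvd; apply/andP; split.
    by rewrite muln_gcdr dvdn_gcd dvdn_mull // muln_gcdl dvdn_gcd dvdn_mulr //.
  rewrite Gauss_dvd ?dvdn_gcdl //.
  by apply: (coprime_dvdl (dvdn_gcdr _ _)); apply: (coprime_dvdr (dvdn_gcdr _ _)).
by rewrite -!dvdn_divisors // in ha hb; apply: dvdn_mul.
Qed.

Section TwoCharacters.
Variables f g : nat -> int.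
Hypothesis fM : forall a b, f (a * b)%N = f a * f b.
Hypothesis gM : forall a b, g (a * b)%N = g a * g b.
Hypothesis f1 : f 1%N = 1.
Hypothesis g1 : g 1%N = 1.
Hypothesis fv : forall a, [\/ f a = 1, f a = -1 | f a = 0].
Hypothesis gv : forall a, [\/ g a = 1, g a = -1 | g a = 0].
Hypothesis fg0 : forall a, (f a == 0) = (g a == 0).
Hypothesis no : forall q, prime q -> ~ (f q = -1 /\ g q = -1).

Lemma dconv_mul u v : (0 < u)%N -> (0 < v)%N -> coprime u v ->
  dconv f g (u * v) = dconv f g u * dconv f g v.
Proof.
move=> u0 v0 cuv.
rewrite /dconv (perm_big _ (divisors_coprime_mul u0 v0 cuv)) big_allpairs_dep /=.
rewrite mulr_suml; apply: eq_big_seq => a ha; rewrite mulr_sumr.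
apply: eq_big_seq => b hb; rewrite -dvdn_divisors // in ha hb *.
rewrite -dvdn_divisors // in hb.
rewrite fM -(divnK ha) -{1}(divnK hb).
have a0 : (0 < a)%N := dvdn_gt0 u0 ha; have b0 : (0 < b)%N := dvdn_gt0 v0 hb.
have -> : (u %/ a * a * (v %/ b * b) = (u %/ a * (v %/ b)) * (a * b))%N by lia.
by rewrite mulnK ?muln_gt0 ?a0 // gM mulnK //; ring.
Qed.

Lemma dconv_primeX q j : prime q -> 
  dconv f g (q ^ j) = \sum_(i < j.+1) f q ^+ i * g q ^+ (j - i).
Proof.
move=> pq.
have fX (F : nat -> int) : (forall a b, F (a * b)%N = F a * F b) -> F 1%N = 1 ->
    forall n, F (q ^ n)%N = F q ^+ n.
  by move=> FM F1; elim=> [|n IHn]; rewrite ?expn0 ?F1 // expnS FM IHn exprS.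
have -> : dconv f g (q ^ j) = \sum_(d <- [seq (q ^ i)%N | i <- iota 0 j.+1]) f d * g (q ^ j %/ d)%N.
  apply: perm_big; apply: uniq_perm; first exact: divisors_uniq.
    rewrite map_inj_uniq ?iota_uniq // => a b /eqP; rewrite eqn_exp2l ?prime_gt1 //.
    by move/eqP.
  move=> d; rewrite -dvdn_divisors ?expn_gt0 ?prime_gt0 //.
  apply/(dvdn_pfactor _ _ pq)/mapP => [[i ij ->]|[n]].
    by exists i => //; rewrite mem_iota.
  by rewrite mem_iota add0n ltnS => nj ->; exists n.
rewrite big_map -{1}[j.+1]subn0 -/(index_iota 0 j.+1) big_mkord.
apply: eq_bigr => i _; rewrite fX // -expnB ?prime_gt0 ?fX //.
by have := ltn_ord i; lia.
Qed.

(** Unless f and g are both -1 at q, the terms f(q)^i g(q)^(j-i) alternate in sign or none of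
    them is negative. *)
Lemma dconv_primeX_ge q j : prime q -> 0 <= dconv f g (q ^ j) /\
  (f q != 0 -> ~~ odd j -> 1 <= dconv f g (q ^ j)).
Proof.
move=> pq; rewrite dconv_primeX //.
have alt n : \sum_(i < n) (-1 : int) ^+ i = (odd n)%:R.
  elim: n => [|n IHn]; rewrite ?big_ord0 // big_ord_recr /= IHn -signr_odd.
  by case: (odd n); rewrite ?expr1 ?expr0; lia.
have := @no q pq; have := fg0 q.
case: (fv q) => ->; case: (gv q) => -> //= _ H.
- rewrite (eq_bigr (fun=> 1)) => [|i _]; last by rewrite !expr1n.
  by rewrite sumr_const card_ord; split=> [|_ _]; lia.
- rewrite (reindex_inj rev_ord_inj) /=.
  rewrite (eq_bigr (fun i : 'I_j.+1 => (-1) ^+ i)) => [|i _].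
    by rewrite alt /=; split=> [|_ ->]; [case: odd|].
  by rewrite expr1n mul1r; congr (_ ^+ _); have := ltn_ord i; lia.
- rewrite (eq_bigr (fun i : 'I_j.+1 => (-1) ^+ i)) => [|i _].
    by rewrite alt /=; split=> [|_ ->]; [case: odd|].
  by rewrite expr1n mulr1.
- by case: H.
- split => //; apply: sumr_ge0 => i _.
  by case: (j - i)%N => [|n]; rewrite ?expr0 ?mulr1 ?expr0n ?mulr0 //; case: (nat_of_ord i).
Qed.

(** By multiplicativity the coefficients of L(s, f) L(s, g) are nonnegative, and at least 1 at
    the squares of numbers where f does not vanish. *)
Lemma dconv_ge m : (0 < m)%N -> 0 <= dconv f g m /\
  (f m != 0 -> (forall q, prime q -> ~~ odd (logn q m)) -> 1 <= dconv f g m).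
Proof.
elim/ltn_ind: m => m IH m0.
have [m1|m1] := leqP m 1.
  have -> : m = 1%N by lia.
  by rewrite /dconv /= big_cons big_nil f1 g1.
pose q := pdiv m; have pq : prime q by exact: pdiv_prime.
have qm : (q %| m)%N by exact: pdiv_dvd.
have [n cqn e] := pfactor_coprime pq m0.
set j := logn q m in e.
have j0 : (0 < j)%N by rewrite logn_gt0 mem_primes pq m0 qm.
have n0 : (0 < n)%N by move: m0; rewrite e muln_gt0 => /andP[].
have qj0 : (1 < q ^ j)%N by rewrite -(exp1n j) ltn_exp2r ?prime_gt1.
have nm : (n < m)%N by rewrite e -{1}[n]muln1 ltn_pmul2l.
have cnq : coprime n (q ^ j) by rewrite coprimeXr // coprime_sym.
rewrite [in dconv _ _ m]e dconv_mul //; last by lia.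
have [h1 h2] := IH n nm n0; have [h3 h4] := @dconv_primeX_ge q j pq.
split; first exact: mulr_ge0.
rewrite [in f m]e fM mulf_eq0 negb_or => /andP[fn fqj] hodd.
have fq : f q != 0 by move: fqj; rewrite -(prednK j0) expnS fM mulf_eq0 negb_or => /andP[].
have := h4 fq (hodd q pq).
have : 1 <= dconv f g n.
  apply: h2 => // r pr; have [->|nrq] := eqVneq r q.
    by rewrite (_ : logn q n = 0%N) // logn_coprime.
  have := hodd r pr; rewrite e lognM // ?expn_gt0 ?prime_gt0 // lognX.
  by rewrite (_ : logn r q = 0%N) ?muln0 ?addn0 // logn_prime // (negbTE nrq).
by nia.
Qed.

End TwoCharacters.

(** Summation by parts against the decreasing weights w. *)
Lemma abel_bound (R : realDomainType) (f w : nat -> R) (C : R) (k n : nat) :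
  (forall a, (k <= a)%N -> w a.+1 <= w a) -> (forall a, 0 <= w a) ->
  (forall j, `|\sum_(k <= a < j) f a| <= C) -> 0 <= C ->
  `|\sum_(k <= a < n) f a * w a| <= C * w k.
Proof.
move=> wd w0 hC C0; have [nk|kn] := leqP n k.
  by rewrite big_geq // normr0 mulr_ge0.
suff [E eE hE] : exists2 E, \sum_(k <= a < n) f a * w a =
    (\sum_(k <= a < n) f a) * w n + E & `|E| <= C * (w k - w n).
  rewrite eE (le_trans (ler_normD _ _)) // normrM (ger0_norm (w0 n)).
  have -> : C * w k = C * w n + C * (w k - w n) by ring.
  by apply: lerD => //; apply: ler_wpM2r.
rewrite -(subnKC (ltnW kn)); elim: (n - k)%N => [|m [E eE hE]].
  by exists 0; rewrite addn0 ?big_geq // ?mul0r ?addr0 // normr0 subrr mulr0.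
rewrite addnS !big_nat_recr ?leq_addr //= eE.
set P := \sum_(k <= i < k + m) f i.
exists (E + (P + f (k + m)%N) * (w (k + m)%N - w (k + m).+1)); first by ring.
rewrite (le_trans (ler_normD _ _)) // normrM.
have wd' := wd (k + m)%N (leq_addr _ _).
rewrite (@ger0_norm _ (_ - _)) ?subr_ge0 //.
have -> : C * (w k - w (k + m).+1) =
  C * (w k - w (k + m)%N) + C * (w (k + m)%N - w (k + m).+1) by ring.
apply: lerD => //; apply: ler_wpM2r; first by rewrite subr_ge0.
by have := hC (k + m).+1; rewrite big_nat_recr ?leq_addr.
Qed.

Lemma periodic_sum_bound (f : nat -> int) (M k j : nat) : (0 < M)%N ->
  (forall a, f (a + M)%N = f a) -> (forall a, `|f a| <= 1) ->
  \sum_(0 <= a < M) f a = 0 ->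
  `|\sum_(k <= a < j) f a| <= (2 * M)%N.
Proof.
move=> M0 fp f1 fs.
have pre n : `|\sum_(0 <= a < n) f a| <= M.
  elim/ltn_ind: n => n IH; have [nM|Mn] := ltnP n M.
    rewrite (le_trans (ler_norm_sum _ _ _)) //.
    rewrite (le_trans (ler_sum _ (fun a _ => f1 a))) // big_mkord sumr_const card_ord.
    by lia.
  rewrite (big_cat_nat _ Mn) //= fs add0r.
  rewrite -{1}[M]add0n -(subnK Mn) big_addn addnK.
  rewrite (eq_bigr f) => [|a _]; last exact: fp.
  by apply: IH; lia.
have [jk|kj] := leqP j k; first by rewrite big_geq // normr0; lia.
have e : \sum_(k <= a < j) f a = \sum_(0 <= a < j) f a - \sum_(0 <= a < k) f a.
  by rewrite (@big_cat_nat _ _ _ k 0 j xpredT f) ?(ltnW kj) //=; ring.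
by rewrite e (le_trans (ler_normB _ _)) //; have := pre j; have := pre k; lia.
Qed.

Section Hyperbola.
Variables (R : rcfType) (f g : nat -> int) (M : nat).
Hypothesis M0 : (0 < M)%N.
Hypothesis f1 : forall a, `|f a| <= 1.
Hypothesis g1 : forall a, `|g a| <= 1.
Hypothesis fp : forall a, f (a + M)%N = f a.
Hypothesis gp : forall a, g (a + M)%N = g a.
Hypothesis fs : \sum_(0 <= a < M) f a = 0.
Hypothesis gs : \sum_(0 <= a < M) g a = 0.

Definition isqrt (a : nat) : R := (Num.sqrt a%:R)^-1.

Lemma isqrtM a b : isqrt (a * b) = isqrt a * isqrt b.
Proof. by rewrite /isqrt natrM sqrtrM ?ler0n // invfM. Qed.

Lemma isqrt_ge0 a : 0 <= isqrt a.
Proof. by rewrite invr_ge0 sqrtr_ge0. Qed.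

Lemma isqrt_anti a b : (0 < a)%N -> (a <= b)%N -> isqrt b <= isqrt a.
Proof.
move=> a0 ab; rewrite lef_pV2 ?posrE ?sqrtr_gt0 ?ltr0n //; last by lia.
by rewrite ler_sqrt ?ler_nat ?ler0n.
Qed.

Lemma sum_isqrt n : \sum_(1 <= a < n.+1) isqrt a <= 2 * Num.sqrt n%:R.
Proof.
elim: n => [|n IH]; first by rewrite big_geq // sqrtr0 mulr0.
rewrite big_nat_recr //= (le_trans (lerD IH (lexx _))) //.
set s := Num.sqrt n%:R; set t := Num.sqrt n.+1%:R.
have t0 : 0 < t by rewrite sqrtr_gt0 ltr0n.
have s0 : 0 <= s := sqrtr_ge0 _.
have es : s ^+ 2 = n%:R by rewrite sqr_sqrtr ?ler0n.
have et : t ^+ 2 = n%:R + 1 by rewrite sqr_sqrtr ?ler0n // -natr1.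
rewrite /isqrt -/t -(ler_pM2r t0) mulrDl mulVf ?gt_eqF //.
by have := sqr_ge0 (s - t); nra.
Qed.

Lemma char_tail (F : nat -> int) k n : (forall a, `|F a| <= 1) ->
  (forall a, F (a + M)%N = F a) -> \sum_(0 <= a < M) F a = 0 -> (0 < k)%N ->
  `|\sum_(k <= a < n) (F a)%:~R * isqrt a| <= (2 * M)%:R * isqrt k.
Proof.
move=> F1 Fp Fs k0; apply: abel_bound.
- by move=> a ka; apply: isqrt_anti; lia.
- exact: isqrt_ge0.
- move=> j; rewrite -rmorph_sum /= -intr_norm -[(2 * M)%:R]/(((2 * M)%N : int)%:~R) ler_int.
  exact: periodic_sum_bound.
- exact: ler0n.
Qed.

Lemma dconvE X m : (0 < m <= X)%N ->
  dconv f g m = \sum_(1 <= a < X.+1) \sum_(1 <= b < X.+1 | (a * b == m)%N) f a * g b.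
Proof.
move=> /andP[m0 mX].
transitivity (\sum_(1 <= a < X.+1 | (a %| m)%N) f a * g (m %/ a)%N).
  rewrite /dconv -[RHS]big_filter; apply: perm_big; apply: uniq_perm.
  - exact: divisors_uniq.
  - by rewrite filter_uniq // iota_uniq.
  move=> d; rewrite mem_filter -dvdn_divisors // mem_index_iota ltnS.
  case dm: (d %| m)%N => //=; have := dvdn_leq m0 dm; have := dvdn_gt0 m0 dm; lia.
rewrite big_mkcond; apply: eq_big_nat => a /andP[a0 aX].
have [am|am] := boolP (a %| m)%N; last first.
  rewrite big1 // => b /eqP e; case/negP: am; rewrite -e; exact: dvdn_mulr.
rewrite -big_filter.
have -> : [seq b <- index_iota 1 X.+1 | (a * b == m)%N] = [:: (m %/ a)%N].
  apply: perm_small_eq => //; apply: uniq_perm => //.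
    by rewrite filter_uniq // iota_uniq.
  move=> b; rewrite mem_filter mem_index_iota inE.
  have e : (a * (m %/ a) = m)%N by rewrite mulnC divnK.
  apply/andP/eqP => [[/eqP e' _]|->].
    by rewrite -e' mulKn.
  rewrite e eqxx; split => //.
  have := leq_div m a; have : (0 < m %/ a)%N by rewrite divn_gt0 // dvdn_leq.
  by lia.
by rewrite big_seq1.
Qed.

(** The hyperbola method of Dirichlet: the sum over a b <= N^2 is split into a, b <= N and two
    parts where one factor exceeds N. There the character sum over the large factor is O(1 /
    sqrt N), which compensates the sum of 1 / sqrt a over a <= N. *)
Lemma hyperbola_bound N : (0 < N)%N ->
  `|\sum_(1 <= m < (N * N).+1) (dconv f g m)%:~R * isqrt m|
    <= ((2 * M) * (2 * M) + 8 * M)%:R.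
Proof.
move=> N0; have [X eX] : {X | X = (N * N)%N} by exists (N * N)%N.
rewrite -eX.
pose u a := (f a)%:~R * isqrt a; pose v a := (g a)%:~R * isqrt a.
have NX : (N <= X)%N by rewrite eX; nia.
have -> : \sum_(1 <= m < X.+1) (dconv f g m)%:~R * isqrt m =
    \sum_(1 <= a < X.+1) \sum_(1 <= b < X.+1 | (a * b <= X)%N) u a * v b.
  transitivity (\sum_(1 <= m < X.+1) \sum_(1 <= a < X.+1) \sum_(1 <= b < X.+1)
     (if (a * b == m)%N then u a * v b else 0)).
    apply: eq_big_nat => m mX; rewrite (dconvE mX) rmorph_sum /= mulr_suml.
    apply: eq_bigr => a _; rewrite rmorph_sum /= mulr_suml big_mkcond.
    apply: eq_bigr => b _; case: eqP => // <-.
    by rewrite isqrtM /u /v rmorphM /=; ring.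
  rewrite exchange_big /=; apply: eq_big_nat => a aX.
  rewrite exchange_big /= [RHS]big_mkcond; apply: eq_big_nat => b bX.
  rewrite -big_mkcond /=; case: leqP => abX.
    rewrite -big_filter (_ : [seq _ <- _ | _] = [:: (a * b)%N]) ?big_seq1 //.
    apply: perm_small_eq => //; apply: uniq_perm => //.
      by rewrite filter_uniq // iota_uniq.
    move=> m; rewrite mem_filter mem_index_iota inE.
    apply/andP/eqP => [[/eqP e _]|->]; first exact: esym e.
    by split; [exact/eqP|lia].
  by rewrite big_nat_cond big1 // => m; case: eqP => [<-|]; rewrite ?andbF // andbT; lia.
have trunc (F : nat -> R) k a : (0 < a)%N ->
   \sum_(k <= b < X.+1 | (a * b <= X)%N) F b = \sum_(k <= b < (X %/ a).+1) F b.
  move=> a0; have h : ((X %/ a).+1 <= X.+1)%N by rewrite ltnS leq_div.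
  rewrite (big_nat_widen _ _ _ _ _ h); apply: eq_bigl => b.
  by rewrite ltnS leq_divRL // mulnC.
have split1 : \sum_(1 <= a < X.+1) \sum_(1 <= b < X.+1 | (a * b <= X)%N) u a * v b =
   (\sum_(1 <= a < N.+1) u a) * (\sum_(1 <= b < N.+1) v b)
   + \sum_(1 <= a < N.+1) u a * (\sum_(N.+1 <= b < (X %/ a).+1) v b)
   + \sum_(1 <= b < N.+1) v b * (\sum_(N.+1 <= a < (X %/ b).+1) u a).
  rewrite (@big_cat_nat _ _ _ N.+1) //=; congr (_ + _).
    rewrite mulr_suml -big_split /=; apply: eq_big_nat => a /andP[a0 aN].
    rewrite (trunc (fun b => u a * v b)) // (@big_cat_nat _ _ _ N.+1) //=.
      by rewrite !mulr_sumr.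
    by rewrite ltnS leq_divRL // eX leq_mul.
  transitivity (\sum_(N.+1 <= a < X.+1) \sum_(1 <= b < N.+1) if (a * b <= X)%N then u a * v b else 0).
    apply: eq_big_nat => a /andP[aN _].
    rewrite big_mkcond (@big_cat_nat _ _ _ N.+1) //= [X in _ + X]big_nat_cond.
    rewrite [X in _ + X]big1 ?addr0 // => b; rewrite andbT => hb.
    by case: leqP => //; rewrite eX; nia.
  rewrite exchange_big /=; apply: eq_big_nat => b /andP[b0 bN].
  rewrite -big_mkcond /= mulr_sumr -(trunc (fun a => v b * u a)) //.
  by apply: eq_big => [a|a _]; [rewrite mulnC|rewrite mulrC].
rewrite split1.
have bu : `|\sum_(1 <= a < N.+1) u a| <= (2 * M)%:R.
  by have := @char_tail f 1 N.+1 f1 fp fs isT; rewrite {2}/isqrt sqrtr1 invr1 mulr1.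
have bv : `|\sum_(1 <= a < N.+1) v a| <= (2 * M)%:R.
  by have := @char_tail g 1 N.+1 g1 gp gs isT; rewrite {2}/isqrt sqrtr1 invr1 mulr1.
have cross (F G : nat -> int) : (forall a, `|F a| <= 1) -> (forall a, `|G a| <= 1) ->
    (forall a, G (a + M)%N = G a) -> \sum_(0 <= a < M) G a = 0 ->
    `|\sum_(1 <= a < N.+1) (F a)%:~R * isqrt a *
       (\sum_(N.+1 <= b < (X %/ a).+1) (G b)%:~R * isqrt b)| <= (4 * M)%:R.
  move=> F1 G1 Gp Gs; rewrite (le_trans (ler_norm_sum _ _ _)) //.
  have h a : `|(F a)%:~R * isqrt a * (\sum_(N.+1 <= b < (X %/ a).+1) (G b)%:~R * isqrt b)|
      <= (2 * M)%:R * isqrt N * isqrt a.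
    rewrite 2!normrM (ger0_norm (isqrt_ge0 a)) -intr_norm.
    have := @char_tail G N.+1 (X %/ a).+1 G1 Gp Gs isT.
    have := @isqrt_anti N N.+1 N0 (leqnSn _).
    have : (`|F a|%:~R : R) <= 1 by rewrite -[1]/(1%:~R) ler_int.
    have : (0 : R) <= `|F a|%:~R by rewrite ler0z.
    have := isqrt_ge0 a; have := isqrt_ge0 N; have := isqrt_ge0 N.+1.
    set A := `|\sum_(_ <= _ < _) _|; have : 0 <= A := normr_ge0 _.
    set K := (2 * M)%:R; have : 0 <= K by rewrite ler0n.
    move: (isqrt a) (isqrt N) (isqrt N.+1) (_%:~R) A K => wa wN wN1 fa A K K0 A0 N10 Nn0 a0 fa0 fa1 hN hA.
    have h1 : A <= K * wN by apply: (le_trans hA); apply: ler_wpM2l.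
    rewrite -[leRHS]mul1r; have -> : 1 * (K * wN * wa) = (1 * wa) * (K * wN) by ring.
    by apply: ler_pM => //; [apply: mulr_ge0|apply: ler_wpM2r].
  rewrite (le_trans (ler_sum _ (fun a _ => h a))) // -mulr_sumr.
  rewrite (le_trans (ler_wpM2l _ (sum_isqrt N))) ?mulr_ge0 ?ler0n ?isqrt_ge0 //.
  have sN : Num.sqrt (N%:R : R) != 0 by rewrite gt_eqF // sqrtr_gt0 ltr0n.
  rewrite /isqrt -mulrA [_^-1 * _]mulrCA mulVf // mulr1 -natrM ler_nat; lia.
have h1 : `|\sum_(1 <= a < N.+1) u a * (\sum_(N.+1 <= b < (X %/ a).+1) v b)| <= (4 * M)%:R.
  exact: cross.
have h2 : `|\sum_(1 <= b < N.+1) v b * (\sum_(N.+1 <= a < (X %/ b).+1) u a)| <= (4 * M)%:R.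
  exact: cross.
rewrite (le_trans (ler_normD _ _)) // (le_trans (lerD (ler_normD _ _) (lexx _))) //.
have -> : ((2 * M * (2 * M) + 8 * M)%:R : R) = (2 * M)%:R * (2 * M)%:R + (4 * M)%:R + (4 * M)%:R.
  by rewrite -natrM -!natrD; congr (_%:R); lia.
by rewrite normrM !lerD // ler_pM.
Qed.
End Hyperbola.

Lemma harmonic_dyadic (R : realFieldType) k :
  (k%:R / 2 : R) <= \sum_(0 <= j < 2 ^ k) (j.+1%:R)^-1.
Proof.
elim: k => [|k IH]; first by rewrite mul0r sumr_ge0 // => i _; rewrite invr_ge0 ler0n.
have h2 : (2 ^ k <= 2 ^ k.+1)%N by rewrite leq_exp2l.
rewrite (big_cat_nat _ h2) //= -natr1 mulrDl lerD //.
have -> : (1 / 2 : R) = \sum_(2 ^ k <= j < 2 ^ k.+1) ((2 ^ k.+1)%:R)^-1.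
  rewrite sumr_const_nat expnS mul2n -addnn addnK -mulr_natl natrD.
  have : ((2 ^ k)%:R : R) != 0 by rewrite pnatr_eq0 -lt0n expn_gt0.
  by move=> z; field; rewrite -mulr2n mulrn_eq0.
apply: ler_sum_nat => j /andP[_ hj].
by rewrite lef_pV2 ?posrE ?ltr0n ?expn_gt0 // ler_nat.
Qed.

(** If no such prime exists, the convolution of f and g is nonnegative, and at least 1 at the
    squares of the numbers 1 + j M. With the weights 1 / sqrt m these squares contribute a
    harmonic series, against the bound [hyperbola_bound]. This takes the place of the theorem of
    Dirichlet on primes in arithmetic progressions. *)
Theorem two_characters (R : rcfType) (f g : nat -> int) (M : nat) : (0 < M)%N ->
  (forall a b, f (a * b)%N = f a * f b) -> (forall a b, g (a * b)%N = g a * g b) ->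
  f 1%N = 1 -> g 1%N = 1 ->
  (forall a, [\/ f a = 1, f a = -1 | f a = 0]) ->
  (forall a, [\/ g a = 1, g a = -1 | g a = 0]) ->
  (forall a, (f a == 0) = (g a == 0)) ->
  (forall a, f (a + M)%N = f a) -> (forall a, g (a + M)%N = g a) ->
  \sum_(0 <= a < M) f a = 0 -> \sum_(0 <= a < M) g a = 0 ->
  exists q, prime q /\ f q = -1 /\ g q = -1.
Proof.
move=> M0 fM gM f1 g1 fv gv fg0 fp gp fs gs.
apply: contrapT => no.
have {}no q : prime q -> ~ (f q = -1 /\ g q = -1) by move=> pq h; apply: no; exists q.
have bd (F : nat -> int) : (forall a, [\/ F a = 1, F a = -1 | F a = 0]) -> forall a, `|F a| <= 1.
  by move=> Fv a; case: (Fv a) => ->.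
(* The first 2^(2 M (C + 1)) terms of the harmonic series exceed M C. *)
set C := ((2 * M) * (2 * M) + 8 * M)%N.
pose J := (2 ^ (2 * M * C.+1))%N.
pose N := (1 + J * M)%N.
have N0 : (0 < N)%N by [].
have := @hyperbola_bound R f g M M0 (bd f fv) (bd g gv) fp gp fs gs N N0.
rewrite -/C => hb; move: (le_trans (ler_norm _) hb); apply/negP; rewrite -ltNge.
pose s := [seq ((1 + j * M) * (1 + j * M))%N | j <- index_iota 0 J].
pose F m : R := (dconv f g m)%:~R * isqrt R m.
have inj : {in index_iota 0 J &, injective (fun j => (1 + j * M) * (1 + j * M))%N}.
  by move=> a b _ _ /= /eqP; rewrite !mulnn eqn_exp2r // eqn_add2l eqn_pmul2r // => /eqP.
have us : uniq s by rewrite map_inj_in_uniq ?iota_uniq.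
have hh m (m0 : (0 < m)%N) := dconv_ge fM gM f1 g1 fv gv fg0 no m0.
have per j : f (1 + j * M)%N = 1.
  by elim: j => [|j IHj]; rewrite ?mul0n ?addn0 // mulSn addnCA addnC fp.
apply: (@lt_le_trans _ _ (\sum_(m <- s) F m)); last first.
  rewrite [leRHS](bigID (fun m => m \in s)) /=.
  have -> : \sum_(m <- s) F m = \sum_(1 <= m < (N * N).+1 | m \in s) F m.
    rewrite -[RHS]big_filter; apply: perm_big; apply: uniq_perm => //.
      by rewrite filter_uniq // iota_uniq.
    move=> m; rewrite mem_filter; case ms: (m \in s) => //=.
    move/mapP: ms => [j]; rewrite !mem_index_iota => /andP[_ jJ] ->.
    have : (1 + j * M <= N)%N by rewrite /N leq_add2l leq_mul2r ltnW ?orbT.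
    by move=> h; rewrite muln_gt0 /= ltnS leq_mul.
  rewrite lerDl big_nat_cond sumr_ge0 // => m /andP[/andP[m0 _] _].
  rewrite /F mulr_ge0 ?isqrt_ge0 // ler0z; exact: (hh m m0).1.
rewrite big_map.
apply: (@lt_le_trans _ _ (\sum_(0 <= j < J) M%:R^-1 * (j.+1%:R)^-1)); last first.
  apply: ler_sum_nat => j _; rewrite /F.
  set t := (1 + j * M)%N; have t0 : (0 < t)%N by [].
  have d1 : 1 <= dconv f g (t * t).
    apply: (hh _ _).2; first by rewrite muln_gt0 t0.
      by rewrite fM per.
    by move=> q pq; rewrite lognM // addnn odd_double.
  have w : isqrt R (t * t) = t%:R^-1.
    rewrite isqrtM /isqrt -invfM -expr2 sqr_sqrtr ?ler0n //.
  rewrite w -[X in X <= _]mul1r ler_pM ?mulr_ge0 ?invr_ge0 ?ler0n ?ler1z //.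
  rewrite -invfM -natrM lef_pV2 ?posrE ?ltr0n ?muln_gt0 ?M0 // ler_nat /t; nia.
rewrite -mulr_sumr mulrC ltr_pdivlMr ?ltr0n //.
apply: lt_le_trans (harmonic_dyadic _ _).
rewrite ltr_pdivlMr // -!natrM ltr_nat; nia.
Qed.

(** * Unimodular ternary forms *)

(** The symmetric matrix with diagonal (a, b, c) and entries d, e, f at the places 12, 13, 23 is
    the Gram matrix of three vectors u, v, w of Z^3. *)
Definition gram3 (a b c d e f : int) : Prop :=
  exists u1 u2 u3 v1 v2 v3 w1 w2 w3 : int,
  [/\ u1 * u1 + u2 * u2 + u3 * u3 = a, v1 * v1 + v2 * v2 + v3 * v3 = b,
      w1 * w1 + w2 * w2 + w3 * w3 = c &
  [/\ u1 * v1 + u2 * v2 + u3 * v3 = d, u1 * w1 + u2 * w2 + u3 * w3 = e &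
      v1 * w1 + v2 * w2 + v3 * w3 = f]].

Lemma gram3_swap12 a b c d e f : gram3 b a c d f e -> gram3 a b c d e f.
Proof.
move=> [u1 [u2 [u3 [v1 [v2 [v3 [w1 [w2 [w3 [h1 h2 h3 [h4 h5 h6]]]]]]]]]]].
exists v1, v2, v3, u1, u2, u3, w1, w2, w3; split=> //; split=> //.
by rewrite -h4; ring.
Qed.

Lemma gram3_swap23 a b c d e f : gram3 a c b e d f -> gram3 a b c d e f.
Proof.
move=> [u1 [u2 [u3 [v1 [v2 [v3 [w1 [w2 [w3 [h1 h2 h3 [h4 h5 h6]]]]]]]]]]].
exists u1, u2, u3, w1, w2, w3, v1, v2, v3; split=> //; split=> //.
by rewrite -h6; ring.
Qed.

(** Elementary changes of basis; together with permutations they suffice for reduction. *)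
Lemma gram3_shift23 k a b c d e f :
  gram3 a b (c + 2 * k * f + k * k * b) d (e + k * d) (f + k * b) -> gram3 a b c d e f.
Proof.
move=> [u1 [u2 [u3 [v1 [v2 [v3 [w1 [w2 [w3 [h1 h2 h3 [h4 h5 h6]]]]]]]]]]].
exists u1, u2, u3, v1, v2, v3, (w1 - k * v1), (w2 - k * v2), (w3 - k * v3).
split=> //; last (split=> //; first by rewrite -[e](addrK (k * d)) -h5 -h4; ring).
  have -> : c = c + 2 * k * f + k * k * b - 2 * k * (f + k * b) + k * k * b by ring.
  by rewrite -h3 -h6 -h2; ring.
by rewrite -[f](addrK (k * b)) -h6 -h2; ring.
Qed.

Lemma gram3_shift12 k a b c d e f :
  gram3 a (b + 2 * k * d + k * k * a) c (d + k * a) e (f + k * e) -> gram3 a b c d e f.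
Proof.
move=> [u1 [u2 [u3 [v1 [v2 [v3 [w1 [w2 [w3 [h1 h2 h3 [h4 h5 h6]]]]]]]]]]].
exists u1, u2, u3, (v1 - k * u1), (v2 - k * u2), (v3 - k * u3), w1, w2, w3.
split=> //; last split=> //.
- have -> : b = b + 2 * k * d + k * k * a - 2 * k * (d + k * a) + k * k * a by ring.
  by rewrite -h2 -h4 -h1; ring.
- by rewrite -[d](addrK (k * a)) -h4 -h1; ring.
- by rewrite -[f](addrK (k * e)) -h6 -h5; ring.
Qed.

Lemma gram3_shift13 k a b c d e f :
  gram3 a b (c + 2 * k * e + k * k * a) d (e + k * a) (f + k * d) -> gram3 a b c d e f.
Proof.
by move=> H; apply: gram3_swap23; apply: (@gram3_shift12 k); apply: gram3_swap23.
Qed.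

Lemma centered_mod (x m : int) : 0 < m -> exists k, - m <= 2 * (x + k * m) <= m.
Proof.
move=> m0; exists (- ((2 * x + m) %/ (2 * m))%Z).
have := divz_eq (2 * x + m) (2 * m).
have : 0 <= ((2 * x + m) %% (2 * m))%Z < 2 * m.
  by rewrite modz_ge0 ?ltz_pmod //; lia.
by move: (_ %% _)%Z (_ %/ _)%Z => r q; nia.
Qed.

Lemma four_sqr_le (x m : int) : - m <= 2 * x -> 2 * x <= m -> 4 * (x * x) <= m * m.
Proof. by move=> h1 h2; nia. Qed.

Lemma gram2_unimodular (n : nat) (b c f : int) : (`|b| <= n)%N ->
  0 < b -> b * c - f * f = 1 -> gram3 1 b c 0 0 f.
Proof.
elim: n b c f => [|n IH] b c f bn b0 det; first by lia.
have [k /andP[k1 k2]] := centered_mod f b0.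
apply: (@gram3_shift23 k); rewrite mulr0 addr0.
set f' := f + k * b in k1 k2 *; set c' := c + _ + _.
have det' : b * c' - f' * f' = 1 by rewrite -det /c' /f'; ring.
have ff := four_sqr_le k1 k2.
have c0 : 0 < c' by nia.
have [cb|bc] := ltrP c' b.
  apply: gram3_swap23; apply: IH => //; first by lia.
  by rewrite -det'; ring.
have bb : 3 * (b * b) <= 4 by nia.
have b1 : b = 1 by nia.
have f0 : f' = 0 by nia.
have c1 : c' = 1 by rewrite b1 f0 in det'; lia.
by rewrite b1 f0 c1; exists 1, 0, 0, 0, 1, 0, 0, 0, 1.
Qed.

Definition det3 (a b c d e f : int) :=
  a * b * c + 2 * d * e * f - a * (f * f) - b * (e * e) - c * (d * d).

(** Hermite reduction. Let A = a b - d^2, B = a f - d e and C = a c - e^2, so that A C - B^2 = a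
    when the determinant is 1. If 3 A^2 > 4 a, making |B| <= A / 2 yields C < A, and exchanging
    the last two vectors lowers A. Otherwise A is so small that making |d| <= a / 2 lowers a,
    unless a = 1. *)
Theorem gram3_unimodular (a b c d e f : int) : 0 < a -> 0 < a * b - d * d ->
  det3 a b c d e f = 1 -> gram3 a b c d e f.
Proof.
move=> a0; move: {2}(absz a) (leqnn (absz a)) => n.
elim: n a a0 b c d e f => [|n IH] a a0 b c d e f an; first by lia.
move: {2}(absz (a * b - d * d)%R) (leqnn (absz (a * b - d * d)%R)) => m.
elim: m b c d e f => [|m IHm] b c d e f Am A0 det; first by lia.
set A := a * b - d * d in Am A0.
have [small|big] := lerP (3 * (A * A)) (4 * a); last first.
  pose B := a * f - d * e.
  have [k /andP[k1 k2]] := centered_mod B A0.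
  apply: (@gram3_shift23 k); apply: gram3_swap23.
  set c' := c + _ + _; set e' := e + _; set f' := f + _.
  have det' : det3 a c' b e' d f' = 1 by rewrite -det /det3 /c' /e' /f'; ring.
  have eB : a * f' - d * e' = B + k * A by rewrite /B /A /f' /e'; ring.
  set B' := B + k * A in k1 k2 eB.
  set C := a * c' - e' * e'.
  have AC : A * C - B' * B' = a.
    by rewrite -eB /C /A -[RHS]mulr1 -det' /det3; ring.
  have BB := four_sqr_le k1 k2.
  have C0 : 0 < C by rewrite -(pmulr_rgt0 _ A0); move: (sqr_ge0 B'); rewrite expr2; lia.
  have CA : C < A.
    rewrite ltNge; apply/negP => AC'; have : A * A <= A * C by apply: ler_wpM2l => //; lia.
    by lia.
  by apply: IHm => //; rewrite -/C; lia.
have [a1|a2] : a = 1 \/ 2 <= a by lia.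
  apply: (@gram3_shift12 (- d)); apply: (@gram3_shift13 (- e)).
  rewrite a1 !mulr1 !subrr.
  rewrite mulr0 addr0; apply: (@gram2_unimodular _ _ _ _ (leqnn _)).
    by move: A0; rewrite /A a1; lia.
  by move: det; rewrite /det3 a1 => det; rewrite -[RHS]det; ring.
have [k /andP[k1 k2]] := centered_mod d a0.
apply: (@gram3_shift12 k); apply: gram3_swap12.
set b' := b + _ + _; set d' := d + _; set f' := f + _.
have eA : a * b' - d' * d' = A by rewrite /A /b' /d'; ring.
have dd := four_sqr_le k1 k2.
have b0 : 0 < b' by rewrite -(pmulr_rgt0 _ a0); move: (sqr_ge0 d'); rewrite expr2; lia.
have ba : b' < a.
  rewrite ltNge; apply/negP => ab; have h : a * a <= a * b' by apply: ler_wpM2l => //; lia.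
  have h1 : 3 * (a * a) <= 4 * A by lia.
  have h2 : (3 * (a * a)) * (3 * (a * a)) <= (4 * A) * (4 * A) by apply: ler_pM => //; nia.
  have h3 : 27 * (a * a * a) * a <= 64 * a by nia.
  have h4 : 27 * (a * a * a) <= 64 by nia.
  by nia.
apply: IH => //; first by lia.
- by rewrite mulrC eA.
- by rewrite -det /det3 /b' /d' /f'; ring.
Qed.

(** The matrix with rows (D, b, 0), (b, c, g), (0, g, h) has determinant 1, so it is a Gram
    matrix, and n = D c - b^2 is the squared length of the cross product of the first two
    vectors. *)
Corollary three_squares_of_gram (D b c g h n : int) : 0 < D -> 0 < n ->
  D * c - b * b = n -> n * h - D * (g * g) = 1 ->
  exists x y z : int, x * x + y * y + z * z = n.
Proof.
move=> D0 n0 e1 e2.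
have [] := @gram3_unimodular D c h b 0 g D0.
- by rewrite e1.
- by rewrite /det3 -e2 -e1; ring.
move=> u1 [u2 [u3 [v1 [v2 [v3 [w1 [w2 [w3 [h1 h2 _ [h4 _ _]]]]]]]]]].
exists (u2 * v3 - u3 * v2), (u3 * v1 - u1 * v3), (u1 * v2 - u2 * v1).
by rewrite -e1 -h1 -h2 -h4; ring.
Qed.

(** * Sums of three squares *)

Lemma periodic_mod (F : nat -> int) M a : (forall b, F (b + M)%N = F b) ->
  F (a %% M)%N = F a.
Proof.
move=> Fp; rewrite [in RHS](divn_eq a M) addnC.
by elim: (a %/ M)%N => [|k IHk]; rewrite ?mul0n ?addn0 // mulSn addnCA addnC Fp.
Qed.

(** Multiplication by a permutes the residues modulo M and changes the sign of the sum. *)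
Lemma character_sum0 (F : nat -> int) M a : (0 < M)%N ->
  (forall b c, F (b * c)%N = F b * F c) -> (forall b, F (b + M)%N = F b) ->
  coprime a M -> F a = -1 -> \sum_(0 <= m < M) F m = 0.
Proof.
move=> M0 FM Fp aM Fa; rewrite big_mkord.
pose s (i : 'I_M) : 'I_M := Ordinal (ltn_pmod (a * i) M0).
have si : injective s.
  move=> i j /(congr1 val) /= /eqP e; apply: val_inj => /=.
  have : (val i = val j %[mod M])%N.
    apply/eqP; wlog ij : i j e / (j <= i)%N.
      move=> W; case/orP: (leq_total j i) => h; first exact: W.
      by rewrite eq_sym; apply: W => //; rewrite eq_sym.
    by move: e; rewrite !eqn_mod_dvd // ?leq_mul // -mulnBr Gauss_dvdr // coprime_sym.
  by rewrite !modn_small ?ltn_ord.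
have e : \sum_(i < M) F i = - \sum_(i < M) F i.
  rewrite {1}(reindex_inj si) -sumrN; apply: eq_bigr => i _ /=.
  by rewrite periodic_mod // FM Fa mulN1r.
by move: e; set t := \sum_(i < M) F i; lia.
Qed.

(** The Legendre symbol of m modulo p. *)
Definition leg (p m : nat) : int := qchar (m%:R : 'F_p).

(** The nontrivial character modulo 4. *)
Definition chi4 (m : nat) : int := if (m %% 4 == 1)%N then 1 else if (m %% 4 == 3)%N then -1 else 0.

Lemma chi4M a b : chi4 (a * b) = chi4 a * chi4 b.
Proof.
rewrite /chi4 -modnMm; have := ltn_pmod a (isT : 0 < 4)%N; have := ltn_pmod b (isT : 0 < 4)%N.
by case: (a %% 4)%N => [|[|[|[|]]]] //; case: (b %% 4)%N => [|[|[|[|]]]].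
Qed.

Lemma chi4D a : chi4 (a + 4) = chi4 a.
Proof. by rewrite /chi4 modnDr. Qed.

Lemma chi4_cases a : odd a -> chi4 a = 1 \/ chi4 a = -1.
Proof.
move=> oa; rewrite /chi4; have : (a %% 4 = 1 \/ a %% 4 = 3)%N by lia.
by case=> ->; [left|right].
Qed.

Lemma leg_per p m k : prime p -> leg p (m + p * k) = leg p m.
Proof.
move=> pp; rewrite /leg; congr qchar; apply/eqP.
by rewrite Fp_nat_eq // mulnC modnMDl addnC modnMDl || rewrite Fp_nat_eq // addnC mulnC modnMDl.
Qed.

Lemma leg_mul p a b : prime p -> odd p -> leg p (a * b) = leg p a * leg p b.
Proof. by move=> pp op; rewrite /leg natrM qcharM // card_Fp. Qed.

Lemma leg1 p : prime p -> leg p 1 = 1.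
Proof. by move=> pp; rewrite /leg /qchar oner_eq0 expr1n eqxx. Qed.

Lemma leg_cases p a : prime p -> ~~ (p %| a)%N -> leg p a = 1 \/ leg p a = -1.
Proof.
move=> pp pa; apply: qchar_cases.
by rewrite (Fp_nat_eq a 0 pp) mod0n.
Qed.

Lemma leg_nonresidue p : prime p -> odd p -> exists2 a, (~~ (p %| a))%N & leg p a = -1.
Proof.
move=> pp op; have oF : odd #|'F_p| by rewrite card_Fp.
have [g gN] := qchar_nonsquare oF; have [a [_ e]] := Fp_nat g pp.
have g0 : g != 0.
  apply/eqP => z; move: gN; rewrite z expr0n eqn0Ngt qhalf_gt0 //= => /eqP.
  by rewrite eq_sym oppr_eq0 oner_eq0.
exists a; first by move: g0; rewrite -e (Fp_nat_eq a 0 pp) mod0n.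
by rewrite /leg e /qchar (negbTE g0) gN eq_sym (negbTE (one_neqN1 oF)).
Qed.

Lemma prod_pm1 (I : Type) (r : seq I) (P : pred I) (F : I -> int) :
  (forall i, P i -> F i = 1 \/ F i = -1) ->
  \prod_(i <- r | P i) F i = 1 \/ \prod_(i <- r | P i) F i = -1.
Proof.
move=> H; elim: r => [|x r IH]; first by rewrite big_nil; left.
rewrite big_cons; case: ifP => // Px.
by case: (H x Px) => ->; case: IH => ->; [left|right|right|left].
Qed.

Section Characters.
Variable ps : seq nat.
Hypothesis ups : uniq ps.
Hypothesis pps : forall p, p \in ps -> prime p /\ odd p.
Let n := (\prod_(p <- ps) p)%N.
Let M := (4 * n)%N.

Lemma prod_gt0 : (0 < n)%N.
Proof. by apply: prodn_cond_gt0_seq || (rewrite /n big_seq; apply: prodn_cond_gt0 => p /pps[/prime_gt0]). Qed.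

Lemma prod_odd : odd n.
Proof.
rewrite /n; elim: (ps) (pps) => [|p r IH] h; first by rewrite big_nil.
rewrite big_cons oddM (h p (mem_head _ _)).2 /= IH // => q qr.
by apply: h; rewrite inE qr orbT.
Qed.

Lemma mem_dvd p : p \in ps -> (p %| n)%N.
Proof. by move=> h; rewrite /n (big_rem p h) dvdn_mulr. Qed.

Lemma coprime_M a : coprime a M -> odd a /\ forall p, p \in ps -> ~~ (p %| a)%N.
Proof.
rewrite coprimeMr => /andP[a4 an]; split.
  by move: a4; rewrite (coprimeXr_odd) || (rewrite -[4%N]/(2 ^ 2)%N coprime_pexpr // coprimen2).
move=> p pin; apply/negP => pa; have [pp _] := pps pin.
have : (p %| gcdn a n)%N by rewrite dvdn_gcd pa mem_dvd.
by move: an; rewrite /coprime => /eqP ->; rewrite dvdn1 => /eqP e; move: pp; rewrite e.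
Qed.

Definition legprod (S : pred nat) (m : nat) : int := \prod_(p <- ps | S p) leg p m.

Lemma legprodM S a b : legprod S (a * b) = legprod S a * legprod S b.
Proof.
rewrite /legprod !(big_mkcond S) -big_split /= big_seq [RHS]big_seq.
apply: eq_bigr => p pin; case: ifP => _; last by rewrite mulr1.
by have [pp op] := pps pin; rewrite leg_mul.
Qed.

Lemma legprod_per S m : legprod S (m + M) = legprod S m.
Proof.
rewrite /legprod big_seq_cond [RHS]big_seq_cond; apply: eq_bigr => p /andP[pin _].
have [pp op] := pps pin; have /dvdnP[k e] := mem_dvd pin.
by rewrite /M e (_ : 4 * (k * p) = p * (4 * k))%N ?leg_per //; lia.
Qed.

Lemma legprod1 S : legprod S 1 = 1.
Proof. by rewrite /legprod big_seq_cond big1 // => p /andP[/pps[pp _] _]; apply: leg1. Qed.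

Lemma legprod_cases S m : coprime m M -> legprod S m = 1 \/ legprod S m = -1.
Proof.
move=> /coprime_M[_ h]; rewrite /legprod big_seq_cond.
apply: prod_pm1 => p /andP[pin _]; have [pp _] := pps pin.
exact: leg_cases (h p pin).
Qed.

Let ind m : int := if coprime m M then 1 else 0.

Lemma indM a b : ind (a * b) = ind a * ind b.
Proof. by rewrite /ind coprimeMl; do 2!case: coprime. Qed.

Lemma ind_per a : ind (a + M) = ind a.
Proof. by rewrite /ind -coprime_modl modnDr coprime_modl. Qed.

(** The characters [legprod S] and chi4 times the Legendre symbols outside S are both
    nontrivial, so [two_characters] makes them -1 at a common prime q. Their product there is 1;
    by reciprocity this says that -n is a square modulo q when n = 1 modulo 4 (see [split_sqr]). *)
Theorem split_prime (R : rcfType) (S : pred nat) (p0 : nat) : p0 \in ps -> S p0 ->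
  exists q, [/\ prime q, coprime q M, legprod S q = -1 &
    chi4 q * legprod xpredT q = 1].
Proof.
move=> pin Sp0; have [pp0 op0] := pps pin.
pose f m := ind m * legprod S m.
pose g m := ind m * (chi4 m * legprod (predC S) m).
have M0 : (0 < M)%N by rewrite muln_gt0 prod_gt0.
have chi4_per a : chi4 (a + M) = chi4 a.
  by rewrite /M mulnC; elim: n => [|k IHk]; rewrite ?addn0 // mulSn addnCA addnC chi4D.
have fg (h : nat -> int) : (forall m, coprime m M -> h m = 1 \/ h m = -1) ->
    forall a, [\/ ind a * h a = 1, ind a * h a = -1 | ind a * h a = 0] /\
      (ind a * h a == 0) = ~~ coprime a M.
  move=> hc a; rewrite /ind; case: ifP => [ca|_].
    by case: (hc a ca) => ->; split => //; rewrite mul1r; [apply: Or31|apply: Or32].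
  by rewrite mul0r; split => //; apply: Or33.
have hcf := fg _ (legprod_cases S).
have hcg : forall m, coprime m M -> chi4 m * legprod (predC S) m = 1 \/
     chi4 m * legprod (predC S) m = -1.
  move=> m cm; have [om _] := coprime_M cm.
  by case: (chi4_cases om) => ->; case: (legprod_cases (predC S) cm) => ->; [left|right|right|left].
have {}hcg := fg _ hcg.
have fM a b : f (a * b)%N = f a * f b by rewrite /f indM legprodM; ring.
have gM a b : g (a * b)%N = g a * g b by rewrite /g indM chi4M legprodM; ring.
have fp a : f (a + M)%N = f a by rewrite /f ind_per legprod_per.
have gp a : g (a + M)%N = g a by rewrite /g ind_per chi4_per legprod_per.
have c4n : coprime 4 n by rewrite -[4%N]/(2 ^ 2)%N coprimeXl // coprime2n prod_odd.
(* g is -1 at any a that is 3 modulo 4 and 1 modulo n. *)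
have gs : \sum_(0 <= a < M) g a = 0.
  pose a := chinese 4 n 3 1.
  have a4 : (a = 3 %[mod 4])%N by apply: chinese_modl.
  have an : (a = 1 %[mod n])%N by apply: chinese_modr.
  have ca : coprime a M.
    have h1 : coprime a 4 by rewrite -coprime_modl a4.
    have h2 : coprime a n by rewrite -coprime_modl an coprime_modl coprime1n.
    by rewrite coprimeMr h1.
  apply: (@character_sum0 g M a) => //.
  rewrite /g /ind ca mul1r /chi4 a4 /= /legprod big_seq_cond big1 ?mulr1 // => p /andP[pin' _].
  have [pp _] := pps pin'; rewrite -(leg1 pp) /leg; congr qchar; apply/eqP.
  by rewrite Fp_nat_eq // -(modn_dvdm a (mem_dvd pin')) an modn_dvdm ?mem_dvd.
(* f is -1 at any a that is a nonresidue modulo p0 and 1 modulo 4 n / p0. *)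
have fs : \sum_(0 <= a < M) f a = 0.
  have [c pc lc] := leg_nonresidue pp0 op0.
  pose n0 := (\prod_(p <- rem p0 ps) p)%N.
  have en : n = (p0 * n0)%N by rewrite /n (big_rem p0).
  have c2 : coprime p0 (4 * n0).
    rewrite coprimeMr; apply/andP; split.
      by rewrite -[4%N]/(2 ^ 2)%N coprimeXr // coprimen2.
    rewrite prime_coprime //; apply/negP; rewrite /n0 Euclid_dvd_prod // big_has.
    case/hasP => p; rewrite mem_rem_uniq // inE => /andP[np pin'].
    have [pp _] := pps pin'.
    by rewrite dvdn_prime2 // eq_sym (negbTE np).
  pose a := chinese p0 (4 * n0) c 1.
  have a1 : (a = c %[mod p0])%N by apply: chinese_modl.
  have a2 : (a = 1 %[mod 4 * n0])%N by apply: chinese_modr.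
  have ca : coprime a M.
    have -> : M = (p0 * (4 * n0))%N by rewrite /M en; lia.
    rewrite coprimeMr -(coprime_modl a p0) a1 coprime_modl -(coprime_modl a (4 * n0)) a2.
    by rewrite coprime_modl coprime1n andbT coprime_sym prime_coprime.
  apply: (@character_sum0 f M a) => //.
  rewrite /f /ind ca mul1r /legprod big_mkcond (bigD1_seq p0) //= Sp0.
  have -> : leg p0 a = -1.
    rewrite -lc /leg; congr qchar; apply/eqP; rewrite Fp_nat_eq //; exact/eqP.
  rewrite big_seq_cond big1 ?mulr1 // => p /andP[pin' np]; case: ifP => // _.
  have [pp _] := pps pin'; rewrite -(leg1 pp) /leg; congr qchar; apply/eqP.
  have pd : (p %| 4 * n0)%N.
    by rewrite dvdn_mull // /n0 (big_rem p) ?dvdn_mulr // mem_rem_uniq // inE np.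
  by rewrite Fp_nat_eq // -(modn_dvdm a pd) a2 modn_dvdm.
have [q [pq [fq gq]]] := two_characters R M0 fM gM
  ltac:(by rewrite /f /ind coprime1n legprod1) ltac:(by rewrite /g /ind coprime1n legprod1)
  (fun a => (hcf a).1) (fun a => (hcg a).1)
  (fun a => etrans (hcf a).2 (esym (hcg a).2)) fp gp fs gs.
have cq : coprime q M.
  by move: fq; rewrite /f /ind; case: coprime => //; rewrite mul0r.
move: fq gq; rewrite /f /g /ind cq !mul1r => fq gq.
exists q; split => //.
have -> : legprod xpredT q = legprod S q * legprod (predC S) q.
  by rewrite /legprod (bigID S).
by rewrite fq mulrCA gq.
Qed.
End Characters.

Lemma qchar_N1 (F : finFieldType) : odd #|F| -> qchar (-1 : F) = (-1) ^+ qhalf F.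
Proof.
move=> o; apply: (@pm1_inj F F) => //; first exact: one_neqN1.
- by apply: qchar_cases; rewrite oppr_eq0 oner_eq0.
- by rewrite -signr_odd; case: odd; rewrite ?expr0 ?expr1; [right|left].
by rewrite qchar_exp // rmorphXn rmorphN.
Qed.

Lemma chi4_half p : prime p -> odd p -> chi4 p = (-1) ^+ qhalf 'F_p.
Proof.
move=> pp op; rewrite /qhalf card_Fp // -signr_odd /chi4.
have : (p %% 4 = 1 \/ p %% 4 = 3)%N by lia.
case=> e; rewrite e /=.
  by rewrite (_ : odd (p.-1)./2 = false) ?expr0 //; lia.
by rewrite (_ : odd (p.-1)./2 = true) ?expr1 //; lia.
Qed.

Lemma qchar1_sqr_dvd q (n : nat) : prime q -> odd q ->
  qchar (- n%:R : 'F_q) = 1 -> exists x, (q %| x ^ 2 + n)%N.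
Proof.
move=> pq oq h; have oF : odd #|'F_q| by rewrite card_Fp.
have n0 : - n%:R != 0 :> 'F_q by apply/eqP => e; move: h; rewrite e qchar0.
have [s es] : exists s : 'F_q, - n%:R = s ^+ 2.
  apply: qchar_square => //; move: h; rewrite /qchar (negbTE n0).
  by case: eqP.
have [x [_ e]] := Fp_nat s pq; exists x.
have := Fp_nat_eq (x ^ 2 + n)%N 0 pq.
by rewrite natrD natrX e -es addNr eqxx mod0n => /esym.
Qed.

Section ReciprocityConsequence.
Variable ps : seq nat.
Hypothesis ups : uniq ps.
Hypothesis pps : forall p, p \in ps -> prime p /\ odd p.
Let n := (\prod_(p <- ps) p)%N.
Hypothesis n1 : (n %% 4 = 1)%N.

(** Quadratic reciprocity, assembled over the prime divisors of n. *)
Lemma split_sqr q : prime q -> coprime q (4 * n) -> chi4 q * legprod ps xpredT q = 1 ->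
  exists x, (q %| x ^ 2 + n)%N.
Proof.
move=> pq cq; have [oq hq] := coprime_M pps cq; move=> h.
have oF : odd #|'F_q| by rewrite card_Fp.
apply: qchar1_sqr_dvd => //; rewrite -mulN1r qcharM // qchar_N1 // -chi4_half // -h.
congr (_ * _).
have rec p : p \in ps -> leg p q = qchar ((chi4 p)%:~R * p%:R : 'F_q).
  move=> pin; have [pp op] := pps pin; rewrite /leg gauss_reciprocity //; last first.
    by apply: contra (hq _ pin) => /eqP ->.
  by rewrite chi4_half // rmorphXn rmorphN.
rewrite /legprod big_seq (eq_bigr _ rec) -big_seq.
have q1 : qchar (1 : 'F_q) = 1 by rewrite /qchar oner_eq0 expr1n eqxx.
rewrite -(big_morph _ (fun x y => qcharM x y oF) q1) big_split /=.
rewrite -rmorph_prod -natr_prod /=.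
have -> : \prod_(p <- ps) chi4 p = 1.
  by rewrite -(big_morph _ chi4M (erefl : chi4 1 = 1)) /chi4 n1.
by rewrite mul1r.
Qed.
End ReciprocityConsequence.

(** The isomorphism from the additive group of F_2 to the signs, which turns Legendre symbols
    into linear algebra. *)
Definition sg2 (x : 'F_2) : int := if x == 0 then 1 else -1.

Lemma F2_cases (x : 'F_2) : x = 0 \/ x = 1.
Proof. by case: x => -[|[|//]] h; [left|right]; apply: val_inj. Qed.

Lemma sg2D x y : sg2 (x + y) = sg2 x * sg2 y.
Proof. by case: (F2_cases x) => ->; case: (F2_cases y) => ->. Qed.

Lemma crt_seq (F : nat -> nat) (qs : seq nat) : uniq qs -> {in qs, forall q, prime q} ->
  (forall m x y, x = y %[mod m] -> F x = F y %[mod m]) ->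
  (forall q, q \in qs -> exists x, (q %| F x)%N) ->
  exists x, (\prod_(q <- qs) q %| F x)%N.
Proof.
move=> + + Fc; elim: qs => [|q qs IH] /=; first by exists 0%N; rewrite big_nil dvd1n.
move=> /andP[nq uqs] pqs hq.
have [x hx] : exists x, (\prod_(q <- qs) q %| F x)%N.
  by apply: IH => // r rq; [apply: pqs|apply: hq]; rewrite inE rq orbT.
have [y hy] := hq q (mem_head _ _).
have pq := pqs q (mem_head _ _).
have co : coprime q (\prod_(q <- qs) q).
  rewrite prime_coprime // Euclid_dvd_prod // big_has; apply/hasPn => r rq.
  have pr : prime r by apply: pqs; rewrite inE rq orbT.
  by rewrite dvdn_prime2 //; apply: contra nq => /eqP ->.
exists (chinese q (\prod_(q <- qs) q) y x); rewrite big_cons Gauss_dvd //.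
apply/andP; split; rewrite /dvdn.
  by rewrite (Fc q _ y) //; apply: chinese_modl.
by rewrite (Fc (\prod_(q <- qs) q)%N _ x) //; apply: chinese_modr.
Qed.

Section Duality.
Variable R : rcfType.
Variable ps : seq nat.
Hypothesis ups : uniq ps.
Hypothesis pps : forall p, p \in ps -> prime p /\ odd p.
Let n := (\prod_(p <- ps) p)%N.
Hypothesis n1 : (n %% 4 = 1)%N.
Let t := size ps.
Let P (j : 'I_t) := nth 0%N ps j.

Let lv (q : nat) (j : 'I_t) : 'F_2 := (leg (P j) q == -1)%:R.

Definition good_primes (qs : seq nat) : Prop := uniq qs /\
  forall q, q \in qs -> [/\ prime q, coprime q (4 * n) & chi4 q * legprod ps xpredT q = 1].

Let lmx qs : 'M['F_2]_(size qs, t) := \matrix_(i, j) lv (nth 0%N qs i) j.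

Lemma P_in j : P j \in ps. Proof. exact: mem_nth. Qed.

Lemma sg2_lv q j : coprime q (4 * n) -> sg2 (lv q j) = leg (P j) q.
Proof.
move=> cq; have [_ h] := coprime_M pps cq; have [pp op] := pps (P_in j).
by rewrite /lv; case: (leg_cases pp (h _ (P_in j))) => ->.
Qed.

Lemma sg2_sum (I : Type) (r : seq I) (Q : pred I) (F : I -> 'F_2) :
  sg2 (\sum_(i <- r | Q i) F i) = \prod_(i <- r | Q i) sg2 (F i).
Proof. exact: (big_morph _ sg2D (erefl : sg2 0 = 1)). Qed.

Lemma legprod_lv (w : 'rV['F_2]_t) q : coprime q (4 * n) ->
  sg2 (\sum_j w 0 j * lv q j) =
  legprod ps [pred p | [exists j : 'I_t, (P j == p) && (w 0 j != 0)]] q.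
Proof.
move=> cq; rewrite sg2_sum /legprod (big_nth 0%N) big_mkord [RHS]big_mkcond /=.
apply: eq_bigr => j _.
have -> : [exists k : 'I_t, (P k == nth 0%N ps j) && (w 0 k != 0)] = (w 0 j != 0).
  apply/existsP/idP => [[k /andP[/eqP e]]|h]; last by exists j; rewrite eqxx.
  have -> // : k = j.
  by move/eqP: e; rewrite /P nth_uniq // => /eqP /val_inj.
have [->|->] := F2_cases (w 0 j); first by rewrite mul0r.
by rewrite mul1r /= sg2_lv.
Qed.

(** As long as the sign vectors of the primes found so far do not span, some nonzero functional
    w vanishes on them. Its value at q is the product of the Legendre symbols of q over the
    support S of w, so a prime q with [legprod ps S q = -1] has an independent sign vector. *)
Lemma independent_primes r : (r <= t)%N ->
  exists qs, [/\ good_primes qs, size qs = r & row_free (lmx qs)].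
Proof.
elim: r => [|r IH] rt.
  exists [::]; split; [by split|by []|].
  by apply/inj_row_free => v _; apply/rowP => -[].
have [qs [[uq gq] sq fq]] := IH (ltnW rt).
have [w w0 hw] : exists2 w : 'rV['F_2]_t, w != 0 & w *m (lmx qs)^T = 0.
  have : kermx (lmx qs)^T != 0.
    rewrite -mxrank_eq0 mxrank_ker mxrank_tr; move/eqP: fq => ->.
    by rewrite sq subn_eq0 -ltnNge.
  case/rowV0Pn => w /sub_kermxP hw w0; by exists w.
have [j0 wj0] : exists j, w 0 j != 0.
  apply/existsP; apply: contraNT w0; rewrite negb_exists => /forallP h.
  by apply/eqP/rowP => j; rewrite mxE; have := h j; rewrite negbK => /eqP.
pose S := [pred p | [exists j : 'I_t, (P j == p) && (w 0 j != 0)]].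
have [q [pq cq lq hq]] : exists q, [/\ prime q, coprime q (4 * n), legprod ps S q = -1 &
    chi4 q * legprod ps xpredT q = 1].
  apply: (split_prime ups pps R (P_in j0)).
  by apply/existsP; exists j0; rewrite eqxx.
have wq : \sum_j w 0 j * lv q j = 1.
  have := legprod_lv w cq; rewrite -/S lq.
  by case: (F2_cases (\sum_j w 0 j * lv q j)) => ->.
have wqs i : \sum_j w 0 j * lv (nth 0%N qs i) j = 0 \/ (size qs <= i)%N.
  have [iq|] := ltnP i (size qs); last by right.
  left; move/rowP: hw => /(_ (Ordinal iq)); rewrite !mxE => e; rewrite -[RHS]e.
  by apply: eq_bigr => j _; rewrite !mxE.
exists (q :: qs); split; rewrite /= ?sq //.
  split=> /=.
    rewrite uq andbT; apply/negP => qin.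
    case: (wqs (index q qs)); last by rewrite leqNgt index_mem qin.
    by rewrite nth_index // wq => /eqP; rewrite oner_eq0.
  by move=> q'; rewrite inE => /orP[/eqP ->|/gq].
apply/inj_row_free => v hv.
have e j : v 0 ord0 * lv q j + \sum_(i < size qs) v 0 (lift ord0 i) * lv (nth 0%N qs i) j = 0.
  move/rowP: hv => /(_ j); rewrite !mxE big_ord_recl /= !mxE /= => e; rewrite -[RHS]e.
  by congr (_ + _); apply: eq_bigr => i _; rewrite !mxE.
have v0 : v 0 ord0 = 0.
  have : \sum_j w 0 j * (v 0 ord0 * lv q j + \sum_(i < size qs) v 0 (lift ord0 i) * lv (nth 0%N qs i) j) = 0.
    by rewrite big1 // => j _; rewrite e mulr0.
  rewrite (eq_bigr _ (fun j _ => mulrDr _ _ _)) big_split /=.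
  rewrite (eq_bigr (fun j => v 0 ord0 * (w 0 j * lv q j))) => [|j _]; last by rewrite mulrCA.
  rewrite -mulr_sumr wq mulr1.
  rewrite [X in _ + X](_ : _ = 0) ?addr0 //.
  transitivity (\sum_j \sum_(i < size qs) w 0 j * (v 0 (lift ord0 i) * lv (nth 0%N qs i) j)).
    by apply: eq_bigr => j _; rewrite mulr_sumr.
  rewrite exchange_big /= big1 // => i _.
  rewrite (eq_bigr (fun j => v 0 (lift ord0 i) * (w 0 j * lv (nth 0%N qs i) j))) => [|j _].
    by rewrite -mulr_sumr; case: (wqs i) => [->|]; rewrite ?mulr0 // leqNgt ltn_ord.
  by rewrite mulrCA.
have v1 : (\row_i v 0 (lift ord0 i)) *m lmx qs = 0.
  apply/rowP => j; rewrite !mxE -[RHS](e j) v0 mul0r add0r.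
  by apply: eq_bigr => i _; rewrite !mxE.
move: (row_free_inj fq (etrans v1 (esym (mul0mx _ _)))) => /rowP v1'.
apply/rowP => i; rewrite mxE; case: (unliftP ord0 i) => [k ->|->] //.
by have := v1' k; rewrite !mxE.
Qed.

(** A product D of good primes can be given any sign vector; with the one of -1, the number -D
    is a square modulo each prime divisor of n, hence modulo n. And -n is a square modulo D
    because it is one modulo each good prime. *)
Lemma reciprocal_number : exists D : nat, [/\ (0 < D)%N,
  exists b, (D %| b ^ 2 + n)%N & exists g, (n %| D * g ^ 2 + 1)%N].
Proof.
have [qs [[uq gq] sq fq]] := independent_primes (leqnn t).
pose u : 'rV['F_2]_t := \row_j (qchar (-1 : 'F_(P j)) == -1)%:R.
have [c hc] : exists c : 'rV_(size qs), u = c *m lmx qs.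
  apply/submxP; apply: submx_full; rewrite /row_full.
  by move/eqP: fq => ->; rewrite sq.
pose ds := [seq nth 0%N qs (nat_of_ord i) | i : 'I_(size qs) <- enum 'I_(size qs) & c 0 i != 0].
have uds : uniq ds.
  rewrite map_inj_in_uniq => [|i j _ _ /eqP]; first exact/filter_uniq/enum_uniq.
  by rewrite nth_uniq // => /eqP /val_inj.
have dsq d : d \in ds -> d \in qs by case/mapP => i _ ->; apply: mem_nth.
pose D := (\prod_(d <- ds) d)%N.
have pds : {in ds, forall q, prime q} by move=> d /dsq /gq[].
have D0 : (0 < D)%N by rewrite /D big_seq; apply: prodn_cond_gt0 => d /pds /prime_gt0.
exists D; split => //.
  apply: crt_seq => //.
    by move=> m x y e; apply/eqP; rewrite eqn_modDr -modnXm e modnXm.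
  by move=> d /dsq /gq[pd cd hd]; apply: (split_sqr pps n1 pd cd hd).
apply: (crt_seq (F := fun g => D * g ^ 2 + 1)%N) => //.
- by move=> p /pps[].
- by move=> m x y e; apply/eqP; rewrite eqn_modDr -modnMmr -modnXm e modnXm modnMmr.
move=> p pin; have [pp op] := pps pin.
have oF : odd #|'F_p| by rewrite card_Fp.
pose j : 'I_t := Ordinal (etrans (index_mem p ps) pin : (index p ps < t)%N).
have Pj : P j = p by rewrite /P nth_index.
have lD : qchar (D%:R : 'F_p) = qchar (-1 : 'F_p).
  transitivity (sg2 (u 0 j)); last first.
    rewrite mxE Pj; have n0 : (-1 : 'F_p) != 0 by rewrite oppr_eq0 oner_eq0.
    by case: (qchar_cases n0) => ->.
  rewrite hc mxE sg2_sum /D natr_prod big_map big_filter.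
  have q1 : qchar (1 : 'F_p) = 1 by rewrite /qchar oner_eq0 expr1n eqxx.
  rewrite (big_morph _ (fun x y => qcharM x y oF) q1) big_enum_cond /= big_mkcond.
  apply: eq_bigr => i _; have [->|->] := F2_cases (c 0 i); first by rewrite mul0r.
  rewrite /= mul1r mxE sg2_lv ?Pj //.
  by have [] := gq _ (mem_nth 0%N (ltn_ord i)).
have D0p : (D%:R : 'F_p) != 0.
  apply/eqP => z; move: lD; rewrite z qchar0.
  have n0 : (-1 : 'F_p) != 0 by rewrite oppr_eq0 oner_eq0.
  by case: (qchar_cases n0) => ->.
have [s es] : exists s : 'F_p, - D%:R = s ^+ 2.
  apply: qchar_square => //; first by rewrite oppr_eq0.
  have : qchar (- D%:R : 'F_p) = 1.
    rewrite -mulN1r qcharM // lD.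
    have n0 : (-1 : 'F_p) != 0 by rewrite oppr_eq0 oner_eq0.
    by case: (qchar_cases n0) => ->.
  by rewrite /qchar oppr_eq0 (negbTE D0p); case: eqP.
have [g [_ eg]] := Fp_nat s^-1 pp; exists g.
have := Fp_nat_eq (D * g ^ 2 + 1)%N 0 pp.
have s0 : s != 0 by rewrite -sqrf_eq0 -es oppr_eq0.
have -> : ((D * g ^ 2 + 1)%N%:R : 'F_p) = 0.
  rewrite natrD natrM natrX eg -[D%:R]opprK es mulNr exprVn mulfV ?sqrf_eq0 //.
  by rewrite addNr.
by rewrite eqxx mod0n => /esym.
Qed.

Lemma three_squares_prod : exists x y z : int, x * x + y * y + z * z = n.
Proof.
have [D [D0 [b /dvdnP[c ec]] [g /dvdnP[h eh]]]] := reciprocal_number.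
have n0 := prod_gt0 pps.
apply: (@three_squares_of_gram D b c g h n); rewrite -/n; try lia.
Qed.
End Duality.

Lemma squarefree_part (N : nat) : (0 < N)%N ->
  exists (ps : seq nat) (m : nat), [/\ uniq ps, {in ps, forall p, prime p /\ (p %| N)%N} &
    N = (\prod_(p <- ps) p * m ^ 2)%N].
Proof.
move=> N0; exists [seq p <- primes N | odd (logn p N)], (\prod_(p <- primes N) p ^ (logn p N)./2)%N.
split; first by rewrite filter_uniq ?primes_uniq.
  by move=> p; rewrite mem_filter mem_primes => /andP[_ /and3P[]].
rewrite {1}(prod_prime_decomp N0) prime_decompE big_map /= big_filter [in RHS]big_mkcond /=.
have -> : ((\prod_(p <- primes N) p ^ (logn p N)./2) ^ 2 = \prod_(p <- primes N) (p ^ (logn p N)./2) ^ 2)%N.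
  by elim/big_rec2: _ => [|p x y _ <-]; rewrite ?exp1n // expnMn.
rewrite -big_split /=; apply: eq_bigr => p _.
rewrite -expnM muln2 -{1}(odd_double_half (logn p N)) expnD.
by case: odd; rewrite ?expn1 ?expn0.
Qed.

(** Equivalently, x is nonzero and Q_2(sqrt x) is unramified over Q_2. These x form a group
    containing the nonzero squares, and avoid the only obstruction to being a sum of three
    rational squares besides the sign. *)
Definition unit1mod4 (x : rat) : Prop :=
  exists s : rat, s != 0 /\ exists z : int, x * s ^+ 2 = (4 * z + 1)%:~R.

Theorem three_squares (R : rcfType) (x : rat) : 0 < x -> unit1mod4 x ->
  exists a b c : rat, x = a ^+ 2 + b ^+ 2 + c ^+ 2.
Proof.
move=> x0 [s [s0 [z e]]].
have s20 : s ^+ 2 != 0 by rewrite sqrf_eq0.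
have z0 : 0 < 4 * z + 1.
  by rewrite -(ltr0z rat) -e mulr_gt0 // exprn_even_gt0 //= s0.
case: z z0 e => z z0 e; last by lia.
pose N := (4 * z + 1)%N.
have N0 : (0 < N)%N by rewrite /N addn1.
have [ps [m [ups pps eN]]] := squarefree_part N0.
have oN : odd N by rewrite /N; lia.
have pps' p : p \in ps -> prime p /\ odd p.
  by move=> /pps[pp pN]; split=> //; apply: dvdn_odd pN oN.
have n1 : ((\prod_(p <- ps) p) %% 4 = 1)%N.
  have on := prod_odd pps'; have om : odd m.
    by move: oN; rewrite eN oddM oddX /= => /andP[].
  have m1 : (m ^ 2 %% 4 = 1)%N.
    rewrite -modnXm; have : (m %% 4 = 1 \/ m %% 4 = 3)%N by lia.
    by case=> ->.
  have : (N %% 4 = 1)%N by rewrite /N; lia.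
  by rewrite {1}eN -modnMmr m1 muln1.
have [u [v [w euvw]]] := three_squares_prod R ups pps' n1.
exists (u%:~R * m%:R / s), (v%:~R * m%:R / s), (w%:~R * m%:R / s).
apply: (mulIf s20); rewrite e.
have -> : ((4 * Posz z + 1)%:~R : rat) = N%:R by rewrite -[RHS]/(N%:Z%:~R); congr (_%:~R).
rewrite eN natrM natrX.
have -> : ((\prod_(p <- ps) p)%N%:R : rat) = (u * u + v * v + w * w)%:~R by rewrite euvw.
rewrite !rmorphD !rmorphM /=.
by field.
Qed.

(** * Rational isometries of diagonal forms *)

Section Isometry.
Variable R : rcfType.

Definition lform (n : nat) (m : nat -> nat -> rat) (x : nat -> R) (j : nat) : R :=
  \sum_(0 <= i < n) ratr (m j i) * x i.

Definition dform (s : seq rat) (x : nat -> R) : R :=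
  \sum_(0 <= i < size s) ratr s`_i * x i ^+ 2.

(** Only one direction of the change of variables is recorded; between positive definite forms
    it is automatically invertible (see [frame_dual]). *)
Definition isometric (s t : seq rat) : Prop := size s = size t /\
  exists m, forall x, dform s x = dform t (lform (size s) m x).

Lemma isometric_refl s : isometric s s.
Proof.
split=> //; exists (fun j i => (i == j)%:R) => x.
apply: eq_big_nat => i /andP[_ si]; congr (_ * _ ^+ 2).
rewrite /lform (bigD1_seq i) ?mem_index_iota ?iota_uniq //= eqxx rmorph1 mul1r.
by rewrite big1 ?addr0 // => j /negbTE ->; rewrite rmorph0 mul0r.
Qed.

Lemma isometric_trans s t u : isometric s t -> isometric t u -> isometric s u.
Proof.
move=> [e1 [m1 h1]] [e2 [m2 h2]]; split; first by rewrite e1.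
exists (fun j i => \sum_(0 <= k < size t) m2 j k * m1 k i) => x.
rewrite h1 h2; apply: eq_bigr => j _; congr (_ * _ ^+ 2).
rewrite /lform; transitivity (\sum_(0 <= k < size t) \sum_(0 <= i < size s)
    ratr (m2 j k) * (ratr (m1 k i) * x i)).
  by apply: eq_bigr => k _; rewrite mulr_sumr.
rewrite exchange_big /=; apply: eq_bigr => i _.
by rewrite rmorph_sum mulr_suml; apply: eq_bigr => k _; rewrite rmorphM mulrA.
Qed.

Lemma dform_cat s t x : dform (s ++ t) x = dform s x + dform t (fun i => x (size s + i)%N).
Proof.
rewrite /dform size_cat (@big_cat_nat _ _ _ (size s)) ?leq_addr //=; congr (_ + _).
  by apply: eq_big_nat => i /andP[_ si]; rewrite nth_cat si.
rewrite -{1}[size s]add0n big_addn addKn; apply: eq_bigr => i _.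
by rewrite nth_cat ltnNge leq_addl /= addnK addnC.
Qed.

Lemma isometric_cat s1 t1 s2 t2 : isometric s1 t1 -> isometric s2 t2 ->
  isometric (s1 ++ s2) (t1 ++ t2).
Proof.
move=> [e1 [m1 h1]] [e2 [m2 h2]]; split; first by rewrite !size_cat e1 e2.
exists (fun j i => if (i < size s1)%N then if (j < size s1)%N then m1 j i else 0
  else if (j < size s1)%N then 0 else m2 (j - size s1)%N (i - size s1)%N) => x.
rewrite !dform_cat h1 h2; congr (_ + _); apply: eq_big_nat => j /andP[_ hj];
  congr (_ * _ ^+ 2); rewrite /lform size_cat [in RHS](@big_cat_nat _ _ _ (size s1)) ?leq_addr //=.
  rewrite -e1 in hj; rewrite [X in _ = _ + X]big_nat_cond [X in _ = _ + X]big1 ?addr0.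
    by apply: eq_big_nat => i /andP[_ hi]; rewrite hi hj.
  by move=> i /andP[/andP[hi _] _]; rewrite ltnNge hi hj /= rmorph0 mul0r.
rewrite -e1 [X in _ = X + _]big_nat_cond [X in _ = X + _]big1 ?add0r.
  rewrite -{2}[size s1]add0n big_addn addKn; apply: eq_bigr => i _.
  by rewrite !ltnNge leq_addl leq_addr /= addnK addKn addnC.
by move=> i /andP[/andP[_ hi] _]; rewrite hi ltnNge leq_addr /= rmorph0 mul0r.
Qed.

Lemma isometric_cons a s t : isometric s t -> isometric (a :: s) (a :: t).
Proof. by move=> h; rewrite -cat1s -[a :: t]cat1s; apply: isometric_cat => //; apply: isometric_refl. Qed.

Lemma isometric_mx (s t : seq rat) (M : seq (seq rat)) : size s = size t ->
  (forall x, dform s x = dform t (lform (size s) (fun j i => (nth [::] M j)`_i) x)) ->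
  isometric s t.
Proof. by move=> e h; split => //; exists (fun j i => (nth [::] M j)`_i). Qed.

Lemma isometric_swap a b s : isometric [:: a, b & s] [:: b, a & s].
Proof.
rewrite -[[:: a, b & s]]/([:: a; b] ++ s) -[[:: b, a & s]]/([:: b; a] ++ s).
apply: isometric_cat (isometric_refl s).
apply: (@isometric_mx _ _ [:: [:: 0; 1]; [:: 1; 0]]) => // x.
rewrite /dform /lform !big_nat_recr ?big_geq //= rmorph0 rmorph1; ring.
Qed.

Lemma isometric_perm s t : perm_eq s t -> isometric s t.
Proof.
elim: s t => [|a s IH] t; first by rewrite perm_sym => /perm_nilP ->; exact: isometric_refl.
move=> p; have at_ : a \in t by rewrite -(perm_mem p) mem_head.
case/splitPr: at_ p => t1 t2 p.
have p' : perm_eq s (t1 ++ t2).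
  by rewrite -(perm_cons a) (perm_trans p) // -cat1s perm_catCA.
apply: isometric_trans (isometric_cons a (IH _ p')) _.
elim: t1 {p p'} => [|b t1 IHt] /=; first exact: isometric_refl.
exact: isometric_trans (isometric_swap _ _ _) (isometric_cons b IHt).
Qed.
End Isometry.

Section IsometryTheorem.
Variable R : rcfType.
Notation isometric := (isometric R).

Lemma isometric_square a c : c != 0 -> isometric [:: a * c ^+ 2] [:: a].
Proof.
move=> c0; apply: (@isometric_mx R _ _ [:: [:: c]]) => // x.
rewrite /dform /lform !big_nat_recr ?big_geq //= rmorphM rmorphXn /=; ring.
Qed.

(** The hermitian plane diag(a, b) over Q(sqrt(-D)) contains a vector of length 1 by
    [binary_hermitian_universal], hence is diag(1, a b). The matrix is the base change to that
    vector and its orthogonal complement, written over Q. *)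
Lemma isometric_hermitian D a b : 0 < D -> 0 < a -> 0 < b ->
  isometric [:: a; b; D * a; D * b] [:: 1; a * b; D; D * (a * b)].
Proof.
move=> D0 a0 b0; have [x [y [z [w e]]]] := binary_hermitian_universal D0 a0 b0 (ltr01 : 0 < 1).
have {}e := congr1 (fun c : rat => ratr c : R) e.
apply: (@isometric_mx R _ _ [:: [:: a * x; b * z; D * a * y; D * b * w];
  [:: - z; x; D * w; - (D * y)]; [:: - (a * y); - (b * w); a * x; b * z];
  [:: - w; y; - z; x]]) => // u.
rewrite /dform /lform !big_nat_recr ?big_geq //=.
move: e; rewrite !(rmorphD, rmorphM, rmorphN, rmorphXn, rmorph1) /=.
move: {D0 a0 b0} (ratr a) (ratr b) (ratr D) (ratr x) (ratr y) (ratr z) (ratr w) => {}a {}b {}D {}x {}y {}z {}w e.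
move: (u 0%N) (u 1%N) (u 2%N) (u 3%N) => u0 v0 u1 v1.
transitivity ((a * u0 ^+ 2 + b * v0 ^+ 2 + D * a * u1 ^+ 2 + D * b * v1 ^+ 2) *
  (a * (x ^+ 2 + D * y ^+ 2) + b * (z ^+ 2 + D * w ^+ 2))); last by ring.
by rewrite e; ring.
Qed.

(** Multiplication by a quaternion of norm c. *)
Lemma isometric_scale4 c : 0 < c -> isometric (nseq 4 1) (nseq 4 c).
Proof.
move=> c0; have [p [q [r [t e]]]] := four_squares c0.
have {}e := congr1 (fun c : rat => ratr c : R) e.
have c0' : (ratr c : R) != 0 by rewrite fmorph_eq0 gt_eqF.
apply: (@isometric_mx R _ _ [:: [:: p / c; q / c; r / c; t / c];
  [:: - q / c; p / c; - t / c; r / c]; [:: - r / c; t / c; p / c; - q / c];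
  [:: - t / c; - r / c; q / c; p / c]]) => // u.
rewrite /dform /lform !big_nat_recr ?big_geq //=.
move: e; rewrite !(rmorphD, rmorphM, rmorphN, rmorphXn, rmorph1, fmorphV) /=.
move: {c0} (ratr c) (ratr p) (ratr q) (ratr r) (ratr t) c0' => {}c {}p {}q {}r {}t cn0 e.
move: (u 0%N) (u 1%N) (u 2%N) (u 3%N) => u0 v0 u1 v1.
transitivity ((u0 ^+ 2 + v0 ^+ 2 + u1 ^+ 2 + v1 ^+ 2) * (p ^+ 2 + q ^+ 2 + r ^+ 2 + t ^+ 2) / c).
  by rewrite e; field.
by field.
Qed.

Lemma isometric_nseq_scale c k : 0 < c -> (4 %| k)%N -> isometric (nseq k 1) (nseq k c).
Proof.
move=> c0 /dvdnP[j ->]; elim: j => [|j IH]; first exact: isometric_refl.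
by rewrite mulSn !nseqD; apply: isometric_cat IH; apply: isometric_scale4.
Qed.

(** The vectors (a, b, c), (-b, a, 0) and (-c a, -c b, D) of Q^3 are orthogonal with squared
    lengths n, D and D n. *)
Lemma isometric_quaternion a b c : a != 0 ->
  let D := a ^+ 2 + b ^+ 2 in let n := a ^+ 2 + b ^+ 2 + c ^+ 2 in
  isometric [:: 1; n; D; D * n] (nseq 4 1).
Proof.
move=> a0 D n.
apply: (@isometric_mx R _ _ [:: [:: 1; 0; 0; 0]; [:: 0; a; - b; - (c * a)];
  [:: 0; b; a; - (c * b)]; [:: 0; c; 0; D]]) => // u.
rewrite /dform /lform !big_nat_recr ?big_geq //= /D /n.
rewrite !(rmorphD, rmorphM, rmorphN, rmorphXn, rmorph1, rmorph0) /=.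
by ring.
Qed.

(** The diagonal hermitian form s over Q(sqrt(-D)), as a form over Q. *)
Definition hdouble (D : rat) (s : seq rat) := s ++ map ( *%R D) s.

Lemma hdouble_cons D a s : perm_eq (hdouble D (a :: s)) ([:: a; D * a] ++ hdouble D s).
Proof. by rewrite /hdouble /= perm_cons -cat1s perm_catCA. Qed.

Lemma isometric_hcons D a s t : isometric (hdouble D s) (hdouble D t) ->
  isometric (hdouble D (a :: s)) (hdouble D (a :: t)).
Proof.
move=> h; apply: isometric_trans (isometric_perm R (hdouble_cons _ _ _)) _.
apply: isometric_trans (isometric_cat (isometric_refl R _) h) _.
by apply: isometric_perm; rewrite perm_sym hdouble_cons.
Qed.

Lemma isometric_hswap D a b s : 0 < D -> 0 < a -> 0 < b ->
  isometric (hdouble D [:: a, b & s]) (hdouble D [:: a * b, 1 & s]).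
Proof.
move=> D0 a0 b0.
have p x y : perm_eq (hdouble D [:: x, y & s]) ([:: x; y; D * x; D * y] ++ hdouble D s).
  by apply/permP => P; rewrite /hdouble /= !count_cat /= ?addn0; ring.
apply: isometric_trans (isometric_perm R (p _ _)) _.
apply: isometric_trans (isometric_cat (isometric_hermitian D0 a0 b0) (isometric_refl R _)) _.
apply: isometric_trans (isometric_perm R (_ : perm_eq _ (hdouble D [:: 1, a * b & s]))) _.
  by rewrite perm_sym (perm_trans (p _ _)) // mulr1.
by apply: isometric_perm; apply/permP => P; rewrite /hdouble /= !count_cat /= ?addn0; ring.
Qed.

Lemma isometric_hprod D b s : 0 < D -> 0 < b -> {in s, forall x, 0 < x} ->
  isometric (hdouble D (b :: s)) (hdouble D (b * \prod_(x <- s) x :: nseq (size s) 1)).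
Proof.
move=> D0; elim: s b => [|a s IH] b b0 sp.
  by rewrite big_nil mulr1; exact: isometric_refl.
have a0 : 0 < a by apply: sp; rewrite mem_head.
have {}sp : {in s, forall x, 0 < x} by move=> x xs; apply: sp; rewrite inE xs orbT.
rewrite big_cons mulrA.
apply: isometric_trans (isometric_hcons b (IH a a0 sp)) _.
rewrite -mulrA; apply: isometric_hswap => //.
rewrite mulr_gt0 // big_seq; exact: prodr_gt0.
Qed.

(** Only the product N of the entries matters, by [isometric_hprod]. If their number is
    divisible by 4, take D = N and rescale the entries in groups of four. Otherwise write N =
    a^2 + b^2 + c^2 and take D = a^2 + b^2: the four entries 1, N, D, D N form a sum of four
    squares, and the other entries again fall into groups of four. *)
Theorem isometric_sum_squares (s : seq rat) : {in s, forall x, 0 < x} ->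
  ~~ odd (size s) -> (4 %| size s)%N \/ unit1mod4 (\prod_(x <- s) x) ->
  exists2 D, 0 < D & isometric (hdouble D s) (nseq (2 * size s) D).
Proof.
case: s => [|b s] sp es cs; first by exists 1 => //; exact: isometric_refl.
have b0 : 0 < b by apply: sp; rewrite mem_head.
have {}sp : {in s, forall x, 0 < x} by move=> x xs; apply: sp; rewrite inE xs orbT.
have pi D (D0 : 0 < D) := isometric_hprod D0 b0 sp.
have De : b * \prod_(x <- s) x = \prod_(x <- b :: s) x by rewrite big_cons.
set N := \prod_(x <- b :: s) x in De cs.
have N0 : 0 < N by rewrite -De mulr_gt0 // big_seq; exact: prodr_gt0.
have split4 : (4 %| (size s).+1)%N \/ ((4 %| (size s).-1)%N /\ (0 < size s)%N).
  by move: es => /=; lia.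
case: split4 => [d4|[d4 s0]].
  exists N => //; apply: isometric_trans (pi _ N0) _; rewrite De.
  apply: isometric_trans (isometric_perm R
    (_ : perm_eq _ ([:: N * N] ++ (nseq (size s) 1 ++ nseq (size s).+1 N)))) _.
    apply/permP => P; rewrite /hdouble /= map_nseq mulr1 !count_cat /= !count_nseq; ring.
  apply: (@isometric_trans _ _ (nseq (size s).+1 1 ++ nseq (size s).+1 N)).
    rewrite (_ : nseq (size s).+1 1 ++ _ = [:: 1] ++ (nseq (size s) 1 ++ nseq (size s).+1 N)) //.
    apply: isometric_cat (isometric_refl R _).
    have := @isometric_square 1 N; rewrite mul1r expr2; apply; by rewrite gt_eqF.
  rewrite mul2n -addnn nseqD; apply: isometric_cat (isometric_refl R _).
  exact: isometric_nseq_scale.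
have uN : unit1mod4 N.
  by case: cs => // d4'; exfalso; move: d4 d4' s0 => /=; case: (size s) => //= n; lia.
have [a [b' [c [a0 e]]]] : exists a b c : rat, a != 0 /\ N = a ^+ 2 + b ^+ 2 + c ^+ 2.
  have [a [b' [c e]]] := three_squares R N0 uN.
  have [a0|a0] := eqVneq a 0; last by exists a, b', c.
  have [b0'|b0'] := eqVneq b' 0; last by exists b', a, c; rewrite e; split=> //; ring.
  exists c, a, b'; split; last by rewrite e; ring.
  by apply: contraTneq N0 => c0; rewrite e a0 b0' c0 expr0n !addr0 ltxx.
pose D := a ^+ 2 + b' ^+ 2.
have D0 : 0 < D by rewrite /D ltr_wpDr ?sqr_ge0 // exprn_even_gt0 //= a0.
exists D => //; apply: isometric_trans (pi _ D0) _; rewrite De.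
set k := (size s).-1 in d4.
have ek : size s = k.+1 by rewrite prednK.
apply: isometric_trans (isometric_perm R
    (_ : perm_eq _ ([:: 1; N; D; D * N] ++ (nseq k 1 ++ nseq k D)))) _.
  apply/permP => P; rewrite /hdouble /= map_nseq mulr1 ek !count_cat /= !count_nseq; ring.
have -> : nseq (2 * size (b :: s)) D = nseq 4 D ++ (nseq k D ++ nseq k D).
  by rewrite -!nseqD; have -> : (2 * size (b :: s) = 4 + (k + k))%N by rewrite /= ek; lia.
apply: isometric_cat.
  apply: isometric_trans (isometric_scale4 D0).
  by rewrite e; exact: isometric_quaternion.
by apply: isometric_cat (isometric_refl R _); apply: isometric_nseq_scale.
Qed.

End IsometryTheorem.

(** * Coefficients with prescribed sign and 2-adic class *)

Lemma unit1mod4M x y : unit1mod4 x -> unit1mod4 y -> unit1mod4 (x * y).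
Proof.
move=> [s [s0 [z e]]] [s' [s0' [z' e']]]; exists (s * s'); rewrite mulf_neq0 //; split=> //.
exists (4 * z * z' + z + z'); rewrite exprMn mulrACA e e' -intrM; congr (_%:~R); ring.
Qed.

Lemma unit1mod4_sqr x : x != 0 -> unit1mod4 (x ^+ 2).
Proof.
move=> x0; exists x^-1; rewrite invr_eq0; split=> //; exists 0.
by rewrite -exprMn divff // expr1n mulr0 add0r.
Qed.

Lemma unit1mod4_prod (I : Type) (r : seq I) (P : pred I) (F : I -> rat) :
  (forall i, P i -> unit1mod4 (F i)) -> unit1mod4 (\prod_(i <- r | P i) F i).
Proof.
move=> h; elim/big_ind: _ => //; last exact: unit1mod4M.
by have := @unit1mod4_sqr 1; rewrite expr1n; apply; rewrite oner_eq0.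
Qed.

(** The local ring of Q at 2. *)
Definition odd_denom (x : rat) := exists a c : int, x * (2 * c + 1)%:~R = a%:~R.

Lemma odd_denomD x y : odd_denom x -> odd_denom y -> odd_denom (x + y).
Proof.
move=> [a [c e]] [a' [c' e']].
exists (a * (2 * c' + 1) + a' * (2 * c + 1)), (2 * c * c' + c + c').
have -> : 2 * (2 * c * c' + c + c') + 1 = (2 * c + 1) * (2 * c' + 1) by ring.
by rewrite intrM [in RHS]intrD [X in _ = X + _]intrM [X in _ = _ + X]intrM -e -e'; ring.
Qed.

Lemma odd_denomM x y : odd_denom x -> odd_denom y -> odd_denom (x * y).
Proof.
move=> [a [c e]] [a' [c' e']]; exists (a * a'), (2 * c * c' + c + c').
have -> : 2 * (2 * c * c' + c + c') + 1 = (2 * c + 1) * (2 * c' + 1) by ring.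
by rewrite !intrM -e -e'; ring.
Qed.

Lemma odd_denom_int (z : int) : odd_denom z%:~R.
Proof. by exists z, 0; rewrite mulr0 add0r mulr1. Qed.

Lemma odd_denom_nat n : odd_denom n%:R.
Proof. exact: (odd_denom_int n). Qed.

Lemma odd_denom_scale (x : rat) : exists n, odd_denom (x * 2 ^+ n).
Proof.
pose d := `|denq x|%N.
have d0 : (0 < d)%N by rewrite absz_gt0 denq_neq0.
exists (logn 2 d).
have [e] := @pfactor_coprime 2 d isT d0; rewrite coprime2n => oe ed.
exists (numq x), (e./2)%:Z.
have -> : (2 * (e./2)%:Z + 1) = e%:Z by lia.
rewrite -mulrA -[X in X * _]divq_num_den.
have -> : denq x = d%:Z by rewrite /d gez0_abs // ltW.
have <- : (d%:Z%:~R : rat) = 2 ^+ logn 2 d * (e%:Z)%:~R.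
  by rewrite {1}ed -!pmulrn natrM natrX mulrC.
by rewrite mulfVK // -pmulrn pnatr_eq0 -lt0n.
Qed.

(** Smallness for the real and for the 2-adic absolute value at once. *)
Definition small m (x : rat) := `|x| * 2 ^+ m <= 1 /\ odd_denom (x / 2 ^+ m).

Lemma smallD m x y : small m.+1 x -> small m.+1 y -> small m (x + y).
Proof.
have p0 : 0 < 2 ^+ m :> rat by rewrite exprn_gt0.
move=> [xr xo] [yr yo]; split.
  have := ler_normD x y; rewrite -(ler_pM2r p0) => h; apply: le_trans h _.
  by move: xr yr; rewrite !exprS; nra.
have -> : (x + y) / 2 ^+ m = 2 * (x / 2 ^+ m.+1 + y / 2 ^+ m.+1).
  by rewrite exprS; move: (2 ^+ m) p0 => u u0; field; rewrite gt_eqF.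
by apply: odd_denomM; [apply: (odd_denom_nat 2)|apply: odd_denomD].
Qed.

Lemma smallZ c : exists k, forall m x, small (m + k) x -> small m (c * x).
Proof.
have [n on] := odd_denom_scale c.
pose b := Num.bound `|c|.
have cb : `|c| <= 2 ^+ b.
  apply: ltW (lt_trans (archi_boundP (normr_ge0 c)) _).
  by rewrite -natrX ltr_nat ltn_expl.
exists (n + b)%N => m x [xr xo]; split.
  rewrite normrM; apply: le_trans xr.
  rewrite [`|c| * _]mulrC -mulrA ler_wpM2l // exprD mulrC ler_wpM2l ?exprn_ge0 // exprD.
  apply: le_trans cb _; rewrite ler_peMl ?exprn_ge0 //.
  by rewrite exprn_ege1 // ler1n.
have -> : c * x / 2 ^+ m = (c * 2 ^+ n) * (x / 2 ^+ (m + (n + b))) * 2 ^+ b.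
  have q0 j : 2 ^+ j != 0 :> rat by rewrite expf_neq0.
  rewrite !exprD; move: (2 ^+ m) (2 ^+ n) (2 ^+ b) (q0 m) (q0 n) (q0 b) => u v w u0 v0 w0.
  by field; apply/and3P.
apply: odd_denomM; first exact: odd_denomM.
by rewrite -natrX; apply: odd_denom_nat.
Qed.

Lemma smallM m x y : small m x -> small m y -> small m (x * y).
Proof.
have p1 : 1 <= 2 ^+ m :> rat by rewrite exprn_ege1 // ler1n.
have p0 : 0 < 2 ^+ m :> rat by rewrite exprn_gt0.
move=> [xr xo] [yr yo]; split.
  rewrite normrM -mulrA -[X in _ <= X]mul1r; apply: ler_pM => //; first by rewrite mulr_ge0 // ltW.
  by apply: le_trans xr; rewrite ler_peMr.
have -> : x * y / 2 ^+ m = (x / 2 ^+ m) * (y / 2 ^+ m) * 2 ^+ m.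
  by move: (2 ^+ m) p0 => u u0; field; rewrite gt_eqF.
apply: odd_denomM; first exact: odd_denomM.
by rewrite -natrX; apply: odd_denom_nat.
Qed.

Definition good (x : rat) := 0 < x /\ unit1mod4 x.

(** Both conditions in [good] are open, for the real and the 2-adic topology respectively. *)
Lemma good_near c : good c -> exists m, forall x, small m x -> good (c + x).
Proof.
move=> [c0 c1]; have [k hk] := smallZ c^-1.
exists (2 + k)%N => x /hk [xr [a [e xo]]].
have -> : c + x = c * (1 + c^-1 * x) by rewrite mulrDr mulr1 mulVKf // gt_eqF.
move: xr xo; set y := c^-1 * x => yr yo; split.
  by rewrite mulr_gt0 //; have := ler_norm (- y); rewrite normrN; move: yr; lra.
apply: unit1mod4M c1 _; exists (2 * e + 1)%:~R; split; first by rewrite intr_eq0; lia.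
exists (e ^+ 2 + e + a * (2 * e + 1)).
have -> : y = 4 * (y / 2 ^+ 2) by field.
move: (y / 2 ^+ 2) yo => v; set o := (2 * e + 1)%:~R => vo.
have -> : (1 + 4 * v) * o ^+ 2 = o * o + 4 * (v * o) * o by ring.
rewrite vo /o -[4]/(4%:~R) -!intrM -intrD; congr (_%:~R); ring.
Qed.

Definition eventually (P : nat -> Prop) := exists N, forall M, (N <= M)%N -> P M.

Lemma eventually_and P Q : eventually P -> eventually Q -> eventually (fun M => P M /\ Q M).
Proof.
move=> [N h] [N' h']; exists (maxn N N') => M; rewrite geq_max => /andP[p q].
by split; [apply: h|apply: h'].
Qed.

Lemma eventually_imp (P Q : nat -> Prop) : (forall M, P M -> Q M) -> eventually P -> eventually Q.
Proof. by move=> pq [N h]; exists N => M NM; apply: pq; apply: h. Qed.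

Lemma eventually_all n (P : nat -> nat -> Prop) :
  (forall i, (i < n)%N -> eventually (P i)) ->
  eventually (fun M => forall i, (i < n)%N -> P i M).
Proof.
elim: n => [|n IH] h; first by exists 0%N.
have := eventually_and (IH (fun i ni => h i (ltnW ni))) (h n (ltnSn n)).
by apply: eventually_imp => M [h1 h2] i; rewrite ltnS leq_eqVlt => /predU1P[->|/h1].
Qed.

Definition null (f : nat -> rat) := forall m, eventually (fun M => small m (f M)).

Lemma nullD f g : null f -> null g -> null (fun M => f M + g M).
Proof.
move=> nf ng m; have := eventually_and (nf m.+1) (ng m.+1).
by apply: eventually_imp => M [fs gs]; apply: smallD.
Qed.

Lemma nullM f g : null f -> null g -> null (fun M => f M * g M).
Proof.
move=> nf ng m; have := eventually_and (nf m) (ng m).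
by apply: eventually_imp => M [fs gs]; apply: smallM.
Qed.

Lemma nullZ c f : null f -> null (fun M => c * f M).
Proof.
move=> nf m; have [k hk] := smallZ c.
by apply: eventually_imp (nf (m + k)%N) => M; apply: hk.
Qed.

Lemma null_eq f g : f =1 g -> null f -> null g.
Proof. by move=> fg nf m; apply: eventually_imp (nf m) => M; rewrite fg. Qed.

(** A square that grows both for the real and for the 2-adic absolute value. *)
Definition growth (M : nat) : rat := (25 / 4) ^+ M.

Lemma growth_gt0 M : 0 < growth M.
Proof. by apply: exprn_gt0; apply: divr_gt0. Qed.

Lemma growth_neq0 M : growth M != 0.
Proof. by rewrite gt_eqF // growth_gt0. Qed.

Lemma null_growthV : null (fun M => (growth M)^-1).
Proof.
move=> m; exists m => M /subnK <-; move: (M - m)%N => {}M.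
have p0 n : 0 < 2 ^+ n :> rat by rewrite exprn_gt0.
have q0 n : 0 < 25 ^+ n :> rat by rewrite exprn_gt0.
have e : (growth (M + m))^-1 = 2 ^+ (M + m + M + m) / 25 ^+ (M + m).
  rewrite /growth -exprVn invf_div exprMn -exprVn; congr (_ * _).
  by rewrite -[4]/(2 ^+ 2 : rat) -exprM; congr (_ ^+ _); lia.
split.
  rewrite ger0_norm ?invr_ge0 ?(ltW (growth_gt0 _)) // e mulrAC ler_pdivrMr // mul1r -exprD.
  apply: le_trans (_ : 16 ^+ (M + m) <= _); last by rewrite lerXn2r ?nnegrE ?ler_nat.
  rewrite -[16]/(2 ^+ 4 : rat) -exprM ler_eXn2l ?ltr1n //; lia.
exists (2 ^+ (M + m + M)), ((25 ^ (M + m))./2)%:Z.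
have -> : 2 * ((25 ^ (M + m))./2)%:Z + 1 = (25 ^ (M + m))%:Z.
  by have := odd_double_half (25 ^ (M + m)); rewrite oddX orbT; lia.
rewrite e -pmulrn natrX exprD rmorphXn /=.
by field; rewrite !gt_eqF.
Qed.

(** f M = (c + o(1)) (growth M)^n; the value c = 0 is allowed, and means that f is of lower
    order. *)
Definition asym (n : nat) (c : rat) (f : nat -> rat) :=
  null (fun M => f M / growth M ^+ n - c).

Lemma asym_eq n c f g : f =1 g -> asym n c f -> asym n c g.
Proof. by move=> fg; apply: null_eq => M; rewrite fg. Qed.

Lemma null0 : null (fun=> 0).
Proof. by move=> m; exists 0%N => M _; split; rewrite ?normr0 ?mul0r ?ler01 //; apply: (odd_denom_int 0). Qed.

Lemma asym_const c : asym 0 c (fun=> c).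
Proof. by apply: null_eq null0 => M; rewrite expr0 divr1 subrr. Qed.

Lemma asym_growth : asym 1 1 growth.
Proof. by apply: null_eq null0 => M; rewrite expr1 divff ?growth_neq0 // subrr. Qed.

Lemma asym_growthV : asym 0 0 (fun M => (growth M)^-1).
Proof. by apply: null_eq null_growthV => M; rewrite expr0 divr1 subr0. Qed.

Lemma asymD n c d f g : asym n c f -> asym n d g -> asym n (c + d) (fun M => f M + g M).
Proof. by move=> af ag; apply: null_eq (nullD af ag) => M; ring. Qed.

Lemma asymM n m c d f g : asym n c f -> asym m d g -> asym (n + m) (c * d) (fun M => f M * g M).
Proof.
move=> af ag; apply: null_eq (nullD (nullD (nullM af ag) (nullZ c ag)) (nullZ d af)) => M.
by move: (growth M) (growth_neq0 M) => T T0; rewrite exprD; field; rewrite !expf_neq0.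
Qed.

Lemma asymZ n c d f : asym n c f -> asym n (d * c) (fun M => d * f M).
Proof. exact: asymM (asym_const d). Qed.

Lemma asymS n c f : asym n c f -> asym n.+1 0 f.
Proof.
move=> af; apply: null_eq (nullD (nullM af null_growthV) (nullZ c null_growthV)) => M.
by move: (growth M) (growth_neq0 M) => T T0; rewrite exprS; field; rewrite T0 expf_neq0.
Qed.

(** The powers of [growth] are positive squares, so only the leading coefficient counts. *)
Lemma asym_good n c f : good c -> asym n c f -> eventually (fun M => good (f M)).
Proof.
move=> gc af; have [m hm] := good_near gc.
apply: eventually_imp (af m) => M /hm; rewrite addrC subrK => -[f0 f1].
have g0 : 0 < growth M ^+ n by rewrite exprn_gt0 // growth_gt0.
have -> : f M = f M / growth M ^+ n * growth M ^+ n by rewrite mulfVK // gt_eqF.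
split; first by rewrite mulr_gt0.
apply: unit1mod4M f1 _.
have -> : growth M ^+ n = ((5 / 2) ^+ (M * n)) ^+ 2.
  by rewrite /growth -!exprM -[25 / 4]/((5 / 2) ^+ 2 : rat) -exprM; congr (_ ^+ _); lia.
have h : (5 / 2 : rat) != 0 by rewrite mulf_neq0 ?invr_eq0 ?pnatr_eq0.
by apply: unit1mod4_sqr; rewrite expf_eq0 (negbTE h) andbF.
Qed.

Lemma prefix_choice (T : Type) (P : seq T -> T -> Prop) :
  (forall s, exists x, P s x) -> exists f : nat -> T, forall n, P (mkseq f n) (f n).
Proof.
move=> /choice[g gP]; pose s n := iter n (fun s => rcons s (g s)) [::].
exists (fun n => g (s n)) => n; suff -> : mkseq (fun n => g (s n)) n = s n by [].
by elim: n => //= n IH; rewrite -[n.+1]addn1 /mkseq iotaD map_cat /= -/(mkseq _ n) IH cats1.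
Qed.

Definition conv (q : nat -> rat) r := \sum_(u < r.+1) q u * q (r - u)%N.

Lemma conv_ends q r : conv q r.+1 = 2 * q 0%N * q r.+1 + \sum_(u < r) q u.+1 * q (r - u)%N.
Proof.
rewrite /conv big_ord_recl big_ord_recr /= subn0 /bump /= !add1n subnn.
have -> : \sum_(i < r) q (1 + i)%N * q (r.+1 - (1 + i))%N = \sum_(u < r) q u.+1 * q (r - u)%N.
  by apply: eq_bigr => u _; rewrite add1n subSS.
ring.
Qed.

(** Each new term is taken to be a large value of [growth], which dominates the three
    expressions, with leading coefficients 1, 1 and 4. These expressions are the leading
    coefficients of the numbers [bform] in [odd_coefficients] and [even_coefficients]. *)
Lemma sequence_exists (x1 : rat) : exists q : nat -> rat, [/\ q 0%N = 1, q 1%N = x1 &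
  forall j, [/\ good (q j.+2 - q j.+1),
    good (q j.+2 + 2 * q j.+1 - 2 * q j - (if j is i.+1 then q i else 0)) &
    good (2 * conv q j.+2)]].
Proof.
pose P (s : seq rat) x := match size s with 0 => x = 1 | 1 => x = x1 | j.+2 =>
  s`_0 = 1 ->
  [/\ good (x - s`_j.+1), good (x + 2 * s`_j.+1 - 2 * s`_j - (if j is i.+1 then s`_i else 0)) &
    good (2 * (2 * s`_0 * x + \sum_(u < j.+1) s`_u.+1 * s`_(j.+1 - u)))] end.
have [|q qP] := @prefix_choice _ P.
  rewrite /P => s; case: (size s) => [|[|j]]; [by exists 1|by exists x1|].
  have [s0|s0] := eqVneq s`_0 1; last by exists 0 => /eqP; rewrite (negbTE s0).
  have g1 : good 1.
    by split=> //; rewrite -[1](expr1n _ 2); apply: unit1mod4_sqr.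
  have g4 : good 4.
    by split=> //; rewrite -[4]/(2 ^+ 2 : rat); apply: unit1mod4_sqr.
  have low c : asym 1 0 (fun=> c) by apply: asymS (asym_const c).
  have h1 : asym 1 1 (fun M => growth M - s`_j.+1).
    by have := asymD asym_growth (low (- s`_j.+1)); rewrite addr0.
  set c2 := 2 * s`_j.+1 - 2 * s`_j - (if j is i.+1 then s`_i else 0).
  have h2 : asym 1 1 (fun M => growth M + 2 * s`_j.+1 - 2 * s`_j - (if j is i.+1 then s`_i else 0)).
    have := asymD asym_growth (low c2); rewrite addr0; apply: asym_eq => M; rewrite /c2; ring.
  set c3 := \sum_(u < j.+1) s`_u.+1 * s`_(j.+1 - u).
  have h3 : asym 1 4 (fun M => 2 * (2 * s`_0 * growth M + c3)).
    have := asymD (asymZ 4 asym_growth) (low (2 * c3)); rewrite addr0 mulr1.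
    by apply: asym_eq => M; rewrite s0; ring.
  have [N hN] := eventually_and (asym_good g1 h1) (eventually_and (asym_good g1 h2) (asym_good g4 h3)).
  by exists (growth N) => _; have [? [? ?]] := hN N (leqnn N).
have q0 : q 0%N = 1 by have := qP 0%N.
exists q; split=> // [|j]; first by have := qP 1%N.
have := qP j.+2; rewrite /P size_mkseq nth_mkseq // => /(_ q0).
rewrite !nth_mkseq // conv_ends => -[h1 h2 h3]; split=> //.
  by move: h2; case: j {h1 h3} => // i; rewrite nth_mkseq // ltnW // ltnW.
congr (good (2 * (_ + _))): h3; apply: eq_bigr => u _.
by rewrite !nth_mkseq //; have := ltn_ord u; lia.
Qed.

(** With N = 2 l - 1 these are the coefficients B_n in the expansion 2 f^2 = sum_n B_n (1 - cos
    (2 n alpha)) of the square of f = sum_u q_u sin ((2 (l - 1 - u) + 1) alpha); compare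
    [curve_identity]. The parameter N stays fixed when l is lowered in [bform_recr]. *)
Definition bform (N l : nat) (q : nat -> rat) (n : nat) : rat :=
  \sum_(u < l) \sum_(v < l) q u * q v *
    ((u + v + n == N)%N%:R - (u + n == v)%N%:R - (v + n == u)%N%:R).

Lemma eq_bform N l q q' n : (forall u, (u < l)%N -> q u = q' u) -> bform N l q n = bform N l q' n.
Proof. by move=> e; apply: eq_bigr => u _; apply: eq_bigr => v _; rewrite !e. Qed.

Lemma bform_recr N l q n : (0 < n)%N ->
  bform N l.+1 q n = bform N l q n + q l ^+ 2 * (l.*2 + n == N)%N%:R +
   2 * q l * \sum_(u < l) q u * ((u + l + n == N)%N%:R - (u + n == l)%N%:R).
Proof.
move=> n0; rewrite /bform big_ord_recr big_ord_recr /=.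
have ln : (l + n == l)%N = false by lia.
rewrite ln !subr0 addnn -expr2.
under eq_bigr => u _ do rewrite big_ord_recr /=.
rewrite big_split /= -!addrA; congr (_ + _); rewrite addrA addrC; congr (_ + _).
rewrite -big_split mulr_sumr /=; apply: eq_bigr => u _.
have lu : (l + n == u)%N = false by have := ltn_ord u; lia.
rewrite lu (addnC l u) /=; move: (_ == N) (u + n == l)%N => b c; ring.
Qed.

Lemma sum_delta l (q : nat -> rat) n m :
  \sum_(u < l) q u * (u + n == m)%N%:R = if (n <= m < l + n)%N then q (m - n)%N else 0.
Proof.
case: ifP => h.
  have lt : (m - n < l)%N by lia.
  rewrite (bigD1 (Ordinal lt)) //= subnK ?eqxx ?mulr1 ?big1 ?addr0 //; last by lia.
  move=> u; rewrite -val_eqE /= => un; have -> : (u + n == m)%N = false by lia.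
  by rewrite mulr0.
rewrite big1 // => u _; have -> : (u + n == m)%N = false by have := ltn_ord u; lia.
by rewrite mulr0.
Qed.

(** For large n no difference of two indices equals n, and a plain convolution remains. *)
Lemma bform_high N l q n : (l <= n <= N)%N -> (N < l + n)%N -> bform N l q n = conv q (N - n).
Proof.
move=> nN Nl; rewrite /conv.
transitivity (\sum_(u < l) q u * (if (u + n <= N)%N then q (N - n - u)%N else 0)).
  apply: eq_bigr => u _.
  transitivity (q u * \sum_(v < l) q v * (v + (u + n) == N)%N%:R).
    rewrite mulr_sumr; apply: eq_bigr => v _.
    have -> : (u + n == v)%N = false by have := ltn_ord v; lia.
    have -> : (v + n == u)%N = false by have := ltn_ord u; lia.
    by rewrite !subr0 mulrA (addnC u v) addnA.
  rewrite sum_delta; congr (_ * _).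
  have -> : (u + n <= N < l + (u + n))%N = (u + n <= N)%N by lia.
  by rewrite (addnC u n) subnDA.
have le : ((N - n).+1 <= l)%N by lia.
rewrite [RHS](big_ord_widen l (fun u => q u * q (N - n - u)%N) le) [RHS]big_mkcond /=.
by apply: eq_bigr => u _; rewrite ltnS; case: ifP; case: ifP; rewrite ?mulr0 //; lia.
Qed.

Lemma good1 : good 1.
Proof. by split=> //; rewrite -[1](expr1n _ 2); apply: unit1mod4_sqr. Qed.

Lemma conv_gt0_good q m : q 0%N = 1 -> (forall r, (0 < r < m)%N -> good (2 * conv q r)) ->
  forall r, (r < m)%N -> 0 < conv q r.
Proof.
move=> q0 h [_|r rm]; first by rewrite /conv big_ord_recl big_ord0 q0.
by have [+ _] := h r.+1 rm; rewrite pmulr_rgt0.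
Qed.

Lemma conv_prod_unit q a b : ~~ odd b -> (forall r, (a <= r < a + b)%N -> good (2 * conv q r)) ->
  unit1mod4 (\prod_(a <= r < a + b) conv q r).
Proof.
move=> ob h.
have -> : \prod_(a <= r < a + b) conv q r =
   \prod_(a <= r < a + b) (2 * conv q r) * ((2 ^+ b./2)^-1) ^+ 2.
  rewrite big_split /= prodr_const_nat addKn exprVn -exprM muln2.
  have -> : (b./2).*2 = b by lia.
  by rewrite mulrAC divff ?mul1r // expf_neq0.
apply: unit1mod4M; last by apply: unit1mod4_sqr; rewrite invr_eq0 expf_neq0.
by rewrite big_nat; apply: unit1mod4_prod => r /h[].
Qed.

(** The last coefficient t is (T - s / T) / 2 for a large value T of [growth], where s is the
    sum of the squares of the others; then t^2 + s is the square of (T + s / T) / 2. The leading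
    coefficient of B_n in T is 1 / 4 for n = 1, a difference of consecutive q for 1 < n <= m,
    and 1 for n = m + 1; the remaining B_n do not involve T and are the convolutions of q. Twice
    each of these is good, except for the one equal to 1; the number m - 1 of the others is even
    when m is odd. *)
Theorem odd_coefficients m : exists (q : nat -> rat) (sigma : rat),
  [/\ forall u, (u <= m)%N -> 0 < q u, 0 < sigma, \sum_(u < m.+1) q u ^+ 2 = sigma ^+ 2,
   forall n, (0 < n < m.+1.*2)%N -> 0 < bform m.*2.+1 m.+1 q n &
   odd m -> unit1mod4 (\prod_(1 <= n < m.+1.*2) bform m.*2.+1 m.+1 q n)].
Proof.
have [q [q0 q1 qP]] := sequence_exists 5.
have g4 : good 4 by split=> //; rewrite -[4]/(2 ^+ 2 : rat); apply: unit1mod4_sqr.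
have g5 : good 5 by split=> //; exists 1; split=> //; exists 1; rewrite expr1n mulr1.
have g20 : good 20.
  by split=> //; exists (1 / 2); split=> //; exists 1.
have dq j : good (q j.+1 - q j).
  case: j => [|j]; last by have [] := qP j.
  by rewrite q0 q1 (_ : 5 - 1 = 4).
have cq r : (0 < r)%N -> good (2 * conv q r).
  case: r => // -[|r] _; last by have [] := qP r.
  by rewrite conv_ends big_ord0 q0 q1 (_ : 2 * _ = 20).
have qgt0 j : 0 < q j.
  by elim: j => [|j IH]; rewrite ?q0 //; have [+ _] := dq j; lra.
pose s := \sum_(u < m) q u ^+ 2.
pose t M := (growth M - s / growth M) / 2.
have at_ : asym 1 (1 / 2) t.
  have := asymZ (1 / 2) (asymD asym_growth (asymS (asymZ (- s) asym_growthV))).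
  by rewrite addr0 mulr1; apply: asym_eq => M; rewrite /t; ring.
pose q' M u := if (u < m)%N then q u else t M.
have q'low M u : (u < m)%N -> q' M u = q u by rewrite /q' => ->.
have q'm M : q' M m = t M by rewrite /q' ltnn.
pose e n := \sum_(u < m) q u * ((u + m + n == m.*2.+1)%N%:R - (u + n == m)%N%:R).
have bE M n : (0 < n)%N -> bform m.*2.+1 m.+1 (q' M) n =
    bform m.*2.+1 m q n + t M ^+ 2 * (n == 1)%N%:R + 2 * t M * e n.
  move=> n0; rewrite bform_recr // q'm (eq_bform _ _ (q'low M)).
  have -> : (m.*2 + n == m.*2.+1)%N = (n == 1)%N by lia.
  congr (_ + _ * _).
  by apply: eq_bigr => u _; rewrite q'low.
have eE n : (1 < n)%N -> e n = (if (n <= m.+1)%N then q (m.+1 - n)%N else 0) * (0 < m)%N%:R -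
    (if (n <= m)%N then q (m - n)%N else 0).
  move=> n1; rewrite /e; under eq_bigr do rewrite mulrBr.
  rewrite sumrB sum_delta; congr (_ - _); last by case: ifP; case: ifP => //; lia.
  transitivity (\sum_(u < m) q u * (u + n == m.+1)%N%:R).
    by apply: eq_bigr => u _; congr (_ * _%:R); lia.
  rewrite sum_delta; case: (posnP m) => [->|m0]; first by rewrite mulr0; case: ifP => //; lia.
  by rewrite mulr1; case: ifP; case: ifP => //; lia.
have top n : (0 < n < m.+2)%N -> eventually (fun M => good (bform m.*2.+1 m.+1 (q' M) n)).
  case: n => // -[_|n /= nm].
    apply: (@asym_good 2 (1 / 4)).
      by split=> //; apply: (@unit1mod4_sqr (1 / 2)).
    have := asymD (asymD (asymM at_ at_) (asymS (asymS (asym_const (bform m.*2.+1 m q 1)))))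
      (asymS (asymZ (2 * e 1%N) at_)).
    rewrite !addr0; apply: asym_eq => M; rewrite bE //=; ring.
  have ge : good (e n.+2).
    rewrite eE //; have m0 : (0 < m)%N by lia.
    rewrite m0 mulr1 ifT; last by lia.
    case: ifP => h; last first.
      have -> : (m.+1 - n.+2 = 0)%N by lia.
      by rewrite q0 subr0; exact: good1.
    by have -> : (m.+1 - n.+2 = (m - n.+2).+1)%N by lia.
  apply: (@asym_good 1 (e n.+2)) => //.
  have := asymD (asymS (asym_const (bform m.*2.+1 m q n.+2))) (asymZ (2 * e n.+2) at_).
  have -> : 0 + 2 * e n.+2 * (1 / 2) = e n.+2 by field.
  by apply: asym_eq => M; rewrite bE //=; ring.
have high M n : (m.+1 < n < m.+1.*2)%N -> bform m.*2.+1 m.+1 (q' M) n = conv q (m.*2.+1 - n).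
  move=> h; rewrite bE; last by lia.
  rewrite eE; last by lia.
  rewrite !ifF; try lia.
  have -> : (n == 1)%N = false by lia.
  by rewrite bform_high ?subr0 ?mul0r ?mulr0 ?addr0 //; lia.
have tpos : eventually (fun M => 0 < t M).
  have := asym_good _ (asymZ 2 at_); rewrite (_ : 2 * (1 / 2) = 1) // => /(_ good1).
  by apply: eventually_imp => M []; rewrite pmulr_rgt0.
have [N hN] := eventually_and tpos (@eventually_all m.+1
  (fun i M => good (bform m.*2.+1 m.+1 (q' M) i.+1)) (fun i im => top i.+1 im)).
have [tN {}top] := hN N (leqnn N).
exists (q' N), ((growth N + s / growth N) / 2); split.
- by move=> u um; rewrite /q'; case: ifP.
- rewrite divr_gt0 // ltr_wpDr ?growth_gt0 // divr_ge0 ?(ltW (growth_gt0 _)) //.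
  by apply: sumr_ge0 => i _; apply: sqr_ge0.
- rewrite big_ord_recr /= q'm (eq_bigr (fun i : 'I_m => q i ^+ 2)) => [|i _]; last by rewrite q'low.
  by rewrite -/s /t; move: (growth N) (growth_neq0 N) => T T0; field.
- move=> n /andP[n0 nm]; have [h|h] := leqP n m.+1.
    by case: n n0 nm h => // n _ _ h; have [] := top n h.
  rewrite high; last by rewrite h.
  by apply: (@conv_gt0_good q m) => // [r /andP[r0 _]|]; [apply: cq|lia].
move=> om; rewrite (@big_cat_nat _ _ _ m.+2) //=; last by lia.
apply: unit1mod4M.
  rewrite big_add1 /= big_mkord; apply: unit1mod4_prod => i _; have [] := top i (ltn_ord i) => //.
have -> : \prod_(m.+2 <= n < m.+1.*2) bform m.*2.+1 m.+1 (q' N) n = \prod_(0 <= r < m) conv q r.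
  rewrite big_nat_rev -{1}[m.+2]add0n big_addn (_ : m.+1.*2 - m.+2 = m)%N; last by lia.
  apply: eq_big_nat => r /andP[_ rm]; rewrite high; last by lia.
  by congr (conv q _); lia.
case: m om {s t at_ q' q'low q'm e bE eE top high tpos hN tN} => // m om.
rewrite big_ltn // {1}/conv big_ord_recl big_ord0 subnn q0 !mulr1 addr0 mul1r.
rewrite -add1n; apply: conv_prod_unit => [|r /andP[r0 _]]; [by []|exact: cq].
Qed.

(** Two coefficients p and t are added on top of q, with t = T - c for a large value T of
    [growth]. The equation B_1 = 0 is linear in p, and the shift by c is chosen to make its
    solution p = (T - 2 c + kappa / T) / 2 a Laurent polynomial in T. The leading coefficients
    of the following B_n are 1, 1 / 4 and the combinations E of four consecutive terms of q; the
    remaining B_n are convolutions of q. *)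
Theorem even_coefficients m : exists q : nat -> rat,
  [/\ bform m.*2.+3 m.+2 q 1 = 0,
   forall n, (1 < n < m.+2.*2)%N -> 0 < bform m.*2.+3 m.+2 q n &
   ~~ odd m -> unit1mod4 (\prod_(2 <= n < m.+2.*2) bform m.*2.+3 m.+2 q n)].
Proof.
have [q [q0 q1 qP]] := sequence_exists 2.
have g4 : good 4 by split=> //; rewrite -[4]/(2 ^+ 2 : rat); apply: unit1mod4_sqr.
have gq : good (1 / 4) by split=> //; apply: (@unit1mod4_sqr (1 / 2)).
pose E j := q j + (if j is i.+1 then 2 * q i else 0) - (if j is i.+2 then 2 * q i else 0) -
  (if j is i.+3 then q i else 0).
have gE j : good (E j).
  case: j => [|[|j]]; rewrite /E ?q0 ?q1 ?subr0 ?addr0; first exact: good1.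
    by rewrite (_ : 2 + 2 * 1 = 4).
  by have [] := qP j.
have cq r : (1 < r)%N -> good (2 * conv q r).
  by case: r => [|[|r]] // _; have [] := qP r.
have c1 : conv q 1 = 4 by rewrite conv_ends big_ord0 q0 q1.
have cpos r : 0 < conv q r.
  case: r => [|[|r]]; [by rewrite /conv big_ord_recl big_ord0 q0 | by rewrite c1|].
  by have [+ _] := cq r.+2 isT; rewrite pmulr_rgt0.
pose N := m.*2.+3.
pose c := \sum_(u < m) q u * (u + 1 == m)%N%:R.
pose low n := bform N m q n.
pose kappa := c ^+ 2 + low 1%N.
pose t M := growth M - c.
pose p M := (growth M - 2 * c + kappa / growth M) / 2.
have at_ : asym 1 1 t.
  by have := asymD asym_growth (asymS (asym_const (- c))); rewrite addr0.
have ap : asym 1 (1 / 2) p.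
  have := asymZ (1 / 2) (asymD (asymD asym_growth (asymS (asym_const (- (2 * c)))))
    (asymS (asymZ kappa asym_growthV))).
  by rewrite !addr0 mulr1; apply: asym_eq => M; rewrite /p; ring.
pose q' M u := if (u < m)%N then q u else if u == m then p M else t M.
have q'low M u : (u < m)%N -> q' M u = q u by rewrite /q' => ->.
have q'm M : q' M m = p M by rewrite /q' ltnn eqxx.
have q'm1 M : q' M m.+1 = t M by rewrite /q' ltnNge leqnSn gtn_eqF.
pose d k : rat := \sum_(u < m) q u * (u + k == m)%N%:R.
pose dd n k := \sum_(u < m) q u * (u + n == m + k)%N%:R.
have bE M n : (0 < n)%N -> bform N m.+2 (q' M) n = low n + p M ^+ 2 * (n == 3)%N%:R +
    2 * p M * (dd n 3%N - dd n 0%N) + t M ^+ 2 * (n == 1)%N%:R +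
    2 * t M * (dd n 2%N - dd n 1%N + p M * ((n == 2)%N%:R - (n == 1)%N%:R)).
  move=> n0; rewrite !bform_recr // q'm q'm1 (eq_bform _ _ (q'low M)) big_ord_recr /= q'm.
  have -> : (m.*2 + n == N)%N = (n == 3)%N by rewrite /N; lia.
  have -> : (m.+1.*2 + n == N)%N = (n == 1)%N by rewrite /N; lia.
  have -> : (m + m.+1 + n == N)%N = (n == 2)%N by rewrite /N; lia.
  have -> : (m + n == m.+1)%N = (n == 1)%N by lia.
  have e1 : \sum_(u < m) q' M u * ((u + m + n == N)%N%:R - (u + n == m)%N%:R) = dd n 3%N - dd n 0%N.
    rewrite /dd -sumrB; apply: eq_bigr => u _; rewrite q'low // -mulrBr addn0.
    by congr (_ * (_%:R - _)); rewrite /N; lia.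
  have e2 : \sum_(u < m) q' M u * ((u + m.+1 + n == N)%N%:R - (u + n == m.+1)%N%:R) = dd n 2%N - dd n 1%N.
    rewrite /dd -sumrB; apply: eq_bigr => u _; rewrite q'low // -mulrBr addn1.
    by congr (_ * (_%:R - _)); rewrite /N; lia.
  by rewrite e1 e2.
have ddE n k : dd n k = if (n <= m + k < m + n)%N then q (m + k - n)%N else 0 by exact: sum_delta.
have b1 M : bform N m.+2 (q' M) 1 = 0.
  have z3 : dd 1 3%N = 0 by rewrite ddE ifF //; lia.
  have z2 : dd 1 2%N = 0 by rewrite ddE ifF //; lia.
  have z1 : dd 1 1%N = 0 by rewrite ddE ifF //; lia.
  have z0 : dd 1 0%N = c by apply: eq_bigr => u _; rewrite addn0.
  rewrite bE //= z3 z2 z1 z0 /p /t /kappa.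
  by move: (growth M) (growth_neq0 M) => T T0; field.
have top n : (1 < n < m.+4)%N -> eventually (fun M => good (bform N m.+2 (q' M) n)).
  case: n => [|[|[|[|n]]]] // h.
  - apply: (@asym_good 2 1); first exact: good1.
    have := asymD (asymS (asymS (asym_const (low 2)))) (asymD (asymS (asymZ (2 * (dd 2 3%N - dd 2 0%N)) ap))
      (asymD (asymS (asymZ (2 * (dd 2 2%N - dd 2 1%N)) at_)) (asymZ 2 (asymM ap at_)))).
    have -> : 0 + (0 + (0 + 2 * (1 / 2 * 1))) = 1 :> rat by field.
    by apply: asym_eq => M; rewrite bE //=; ring.
  - apply: (@asym_good 2 (1 / 4)) => //.
    have := asymD (asymS (asymS (asym_const (low 3)))) (asymD (asymS (asymZ (2 * (dd 3 3%N - dd 3 0%N)) ap))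
      (asymD (asymS (asymZ (2 * (dd 3 2%N - dd 3 1%N)) at_)) (asymM ap ap))).
    have -> : 0 + (0 + (0 + 1 / 2 * (1 / 2))) = 1 / 4 :> rat by field.
    by apply: asym_eq => M; rewrite bE //=; ring.
  apply: (@asym_good 1 (E (m.+3 - n.+4)%N)) => //.
  have := asymD (asymS (asym_const (low n.+4))) (asymD (asymZ (2 * (dd n.+4 3%N - dd n.+4 0%N)) ap)
      (asymZ (2 * (dd n.+4 2%N - dd n.+4 1%N)) at_)).
  have -> : 0 + (2 * (dd n.+4 3 - dd n.+4 0) * (1 / 2) + 2 * (dd n.+4 2 - dd n.+4 1) * 1) = E (m.+3 - n.+4)%N.
    rewrite !ddE; have [j mj] : exists j, m = (n + j).+1 by exists (m - n.+1)%N; lia.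
    have -> : (m.+3 - n.+4 = j)%N by lia.
    have -> : (n.+3 < m + 3 < m + n.+4)%N by lia.
    have -> : (m + 3 - n.+4 = j)%N by lia.
    rewrite /E; case: j mj => [|[|[|j]]] mj.
    - by rewrite !ifF; [field|lia|lia|lia].
    - rewrite ifF; last by lia.
      rewrite ifT; last by lia.
      rewrite ifF; last by lia.
      rewrite (_ : m + 2 - n.+4 = 0)%N; last by lia.
      by field.
    - rewrite ifF; last by lia.
      rewrite !ifT; try lia.
      rewrite (_ : m + 2 - n.+4 = 1)%N; last by lia.
      rewrite (_ : m + 1 - n.+4 = 0)%N; last by lia.
      by field.
    rewrite !ifT; try lia.
    rewrite (_ : m + 2 - n.+4 = j.+2)%N; last by lia.
    rewrite (_ : m + 1 - n.+4 = j.+1)%N; last by lia.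
    rewrite (_ : m + 0 - n.+4 = j)%N; last by lia.
    by field.
  by apply: asym_eq => M; rewrite bE //=; ring.
have high M n : (m.+3 < n < m.+2.*2)%N -> bform N m.+2 (q' M) n = conv q (N - n).
  move=> h; rewrite bE; last by lia.
  rewrite !ddE !ifF; try lia.
  have -> : (n == 1)%N = false by lia.
  have -> : (n == 2)%N = false by lia.
  have -> : (n == 3)%N = false by lia.
  by rewrite /low bform_high ?subrr ?mulr0 ?addr0 ?mulr0 ?addr0 ?subrr ?mulr0 ?addr0 //; rewrite /N; lia.
have [M hM] := @eventually_all m.+2
  (fun i M => good (bform N m.+2 (q' M) i.+2)) (fun i im => top i.+2 im).
have {}top := hM M (leqnn M).
exists (q' M); split=> //.
  move=> n /andP[n0 nm]; have [h|h] := leqP n m.+3.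
    by case: n n0 nm h => [|[|n]] // _ _ h; have [] := top n h.
  by rewrite high // h.
move=> om; rewrite (@big_cat_nat _ _ _ m.+4) //=; last by lia.
apply: unit1mod4M.
  rewrite !big_add1 /= big_mkord; apply: unit1mod4_prod => i _; by have [] := top i (ltn_ord i).
have -> : \prod_(m.+4 <= n < m.+2.*2) bform N m.+2 (q' M) n = \prod_(0 <= r < m) conv q r.
  rewrite big_nat_rev -{1}[m.+4]add0n big_addn (_ : m.+2.*2 - m.+4 = m)%N; last by lia.
  apply: eq_big_nat => r /andP[_ rm]; rewrite high; last by lia.
  by congr (conv q _); rewrite /N; lia.
case: m om {N c low kappa t p at_ ap q' q'low q'm q'm1 d dd bE ddE b1 top high hM} => [|[|m]] // om.
  by rewrite big_geq //; have [] := good1.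
rewrite big_ltn // big_ltn // {1}/conv big_ord_recl big_ord0 subnn q0 !mulr1 addr0 mul1r c1.
apply: unit1mod4M; first by have [] := g4.
rewrite -add2n; apply: conv_prod_unit => [|r /andP[r0 _]]; [by move: om => /=; rewrite negbK|exact: cq].
Qed.

(** * Orthogonal frames *)

Section RationalForms.
Variable R : rcfType.
Implicit Types (f g : (nat -> R) -> R) (s t : seq rat) (x y : nat -> R).

(** Coordinates are kept as functions, so that successive changes of variables compose. *)
Definition rat_linear n f := exists c : nat -> rat, forall x, f x = \sum_(0 <= i < n) ratr (c i) * x i.

Lemma rat_linear_lform n m j : rat_linear n (fun x => lform n m x j).
Proof. by exists (m j). Qed.

Lemma rat_linear_eq n f g : f =1 g -> rat_linear n f -> rat_linear n g.
Proof. by move=> fg [c h]; exists c => x; rewrite -fg. Qed.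

Lemma rat_linear_coord n i : (i < n)%N -> rat_linear n (fun x => x i).
Proof.
move=> ni; exists (fun j => (j == i)%:R) => x; rewrite big_mkord (bigD1 (Ordinal ni)) //= eqxx rmorph1 mul1r.
by rewrite big1 ?addr0 // => j; rewrite -val_eqE /= => /negbTE ->; rewrite rmorph0 mul0r.
Qed.

Lemma rat_linear0 n : rat_linear n (fun=> 0).
Proof. by exists (fun=> 0) => x; rewrite big1 // => i _; rewrite rmorph0 mul0r. Qed.

Lemma rat_linearD n f g : rat_linear n f -> rat_linear n g -> rat_linear n (fun x => f x + g x).
Proof.
move=> [c h] [c' h']; exists (fun i => c i + c' i) => x.
by rewrite h h' -big_split; apply: eq_bigr => i _; rewrite rmorphD mulrDl.
Qed.

Lemma rat_linearZ n a f : rat_linear n f -> rat_linear n (fun x => ratr a * f x).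
Proof.
move=> [c h]; exists (fun i => a * c i) => x.
by rewrite h mulr_sumr; apply: eq_bigr => i _; rewrite rmorphM mulrA.
Qed.

Lemma rat_linear_sum n (I : Type) (r : seq I) (P : pred I) (F : I -> (nat -> R) -> R) :
  (forall i, P i -> rat_linear n (F i)) -> rat_linear n (fun x => \sum_(i <- r | P i) F i x).
Proof.
move=> h; elim: r => [|i r IH].
  by apply: rat_linear_eq (rat_linear0 n) => x; rewrite big_nil.
apply: (@rat_linear_eq _ (fun x => (if P i then F i x else 0) + \sum_(j <- r | P j) F j x)).
  by move=> x; rewrite big_cons; case: (P i); rewrite ?add0r.
by apply: rat_linearD => //; case: (boolP (P i)) => [/h|_] //; apply: rat_linear0.
Qed.

Lemma rat_linear_comp n p f (y : (nat -> R) -> nat -> R) :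
  (forall j, (j < n)%N -> rat_linear p (fun x => y x j)) -> rat_linear n f ->
  rat_linear p (fun x => f (y x)).
Proof.
move=> hy [c h]; apply: (@rat_linear_eq _ (fun x => \sum_(j < n) ratr (c j) * y x j)).
  by move=> x; rewrite h big_mkord.
by apply: rat_linear_sum => j _; apply: rat_linearZ; apply: hy.
Qed.

Lemma rat_linear_left n p f : (n <= p)%N -> rat_linear n f -> rat_linear p f.
Proof.
move=> np; apply: (@rat_linear_comp _ _ _ (fun x => x)) => j jn.
by apply: rat_linear_coord; apply: leq_trans jn np.
Qed.

Lemma rat_linear_shift n p k f : (k + n <= p)%N -> rat_linear n f ->
  rat_linear p (fun x => f (fun i => x (k + i)%N)).
Proof.
move=> kp; apply: (@rat_linear_comp _ _ _ (fun x i => x (k + i)%N)) => j jn.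
by apply: rat_linear_coord; lia.
Qed.

Lemma rat_linear_comb n f (I : finType) (c : I -> R) (x : I -> nat -> R) : rat_linear n f ->
  f (fun j => \sum_i c i * x i j) = \sum_i c i * f (x i).
Proof.
move=> [a h]; rewrite h; under eq_bigr do rewrite mulr_sumr; rewrite exchange_big /=.
apply: eq_bigr => i _; rewrite h mulr_sumr; apply: eq_bigr => j _; ring.
Qed.

Lemma rat_linear_ext n f x y : rat_linear n f -> (forall i, (i < n)%N -> x i = y i) -> f x = f y.
Proof. by move=> [c h] e; rewrite !h; apply: eq_big_nat => i /andP[_ ni]; rewrite e. Qed.

Lemma rat_linear_lin n f a x b y : rat_linear n f ->
  f (fun i => a * x i + b * y i) = a * f x + b * f y.
Proof.
move=> [c h]; rewrite !h !mulr_sumr -big_split; apply: eq_bigr => i _ /=; ring.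
Qed.

Lemma rat_linear_rat n f (q : nat -> rat) : rat_linear n f ->
  exists r : rat, f (fun i => ratr (q i)) = ratr r.
Proof.
move=> [c h]; exists (\sum_(0 <= i < n) c i * q i).
by rewrite h rmorph_sum; apply: eq_bigr => i _; rewrite rmorphM.
Qed.

Lemma dform_scale a s x : dform (map ( *%R a) s) x = ratr a * dform s x.
Proof.
rewrite /dform size_map mulr_sumr; apply: eq_big_nat => i /andP[_ si].
by rewrite (nth_map 0) // rmorphM mulrA.
Qed.

Lemma dform_cons a s x : dform (a :: s) x = ratr a * x 0%N ^+ 2 + dform s (fun i => x i.+1).
Proof. by rewrite -cat1s dform_cat /dform big_nat1. Qed.

Lemma dform_nseq a n x : dform (nseq n a) x = ratr a * \sum_(0 <= i < n) x i ^+ 2.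
Proof.
rewrite /dform size_nseq mulr_sumr; apply: eq_big_nat => i /andP[_ ni].
by rewrite nth_nseq ni.
Qed.

Lemma dform_ext s x y : (forall i, (i < size s)%N -> x i = y i) -> dform s x = dform s y.
Proof. by move=> e; apply: eq_big_nat => i /andP[_ si]; rewrite e. Qed.

Lemma dform_hdouble D s x :
  dform (hdouble D s) x = dform s x + ratr D * dform s (fun i => x (size s + i)%N).
Proof. by rewrite /hdouble dform_cat dform_scale. Qed.

(** The vector (1, ..., 1) is split off one coordinate at a time, by b x^2 + L^2 / S = (b x +
    L)^2 / (b + S) + (b S / (b + S)) (x - L / S)^2. *)
Lemma gram_schmidt b s : {in b :: s, forall a, 0 < a} -> exists C : seq rat,
  [/\ size C = size s, {in C, forall a, 0 < a},
   \prod_(c <- C) c * \sum_(c <- b :: s) c = \prod_(c <- b :: s) c &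
   exists F : nat -> (nat -> R) -> R, (forall j, rat_linear (size s).+1 (F j)) /\
   forall x, dform (b :: s) x =
     (\sum_(0 <= i < (size s).+1) ratr (b :: s)`_i * x i) ^+ 2 / ratr (\sum_(c <- b :: s) c) +
     dform C (fun j => F j x)].
Proof.
elim: s b => [|a s IH] b sp.
  exists [::]; split=> //; first by rewrite !big_cons !big_nil; ring.
  exists (fun _ _ => 0); split=> [j|x]; first exact: rat_linear0.
  rewrite /dform /= big_nat1 big_nat1 (@big_geq _ _ _ 0 0) // big_cons big_nil !addr0 /=.
  have b0 : (ratr b : R) != 0 by rewrite fmorph_eq0 gt_eqF // sp // mem_head.
  by field.
have b0 : 0 < b by rewrite sp // mem_head.
have sp' : {in a :: s, forall c, 0 < c} by move=> x xs; apply: sp; rewrite inE xs orbT.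
have [C [sC Cp pC [F [Fl FE]]]] := IH a sp'.
set S := \sum_(c <- a :: s) c in pC FE.
have S0 : 0 < S.
  rewrite /S big_cons ltr_wpDr ?sp' ?mem_head // big_seq; apply: sumr_ge0 => x xs.
  by apply: ltW; apply: sp'; rewrite inE xs orbT.
have bS0 : b + S != 0 by rewrite gt_eqF // addr_gt0.
exists (b * S / (b + S) :: C); split.
- by rewrite /= sC.
- move=> x; rewrite inE => /predU1P[->|/Cp //].
  by rewrite divr_gt0 ?mulr_gt0 // addr_gt0.
- have -> : \prod_(c <- [:: b, a & s]) c = b * (\prod_(c <- C) c * S) by rewrite big_cons pC.
  by rewrite big_cons [\sum_(c <- _) _]big_cons -/S; field.
pose L (x : nat -> R) := \sum_(0 <= i < (size s).+1) ratr (a :: s)`_i * x i.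
have Ll : rat_linear (size s).+1 L by exists (fun i => (a :: s)`_i).
exists (fun j x => if j is j'.+1 then F j' (fun i => x i.+1) else x 0%N + ratr (- S^-1) * L (fun i => x i.+1)).
split=> [[|j]|x].
- apply: rat_linearD; first exact: rat_linear_coord.
  by apply: rat_linearZ; apply: (@rat_linear_shift (size s).+1 _ 1).
- by apply: (@rat_linear_shift (size s).+1 _ 1).
rewrite dform_cons FE -/(L _) dform_cons big_nat_recl //= -/(L (fun i => x i.+1)) big_cons -/S.
move: (dform C _) (L _) => d l.
rewrite fmorph_div rmorphN fmorphV rmorphD rmorphM /=.
have S0' : (ratr S : R) != 0 by rewrite fmorph_eq0 gt_eqF.
have bS0' : (ratr b : R) + ratr S != 0 by rewrite -rmorphD fmorph_eq0.
by field; rewrite ?S0' ?bS0'.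
Qed.

(** The functions F_j are the coordinates of an isometry from s to t. *)
Definition orth_frame s (t : seq rat) (F : nat -> (nat -> R) -> R) :=
  (forall j, rat_linear (size s) (F j)) /\ forall x, dform s x = dform t (fun j => F j x).

Definition bilin s x y : R := \sum_(0 <= i < size s) ratr s`_i * (x i * y i).

Lemma dform_lin s a x b y : dform s (fun i => a * x i + b * y i) =
  a ^+ 2 * dform s x + 2 * a * b * bilin s x y + b ^+ 2 * dform s y.
Proof.
rewrite /dform /bilin !mulr_sumr -!big_split; apply: eq_bigr => i _ /=; ring.
Qed.

Lemma polar_frame s t F x y : orth_frame s t F ->
  bilin s x y = bilin t (fun j => F j x) (fun j => F j y).
Proof.
move=> [Fl FE]; have := FE (fun i => 1 * x i + 1 * y i).
rewrite dform_lin !FE; under [in RHS]dform_ext => j _ do rewrite (rat_linear_lin _ _ _ _ (Fl j)).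
rewrite dform_lin; lra.
Qed.

(** By polarisation an isometry is inverted by its adjoint, so every rational functional is
    rational in the new coordinates as well. *)
Lemma frame_dual s t F (k : nat -> rat) : {in s, forall a, 0 < a} -> orth_frame s t F ->
  exists k' : nat -> rat, forall x,
    \sum_(0 <= i < size s) ratr (k i) * x i = \sum_(0 <= j < size t) ratr (k' j) * F j x.
Proof.
move=> sp Fo; have [Fl FE] := Fo.
pose y i := k i / s`_i.
have [k' hk'] : exists k' : nat -> rat, forall j, (j < size t)%N -> ratr t`_j * F j (fun i => ratr (y i)) = ratr (k' j).
  have h j : exists q : rat, F j (fun i => ratr (y i)) = ratr q := rat_linear_rat y (Fl j).
  elim: (size t) => [|n [k' IH]]; first by exists (fun=> 0).
  have [q hq] := h n; exists (fun j => if j == n then t`_j * q else k' j) => j.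
  rewrite ltnS leq_eqVlt; case: eqVneq => [->|_ /= /IH //] _.
  by rewrite hq rmorphM.
exists k' => x; transitivity (bilin s (fun i => ratr (y i)) x).
  apply: eq_big_nat => i /andP[_ si]; have s0 : s`_i != 0 by rewrite gt_eqF // sp // mem_nth.
  by rewrite mulrA -rmorphM /y mulrCA divff // mulr1.
rewrite (polar_frame _ _ Fo); apply: eq_big_nat => j /andP[_ tj].
by rewrite mulrA hk'.
Qed.

Lemma dform_eq0 s x : {in s, forall a, 0 < a} -> dform s x = 0 ->
  forall i, (i < size s)%N -> x i = 0.
Proof.
move=> sp + i si; rewrite /dform big_mkord => /eqP.
rewrite psumr_eq0 => [/allP /(_ (Ordinal si))|j _].
  rewrite mem_index_enum => /(_ isT) /=; rewrite mulf_eq0 fmorph_eq0 sqrf_eq0.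
  by rewrite gt_eqF ?sp ?mem_nth //= => /eqP.
by rewrite mulr_ge0 ?sqr_ge0 // ler0q ltW // sp // mem_nth.
Qed.

Lemma frame_inj s t F x : {in s, forall a, 0 < a} -> orth_frame s t F ->
  (forall j, (j < size t)%N -> F j x = 0) -> forall i, (i < size s)%N -> x i = 0.
Proof.
move=> sp [_ FE] h; apply: dform_eq0 => //; rewrite FE /dform big_nat big1 // => j /andP[_ tj].
by rewrite h // expr0n mulr0.
Qed.

Lemma isometric_frame s t : isometric R s t -> exists F, orth_frame s t F.
Proof.
move=> [e [m h]]; exists (fun j x => lform (size s) m x j); split=> // j.
exact: rat_linear_lform.
Qed.

(** Among the coordinates with weights b :: s the direction (1, ..., 1) is split off as the
    first coordinate of the frame; it gets the coefficient 1 because the weights add up to a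
    square. The weights C left over are paired with the second half D (1 :: C) of the form:
    [hdouble D C] is a sum of squares times D, and a single D remains. *)
Lemma odd_frame b s sigma : {in b :: s, forall a, 0 < a} -> 0 < sigma ->
  \sum_(c <- b :: s) c = sigma ^+ 2 -> ~~ odd (size s) ->
  (4 %| size s)%N \/ unit1mod4 (\prod_(c <- b :: s) c) ->
  exists2 D, 0 < D & exists F, orth_frame (hdouble D (b :: s)) (1 :: nseq (2 * size s).+1 D) F /\
    forall x, F 0%N x = \sum_(0 <= i < (size s).+1) ratr ((b :: s)`_i / sigma) * x i.
Proof.
move=> sp sg0 S es cs; have [C [sC Cp pC [G [Gl GE]]]] := gram_schmidt sp.
have cs' : (4 %| size C)%N \/ unit1mod4 (\prod_(c <- C) c).
  rewrite sC; case: cs => [|[r [r0 [z hz]]]]; [by left|right].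
  exists (r * sigma); rewrite mulf_neq0 ?(gt_eqF sg0) //; split=> //; exists z.
  by rewrite -hz -pC S; ring.
have oC : ~~ odd (size C) by rewrite sC.
have [D D0 isoC] := isometric_sum_squares R Cp oC cs'.
exists D => //; rewrite sC in isoC.
have [H [Hl HE]] := isometric_frame (isometric_cons D isoC).
set n := (size s).+1.
pose xi (x : nat -> R) := \sum_(0 <= i < n) ratr ((b :: s)`_i / sigma) * x i.
have xil : rat_linear n xi by exists (fun i => (b :: s)`_i / sigma).
pose sh (x : nat -> R) i := x (n + i)%N.
pose y (x : nat -> R) j := if j is j'.+1 then
  if (j' < size s)%N then G j' x else G (j' - size s)%N (sh x) else xi (sh x).
have yl j : rat_linear (2 * n) (fun x => y x j).
  case: j => [|j] /=; first by apply: rat_linear_shift xil; lia.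
  case: (j < size s)%N; first by apply: rat_linear_left (Gl j); lia.
  by apply: rat_linear_shift (Gl _); lia.
exists (fun j x => if j is j'.+1 then H j' (y x) else xi x); split=> //; split.
  have -> : size (hdouble D (b :: s)) = (2 * n)%N by rewrite size_cat size_map /=; lia.
  case=> [|j]; first by apply: rat_linear_left xil; lia.
  by apply: rat_linear_comp (Hl j) => i _; apply: yl.
move=> x; rewrite dform_hdouble (dform_cons 1).
have := HE (y x); rewrite -[D :: nseq _ D]/(nseq (2 * size s).+1 D) => <-.
rewrite (dform_cons D) dform_hdouble !GE S rmorph1 mul1r sC.
have xiE z : (\sum_(0 <= i < n) ratr (b :: s)`_i * z i) ^+ 2 / ratr (sigma ^+ 2) = xi z ^+ 2.
  have sg' : (ratr sigma : R) != 0 by rewrite fmorph_eq0 gt_eqF.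
  rewrite rmorphXn /= -expr_div_n mulr_suml; congr (_ ^+ 2).
  by apply: eq_bigr => i _; rewrite fmorph_div /=; field.
rewrite !xiE /=.
have e1 : dform C (fun j => G j x) = dform C (fun i => y x i.+1).
  by apply: dform_ext => j; rewrite sC /= => ->.
have e2 : dform C (fun j => G j (sh x)) = dform C (fun i => y x (size s + i).+1).
  by apply: dform_ext => j; rewrite sC /= => js; rewrite ltnNge leq_addr /= addKn.
by rewrite e1 -/(sh x) e2; ring.
Qed.
End RationalForms.

(** * The trigonometric curve *)

Section Curve.
Variable R : rcfType.
Local Open Scope complex_scope.
Local Notation C := (R[i]).
Local Notation cj := (@conjc R).
Implicit Types (w y : C) (q : nat -> rat).

Lemma cReD x y : complex.Re (x + y : C) = complex.Re x + complex.Re y.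
Proof. by case: x y => [a b] [c d]. Qed.
Lemma cImD x y : complex.Im (x + y : C) = complex.Im x + complex.Im y.
Proof. by case: x y => [a b] [c d]. Qed.
Lemma cReM x y : complex.Re (x * y : C) = complex.Re x * complex.Re y - complex.Im x * complex.Im y.
Proof. by case: x y => [a b] [c d]. Qed.
Lemma cImM x y : complex.Im (x * y : C) = complex.Re x * complex.Im y + complex.Im x * complex.Re y.
Proof. by case: x y => [a b] [c d]. Qed.
Lemma Re_sum (I : Type) (r : seq I) (P : pred I) (F : I -> C) :
  complex.Re (\sum_(i <- r | P i) F i) = \sum_(i <- r | P i) complex.Re (F i).
Proof. by apply: (big_morph _ cReD). Qed.
Lemma Im_sum (I : Type) (r : seq I) (P : pred I) (F : I -> C) :
  complex.Im (\sum_(i <- r | P i) F i) = \sum_(i <- r | P i) complex.Im (F i).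
Proof. by apply: (big_morph _ cImD). Qed.
Lemma complex_ext (x y : C) : complex.Re x = complex.Re y -> complex.Im x = complex.Im y -> x = y.
Proof. by case: x y => [a b] [c d] /= -> ->. Qed.

Definition normsq (x : C) : R := complex.Re x ^+ 2 + complex.Im x ^+ 2.

Lemma normsqM x y : normsq (x * y) = normsq x * normsq y.
Proof. by rewrite /normsq cReM cImM; ring. Qed.

Lemma normsqJ x : normsq (cj x) = normsq x.
Proof. by case: x => a b; rewrite /normsq /= sqrrN. Qed.

Lemma normsqE x : x * cj x = (normsq x)%:C.
Proof. by case: x => a b; apply: complex_ext; rewrite /normsq ?cReM ?cImM /=; ring. Qed.

Lemma normsq_gt0 x : x != 0 -> 0 < normsq x.
Proof.
move=> x0; rewrite lt_neqAle addr_ge0 ?sqr_ge0 // andbT eq_sym.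
apply: contra x0; rewrite paddr_eq0 ?sqr_ge0 // !sqrf_eq0 => /andP[/eqP a /eqP b].
by apply/eqP; apply: complex_ext.
Qed.

Definition on_circle w := w * cj w = 1.

Lemma on_circleP w : on_circle w -> normsq w = 1.
Proof. by rewrite /on_circle normsqE => -[]. Qed.

Lemma on_circleX w n : on_circle w -> on_circle (w ^+ n).
Proof. by rewrite /on_circle => h; rewrite rmorphXn -exprMn h expr1n. Qed.

Lemma on_circle_neq0 w : on_circle w -> w != 0.
Proof. by rewrite /on_circle => h; apply: contraTneq (oner_neq0 C) => w0; rewrite -h w0 mul0r eqxx. Qed.

(** The hypotheses say that sum_i c_i conj(w_i)^K p(w_i) = 0 for all polynomials p of degree at
    most 2 K; take p to vanish at all w_j except one. *)
Lemma trig_free K (w : 'I_(2 * K).+1 -> C) (c : 'I_(2 * K).+1 -> R) :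
  injective w -> (forall i, on_circle (w i)) ->
  (forall n, (n <= K)%N -> \sum_i c i * complex.Re (w i ^+ n) = 0) ->
  (forall n, (n <= K)%N -> \sum_i c i * complex.Im (w i ^+ n) = 0) ->
  forall i, c i = 0.
Proof.
move=> winj wu hRe hIm i.
have S0 n : (n <= K)%N -> \sum_j (c j)%:C * w j ^+ n = 0.
  move=> nK; apply: complex_ext; rewrite ?Re_sum ?Im_sum.
    by rewrite -[RHS](hRe n nK); apply: eq_bigr => j _; rewrite cReM /= mul0r subr0.
  by rewrite -[RHS](hIm n nK); apply: eq_bigr => j _; rewrite cImM /= mul0r addr0.
have S0' n : (n <= K)%N -> \sum_j (c j)%:C * cj (w j) ^+ n = 0.
  move=> nK; have := congr1 conjc (S0 n nK); rewrite rmorph0 rmorph_sum /= => h.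
  by rewrite -[RHS]h; apply: eq_bigr => j _; rewrite rmorphM rmorphXn /= oppr0.
pose p : {poly C} := \prod_(j | j != i) ('X - (w j)%:P).
have sp : size p = (2 * K).+1.
  rewrite /p -big_filter size_prod_XsubC; have [e _ _ [_ ->]] := big_enumP.
  by rewrite cardC1 card_ord.
have : \sum_j (c j)%:C * cj (w j) ^+ K * p.[w j] = 0.
  under eq_bigr => j _ do rewrite horner_coef mulr_sumr.
  rewrite exchange_big big1 //= => -[n /=]; rewrite sp => nK _.
  have [h|h] := leqP K n.
    rewrite (eq_bigr (fun j => p`_n * ((c j)%:C * w j ^+ (n - K)))) => [|j _].
      by rewrite -mulr_sumr S0 ?mulr0 //; lia.
    have e : w j ^+ n = w j ^+ (n - K) * w j ^+ K by rewrite -exprD subnK.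
    by rewrite e; transitivity (p`_n * ((c j)%:C * w j ^+ (n - K)) * (w j * cj (w j)) ^+ K); [rewrite exprMn; ring|rewrite wu expr1n mulr1].
  rewrite (eq_bigr (fun j => p`_n * ((c j)%:C * cj (w j) ^+ (K - n)))) => [|j _].
    by rewrite -mulr_sumr S0' ?mulr0 //; lia.
  have e : cj (w j) ^+ K = cj (w j) ^+ (K - n) * cj (w j) ^+ n by rewrite -exprD subnK // ltnW.
  by rewrite e; transitivity (p`_n * ((c j)%:C * cj (w j) ^+ (K - n)) * (w j * cj (w j)) ^+ n); [rewrite exprMn; ring|rewrite wu expr1n mulr1].
rewrite (bigD1 i) //= big1 ?addr0 => [/eqP|j ji]; last first.
  by rewrite /p horner_prod (bigD1 j) //= hornerXsubC subrr mul0r mulr0.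
rewrite !mulf_eq0 expf_eq0 conjc_eq0 (negbTE (on_circle_neq0 (wu i))) andbF orbF.
have -> : (p.[w i] == 0) = false.
  apply/negbTE; rewrite /p horner_prod prodf_seq_neq0; apply/allP => j _; apply/implyP => ji.
  by rewrite hornerXsubC subr_eq0 (inj_eq winj) eq_sym.
by rewrite orbF => /eqP[].
Qed.

Definition trig K (j : nat) w := if (j <= K)%N then complex.Re (w ^+ j) else complex.Im (w ^+ (j - K)).

(** A trigonometric polynomial of degree K with 2 K + 1 zeros vanishes: [trig_free], transposed. *)
Lemma trig_separated K (w : 'I_(2 * K).+1 -> C) (lam : nat -> R) :
  injective w -> (forall i, on_circle (w i)) ->
  (forall i, \sum_(j < (2 * K).+1) lam j * trig K j (w i) = 0) ->
  forall j, (j < (2 * K).+1)%N -> lam j = 0.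
Proof.
move=> winj wu h.
pose M : 'M[R]_((2 * K).+1) := \matrix_(i, j) trig K j (w i).
have Mu : M \in unitmx.
  rewrite -row_free_unit -kermx_eq0; apply/eqP/row_matrixP => r; rewrite row0.
  have : row r (kermx M) *m M = 0 by rewrite -row_mul mulmx_ker row0.
  move: (row r _) => c cM; apply/rowP => i; rewrite mxE.
  have hj j : (j < (2 * K).+1)%N -> \sum_i c 0 i * trig K j (w i) = 0.
    move=> jK; have := congr1 (fun A : 'rV_ _ => A 0 (Ordinal jK)) cM; rewrite !mxE => hh.
    by rewrite -[RHS]hh; apply: eq_bigr => k _; rewrite mxE.
  apply: (trig_free winj wu) => n nK.
    by have := hj n; rewrite /trig nK; apply; lia.
  case: n nK => [|n] nK; first by rewrite big1 // => k _; rewrite expr0 /= mulr0.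
  have := hj (K + n.+1)%N; rewrite /trig addKn.
  have -> : (K + n.+1 <= K)%N = false by lia.
  by apply; lia.
have : M *m \col_j lam j = 0.
  by apply/colP => i; rewrite !mxE -[RHS](h i); apply: eq_bigr => j _; rewrite !mxE mulrC.
move/(congr1 (mulmx (invmx M))); rewrite mulmx0 mulKmx // => hl j jK.
by have := congr1 (fun A : 'cV_ _ => A (Ordinal jK) 0) hl; rewrite !mxE.
Qed.

End Curve.

Section CurveIdentity.
Variable R : rcfType.
Local Open Scope complex_scope.
Local Notation C := (R[i]).
Local Notation cj := (@conjc R).
Implicit Types (w y Y v : C) (q : nat -> rat).

Lemma bform_sum m q (h : nat -> R) : h 0%N = 0 ->
  \sum_(1 <= n < m.*2.+2) ratr (bform m.*2.+1 m.+1 q n) * h n =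
  \sum_(u < m.+1) \sum_(v < m.+1) ratr (q u) * ratr (q v) *
    (h (m.*2.+1 - (u + v))%N - h (v - u)%N - h (u - v)%N).
Proof.
move=> h0; pose N := m.*2.+1.
have D (a k : nat) : (k - a <= N)%N ->
    \sum_(1 <= n < N.+1) (a + n == k)%N%:R * h n = h (k - a)%N.
  move=> kN; rewrite -[RHS](_ : \sum_(0 <= n < N.+1) (a + n == k)%N%:R * h n + (k < a)%N%:R * 0 = _).
    by rewrite mulr0 addr0 [RHS]big_ltn // h0 mulr0 add0r.
  rewrite mulr0 addr0 big_mkord; have [ak|ka] := leqP a k.
    have lt : (k - a < N.+1)%N by lia.
    rewrite (bigD1 (Ordinal lt)) //= subnKC // eqxx mul1r big1 ?addr0 // => i.
    rewrite -val_eqE /= => ik; have -> : (a + i == k)%N = false by lia.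
    by rewrite mul0r.
  have -> : (k - a = 0)%N by lia.
  rewrite h0 big1 // => i _; have -> : (a + i == k)%N = false by lia.
  by rewrite mul0r.
transitivity (\sum_(1 <= n < N.+1) \sum_(u < m.+1) \sum_(v < m.+1) ratr (q u) * ratr (q v) *
   (((u + v + n == N)%N%:R - (u + n == v)%N%:R - (v + n == u)%N%:R) * h n)).
  apply: eq_bigr => n _; rewrite /bform rmorph_sum mulr_suml; apply: eq_bigr => u _.
  rewrite rmorph_sum mulr_suml; apply: eq_bigr => v _.
  by rewrite !(rmorphM, rmorphB) /= !ratr_nat -[LHS]mulrA.
rewrite exchange_big; apply: eq_bigr => u _; rewrite exchange_big; apply: eq_bigr => v _ /=.
have um := ltn_ord u; have vm := ltn_ord v.
rewrite -mulr_sumr; congr (_ * _).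
under eq_bigr do rewrite !mulrBl.
by rewrite !sumrB !D //; rewrite /N; lia.
Qed.

Lemma conj_frac Y : Y != 0 -> on_circle (Y / cj Y).
Proof.
move=> Y0; rewrite /on_circle rmorphM fmorphV /= conjcK mulf_div [cj Y * _]mulrC divff //.
by rewrite mulf_neq0 // conjc_eq0.
Qed.

Lemma conjcX (Y : C) n : cj (Y ^+ n) = cj Y ^+ n. Proof. exact: rmorphXn. Qed.

Lemma cReJ (Y : C) : complex.Re (cj Y) = complex.Re Y. Proof. by case: Y. Qed.
Lemma cImJ (Y : C) : complex.Im (cj Y) = - complex.Im Y. Proof. by case: Y. Qed.

Lemma sqr_mul_div (F : fieldType) (a b p : F) : a != 0 -> b != 0 -> a ^+ 2 * p / (a * b) = a / b * p.
Proof. by move=> a0 b0; rewrite expr2 invfM mulrACA mulrA mulrAC -!mulrA mulVKf. Qed.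

(** The formula 2 sin ((2 i + 1) t) sin ((2 j + 1) t) = cos (2 (i - j) t) - cos (2 (i + j + 1)
    t) for t = arg Y; one of the two truncated differences is 0 and contributes the cosine 1. *)
Lemma Im_mul_Im Y (i j : nat) : Y != 0 -> let v := Y / cj Y in
  2 * complex.Im (Y * v ^+ i) * complex.Im (Y * v ^+ j) = normsq Y *
   (complex.Re (v ^+ (i - j)) + complex.Re (v ^+ (j - i)) - 1 - complex.Re (v ^+ (i + j).+1)).
Proof.
move=> Y0 v; have cv : on_circle v by exact: conj_frac.
wlog ij : i j / (j <= i)%N => [hw|].
  have [ji|/ltnW ij] := leqP j i; first exact: hw.
  have := hw j i ij; rewrite (addnC j i) => hh.
  by rewrite mulrAC hh; congr (_ * (_ - _ - _)); rewrite addrC.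
rewrite (eqP (_ : j - i == 0)%N) //; rewrite expr0 /=.
set a := v ^+ (i - j); set b := Y * v ^+ j.
have -> : Y * v ^+ i = a * b by rewrite /a /b mulrCA -exprD subnK.
have nb : normsq b = normsq Y.
  by rewrite normsqM (on_circleP (on_circleX j cv)) mulr1.
have -> : v ^+ (i + j).+1 = a * (b ^+ 2 / (normsq Y)%:C).
  rewrite /a /b -normsqE [(Y * v ^+ j) ^+ 2]exprMn -[(v ^+ j) ^+ 2]exprM.
  have -> : Y ^+ 2 * v ^+ (j * 2) / (Y * cj Y) = v ^+ (j * 2).+1.
    by rewrite [RHS]exprS; move: (v ^+ (j * 2)) => p; apply: sqr_mul_div; rewrite // conjc_eq0.
  by rewrite -exprD; congr (_ ^+ _); lia.
have n0 := normsq_gt0 Y0.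
have -> : complex.Re (a * (b ^+ 2 / (normsq Y)%:C)) = complex.Re (a * b ^+ 2) / normsq Y.
  by rewrite mulrA -[(normsq Y)%:C^-1]fmorphV [LHS]cReM /= mulr0 subr0.
clearbody a b; rewrite -nb; move: nb n0; rewrite /normsq => <- n0 {v cv}.
by rewrite expr2 !(cReM, cImM); field; rewrite gt_eqF.
Qed.

(** The expansion of 2 f(arg Y)^2, where f is the sine polynomial attached to q: the imaginary
    part of Y v^i is |Y| sin ((2 i + 1) arg Y). *)
Lemma curve_identity m q Y : Y != 0 ->
  \sum_(1 <= n < m.*2.+2) ratr (bform m.*2.+1 m.+1 q n) * (1 - complex.Re ((Y / cj Y) ^+ n)) =
  2 * (\sum_(u < m.+1) ratr (q u) * complex.Im (Y * (Y / cj Y) ^+ (m - u))) ^+ 2 / normsq Y.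
Proof.
move=> Y0; rewrite bform_sum; last by rewrite expr0 /= subrr.
have n0 : normsq Y != 0 by rewrite gt_eqF // normsq_gt0.
apply: (mulIf n0); rewrite mulfVK // expr2 mulr_suml mulr_suml mulr_sumr.
apply: eq_bigr => u _; rewrite mulr_sumr mulr_suml mulr_sumr; apply: eq_bigr => v _.
have um := ltn_ord u; have vm := ltn_ord v.
transitivity (ratr (q u) * ratr (q v) * (2 * complex.Im (Y * (Y / cj Y) ^+ (m - u)) *
  complex.Im (Y * (Y / cj Y) ^+ (m - v))) : R); last by ring.
rewrite Im_mul_Im //.
have -> : (m - u - (m - v) = v - u)%N by lia.
have -> : (m - v - (m - u) = u - v)%N by lia.
have -> : ((m - u + (m - v)).+1 = m.*2.+1 - (u + v))%N by lia.
by ring.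
Qed.

Definition coefs (k e m : nat) q := mkseq (fun i => bform m.*2.+1 m.+1 q (e + i.+1)) k.

Lemma coefs_sum k e m q (h : nat -> R) : (e + k = m.*2.+1)%N ->
  e = 0%N \/ (e = 1%N /\ bform m.*2.+1 m.+1 q 1 = 0) ->
  \sum_(0 <= i < k) ratr (coefs k e m q)`_i * h (e + i.+1)%N =
  \sum_(1 <= n < m.*2.+2) ratr (bform m.*2.+1 m.+1 q n) * h n.
Proof.
move=> ek [e0|[e1 b1]].
  rewrite e0 in ek *; rewrite (_ : m.*2.+2 = k.+1) ?big_add1 /=; last by lia.
  by apply: eq_big_nat => i /andP[_ ik]; rewrite nth_mkseq.
rewrite e1 in ek *; rewrite (_ : m.*2.+2 = k.+2) ?big_add1 /=; last by lia.
rewrite big_nat_recl //= b1 rmorph0 mul0r add0r.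
by apply: eq_big_nat => i /andP[_ ik]; rewrite nth_mkseq.
Qed.

(** The quotient f(alpha) / sin alpha as a function of w = exp (2 i alpha), a sum of Dirichlet
    kernels. *)
Definition dirichlet m q w : R :=
  \sum_(u < m.+1) ratr (q u) * (1 + 2 * \sum_(j < m - u) complex.Re (w ^+ j.+1)).

Lemma Im_dirichlet y n : y != 0 ->
  complex.Im (y * (y / cj y) ^+ n) = complex.Im y * (1 + 2 * \sum_(j < n) complex.Re ((y / cj y) ^+ j.+1)).
Proof.
move=> y0; elim: n => [|n IH]; first by rewrite expr0 mulr1 big_ord0 mulr0 addr0 mulr1.
rewrite big_ord_recr /= [2 * _]mulrDr addrA [_ * (_ + 2 * _)]mulrDr -IH.
have yE : y = y / cj y * cj y by rewrite divfK // conjc_eq0.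
have e : y * (y / cj y) ^+ n = (y / cj y) ^+ n.+1 * cj y.
  by rewrite {1}yE exprS mulrAC.
rewrite e; move: ((y / cj y) ^+ n.+1) => v; rewrite !cImM cReJ cImJ; ring.
Qed.

Definition cos_poly K (F : C -> R) := exists a : nat -> rat,
  forall w, on_circle w -> F w = \sum_(j < K.+1) ratr (a j) * complex.Re (w ^+ j).

Lemma cos_poly_eq K F G : (forall w, F w = G w) -> cos_poly K F -> cos_poly K G.
Proof. by move=> FG [a h]; exists a => w cw; rewrite -FG h. Qed.

Lemma cos_polyD K F G : cos_poly K F -> cos_poly K G -> cos_poly K (fun w => F w + G w).
Proof.
move=> [a h] [b h']; exists (fun j => a j + b j) => w cw.
by rewrite h // h' // -big_split; apply: eq_bigr => j _; rewrite rmorphD mulrDl.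
Qed.

Lemma cos_polyZ K c F : cos_poly K F -> cos_poly K (fun w => ratr c * F w).
Proof.
move=> [a h]; exists (fun j => c * a j) => w cw.
by rewrite h // mulr_sumr; apply: eq_bigr => j _; rewrite rmorphM mulrA.
Qed.

Lemma cos_poly_Re K n : (n <= K)%N -> cos_poly K (fun w => complex.Re (w ^+ n)).
Proof.
move=> nK; exists (fun j => (j == n)%:R) => w _; have lt : (n < K.+1)%N by [].
rewrite (bigD1 (Ordinal lt)) //= eqxx rmorph1 mul1r big1 ?addr0 // => j.
by rewrite -val_eqE /= => /negbTE ->; rewrite rmorph0 mul0r.
Qed.

Lemma cos_poly_sum K n (F : 'I_n -> C -> R) : (forall i, cos_poly K (F i)) ->
  cos_poly K (fun w => \sum_i F i w).
Proof.
elim: n F => [|n IH] F h.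
  by exists (fun=> 0) => w _; rewrite big_ord0 big1 // => j _; rewrite rmorph0 mul0r.
apply: cos_poly_eq (cos_polyD (IH (fun i => F (widen_ord (leqnSn n) i)) (fun i => h _)) (h ord_max)).
by move=> w; rewrite big_ord_recr.
Qed.

Lemma cos_polyM K L F G : cos_poly K F -> cos_poly L G -> cos_poly (K + L) (fun w => F w * G w).
Proof.
move=> [a h] [b h'].
have [c hc] : cos_poly (K + L) (fun w => \sum_(i < K.+1) \sum_(j < L.+1)
    ratr (a i * b j / 2) * (complex.Re (w ^+ (i + j)) + complex.Re (w ^+ ((i - j) + (j - i))))).
  apply: cos_poly_sum => i; apply: cos_poly_sum => j; apply: cos_polyZ.
  have iK := ltn_ord i; have jL := ltn_ord j.
  by apply: cos_polyD; apply: cos_poly_Re; lia.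
exists c => w cw; rewrite -hc // h // h' // mulr_suml; apply: eq_bigr => i _.
rewrite mulr_sumr; apply: eq_bigr => j _.
suff e : 2 * (complex.Re (w ^+ i) * complex.Re (w ^+ j)) =
    complex.Re (w ^+ (i + j)) + complex.Re (w ^+ ((i - j) + (j - i))).
  by rewrite -e !(rmorphM, fmorphV) /= ratr_nat; field.
move: {h h' hc} (nat_of_ord i) (nat_of_ord j) => {}i {}j; wlog ij : i j / (j <= i)%N => [hw|].
  have [/hw //|/ltnW /hw] := leqP j i.
  by rewrite (addnC i j) (addnC (i - j)%N) => <-; rewrite [_ * complex.Re (w ^+ i)]mulrC.
have -> : ((i - j) + (j - i) = i - j)%N by lia.
have -> : (i + j = (i - j) + j + j)%N by lia.
rewrite -{1}(subnK ij) !exprD.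
have := on_circleP (on_circleX j cw); move: (w ^+ (i - j)) (w ^+ j) => x y.
rewrite /normsq !(cReM, cImM) => e.
by rewrite -[X in _ = _ + X]mulr1 -[X in _ = _ + _ * X]e; ring.
Qed.

Lemma cos_poly_dirichlet m q : cos_poly m (dirichlet m q).
Proof.
apply: cos_poly_sum => u; apply: cos_polyZ; apply: cos_polyD.
  by apply: cos_poly_eq (cos_poly_Re (leq0n m)) => w; rewrite expr0.
have -> : (2 : R) = ratr 2 by rewrite ratr_nat.
apply: cos_polyZ; apply: cos_poly_sum => j; apply: cos_poly_Re.
by have := ltn_ord j; lia.
Qed.

Variables (D : rat) (delta : R).
Hypotheses (delta0 : delta != 0) (deltaD : delta ^+ 2 = ratr D).

(** The real parts of the powers w^(e + 1), ..., w^(e + k), followed by their imaginary parts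
    divided by delta = sqrt D. *)
Definition curve (k e : nat) w (i : nat) : R :=
  if (i < k)%N then complex.Re (w ^+ (e + i.+1)) else complex.Im (w ^+ (e + (i - k).+1)) / delta.

Lemma dform_curve e B w w' : on_circle w -> on_circle w' ->
  dform (hdouble D B) (fun i => curve (size B) e w i - curve (size B) e w' i) =
  2 * \sum_(0 <= i < size B) ratr B`_i * (1 - complex.Re ((w * cj w') ^+ (e + i.+1))).
Proof.
move=> cw cw'; rewrite dform_hdouble /dform !mulr_sumr -big_split /=.
apply: eq_big_nat => i /andP[_ ik]; rewrite /curve ik ltnNge leq_addr /= addKn -mulrBl.
have := on_circleP (on_circleX (e + i.+1) cw); have := on_circleP (on_circleX (e + i.+1) cw').
rewrite [(w * cj w') ^+ _]exprMn -conjcX; move: (w ^+ _) (w' ^+ _) => a b.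
rewrite /normsq cReM cReJ cImJ -deltaD => hb ha.
have -> : delta ^+ 2 * (ratr B`_i * ((complex.Im a - complex.Im b) / delta) ^+ 2) =
  ratr B`_i * (complex.Im a - complex.Im b) ^+ 2 by field.
move: hb ha; move: (complex.Re a) (complex.Im a) (complex.Re b) (complex.Im b) => a1 a2 b1 b2 hb ha.
transitivity (ratr B`_i * ((a1 ^+ 2 + a2 ^+ 2) + (b1 ^+ 2 + b2 ^+ 2) - 2 * (a1 * b1 + a2 * b2))).
  by ring.
by rewrite ha hb; ring.
Qed.

(** The field Q(sqrt(-D)). *)
Definition inK (x : C) := exists c s : rat, complex.Re x = ratr c /\ complex.Im x = delta * ratr s.

Lemma inKM x y : inK x -> inK y -> inK (x * y).
Proof.
move=> [c [s [rx ix]]] [c' [s' [ry iy]]]; exists (c * c' - D * s * s'), (c * s' + s * c').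
rewrite cReM cImM rx ix ry iy !(rmorphB, rmorphD, rmorphM) /= -deltaD; split; ring.
Qed.

Lemma inKJ x : inK x -> inK (cj x).
Proof.
move=> [c [s [rx ix]]]; exists c, (- s); rewrite cReJ cImJ rx ix rmorphN; split=> //; ring.
Qed.

Lemma inK1 : inK 1.
Proof. by exists 1, 0; rewrite rmorph1 rmorph0 mulr0. Qed.

Lemma inKX x n : inK x -> inK (x ^+ n).
Proof. by move=> Kx; elim: n => [|n IH]; rewrite ?expr0 ?exprS; [apply: inK1|apply: inKM]. Qed.

Lemma inK_normsq x : inK x -> exists c : rat, normsq x = ratr c.
Proof.
move=> [c [s [rx ix]]]; exists (c ^+ 2 + D * s ^+ 2).
by rewrite /normsq rx ix rmorphD rmorphM !rmorphXn /= -deltaD; ring.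
Qed.

Lemma inKV x : x != 0 -> inK x -> inK (x^-1).
Proof.
move=> x0 Kx; have -> : x^-1 = cj x * (normsq x)^-1%:C.
  apply: (mulfI x0); rewrite divff // mulrA normsqE -rmorphM divff ?rmorph1 //.
  by rewrite gt_eqF // normsq_gt0.
apply: inKM; first exact: inKJ.
have [c hc] := inK_normsq Kx; exists c^-1, 0.
by rewrite hc /= fmorphV rmorph0 mulr0.
Qed.

Lemma inK_frac x : x != 0 -> inK x -> inK (x / cj x).
Proof.
move=> x0 Kx; apply: inKM => //; apply: inKV; last exact: inKJ.
by rewrite conjc_eq0.
Qed.

Lemma curve_rational k e w i : inK w -> exists c : rat, curve k e w i = ratr c.
Proof.
move=> Kw; rewrite /curve; case: ifP => _.
  by have [c [s [-> _]]] := inKX (e + i.+1) Kw; exists c.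
by have [c [s [_ ->]]] := inKX (e + (i - k).+1) Kw; exists s; rewrite mulrC mulKf.
Qed.

(** The squared distance is 4 f(arg Y)^2 for Y = y conj(y'), by [curve_identity]; and f(arg Y)
    times |Y| is the imaginary part of an element of Q(sqrt(-D)). *)
Lemma curve_dist k e m q y y' : (e + k = m.*2.+1)%N ->
  e = 0%N \/ (e = 1%N /\ bform m.*2.+1 m.+1 q 1 = 0) ->
  y != 0 -> y' != 0 -> inK y -> inK y' ->
  exists rho : rat, dform (hdouble D (coefs k e m q))
     (fun i => curve k e (y / cj y) i - curve k e (y' / cj y') i) =
   4 * ratr D * ratr rho ^+ 2 / (normsq y * normsq y').
Proof.
move=> ek hb y0 y0' Ky Ky'.
have sB : size (coefs k e m q) = k by rewrite size_mkseq.
have Y0 : y * cj y' != 0 by rewrite mulf_neq0 // conjc_eq0.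
have KY : inK (y * cj y') by apply: inKM => //; apply: inKJ.
have [r hr] : exists r : rat, \sum_(u < m.+1) ratr (q u) *
    complex.Im ((y * cj y') * ((y * cj y') / cj (y * cj y')) ^+ (m - u)) = delta * ratr r.
  have h n : exists s : rat, complex.Im ((y * cj y') * ((y * cj y') / cj (y * cj y')) ^+ n) = delta * ratr s.
    by have [c [s [_ hs]]] := inKM KY (inKX n (inK_frac Y0 KY)); exists s.
  elim: m.+1 => [|n [r IH]]; first by exists 0; rewrite big_ord0 rmorph0 mulr0.
  have [s hs] := h (m - n)%N; exists (r + q n * s).
  by rewrite big_ord_recr /= IH hs rmorphD rmorphM; ring.
exists r.
have vE : y / cj y * cj (y' / cj y') = y * cj y' / cj (y * cj y').
  by rewrite !rmorphM fmorphV /= !conjcK mulf_div [X in _ = _ / X]mulrC [cj y * _]mulrC.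
transitivity (dform (hdouble D (coefs k e m q))
  (fun i => curve (size (coefs k e m q)) e (y / cj y) i - curve (size (coefs k e m q)) e (y' / cj y') i)).
  by rewrite sB.
rewrite dform_curve; [|exact: conj_frac|exact: conj_frac].
rewrite sB (coefs_sum (fun n => 1 - complex.Re ((y / cj y * cj (y' / cj y')) ^+ n)) ek hb).
rewrite vE curve_identity // hr normsqM normsqJ exprMn deltaD.
by field; rewrite !gt_eqF ?normsq_gt0.
Qed.

(** The case y' = 1 of [curve_dist], with rho identified. *)
Lemma curve_dist1 k m q y : k = m.*2.+1 -> y != 0 -> inK y -> complex.Im y = delta ->
  dform (hdouble D (coefs k 0 m q)) (fun i => curve k 0 (y / cj y) i - curve k 0 1 i) =
   4 * ratr D * dirichlet m q (y / cj y) ^+ 2 / normsq y.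
Proof.
move=> kE y0 Ky Imy.
have sB : size (coefs k 0 m q) = k by rewrite size_mkseq.
transitivity (dform (hdouble D (coefs k 0 m q))
  (fun i => curve (size (coefs k 0 m q)) 0 (y / cj y) i - curve (size (coefs k 0 m q)) 0 1 i)).
  by rewrite sB.
rewrite dform_curve; [|exact: conj_frac|by rewrite /on_circle rmorph1 mulr1].
rewrite sB rmorph1 mulr1 (@coefs_sum k 0 m q (fun n => 1 - complex.Re ((y / cj y) ^+ n))) //; last by left.
rewrite curve_identity //.
have -> : \sum_(u < m.+1) ratr (q u) * complex.Im (y * (y / cj y) ^+ (m - u)) = delta * dirichlet m q (y / cj y).
  by rewrite mulr_sumr; apply: eq_bigr => u _; rewrite Im_dirichlet // Imy; ring.
by rewrite exprMn deltaD; field; rewrite gt_eqF ?normsq_gt0.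
Qed.

End CurveIdentity.

(** * Stereographic projection *)

Section Families.
Variable R : rcfType.

Definition rational_value (x : R) := exists a : rat, x = ratr a.

Lemma rational_valueD x y : rational_value x -> rational_value y -> rational_value (x + y).
Proof. by move=> [a ->] [b ->]; exists (a + b); rewrite rmorphD. Qed.
Lemma rational_valueN x : rational_value x -> rational_value (- x).
Proof. by move=> [a ->]; exists (- a); rewrite rmorphN. Qed.
Lemma rational_valueM x y : rational_value x -> rational_value y -> rational_value (x * y).
Proof. by move=> [a ->] [b ->]; exists (a * b); rewrite rmorphM. Qed.
Lemma rational_valueV x : rational_value x -> rational_value x^-1.
Proof. by move=> [a ->]; exists a^-1; rewrite fmorphV. Qed.
Lemma rational_value_sum (I : Type) (r : seq I) (P : pred I) (f : I -> R) :
  (forall i, rational_value (f i)) -> rational_value (\sum_(i <- r | P i) f i).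
Proof.
move=> h; elim/big_ind: _ => //; first by exists 0; rewrite rmorph0.
exact: rational_valueD.
Qed.
Lemma rational_value_linear n f x : rat_linear n f -> (forall i, rational_value (x i)) ->
  rational_value (f x).
Proof.
move=> [c h] hx; rewrite h; apply: rational_value_sum => i.
by apply: rational_valueM => //; exists (c i).
Qed.

Definition rational_family (I : Type) d (P : I -> nat -> R) :=
  (forall u j, rational_value (P u j)) /\
  (forall u v, exists a : rat, \sum_(0 <= j < d) (P u j - P v j) ^+ 2 = ratr a ^+ 2).

Definition affinely_free (I : Type) d (P : I -> nat -> R) :=
  forall (u : 'I_d.+1 -> I) (c : 'I_d.+1 -> R), injective u ->
    \sum_i c i = 0 -> (forall j, (j < d)%N -> \sum_i c i * P (u i) j = 0) -> forall i, c i = 0.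

(** No d + 2 points lie on a common sphere or hyperplane: the squared norm is a further
    coordinate, as in the lift to a paraboloid. *)
Definition spherically_free (I : Type) d (P : I -> nat -> R) :=
  forall (u : 'I_d.+2 -> I) (c : 'I_d.+2 -> R), injective u ->
    \sum_i c i = 0 -> (forall j, (j < d)%N -> \sum_i c i * P (u i) j = 0) ->
    \sum_i c i * \sum_(0 <= j < d) P (u i) j ^+ 2 = 0 -> forall i, c i = 0.
End Families.

Section Stereographic.
Variable R : rcfType.
Variables (I : Type) (U : I -> nat -> R) (U1 : nat -> R).
Variables (s : seq rat) (D : rat) (S : R) (e : nat) (F : nat -> (nat -> R) -> R).
Hypotheses (sp : {in s, forall a, 0 < a}) (D0 : 0 < D) (S0 : 0 < S).
Hypothesis Fo : orth_frame s (1 :: nseq e D) F.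
Hypotheses (F1_0 : F 0%N U1 = S) (F1_j : forall j, (j < e)%N -> F j.+1 U1 = 0).
Hypothesis HU : forall u, dform s (fun i => U u i - U1 i) = 2 * S * (S - F 0%N (U u)).
Hypothesis den0 : forall u, S - F 0%N (U u) != 0.

Lemma frame_form x : dform s x = F 0%N x ^+ 2 + ratr D * \sum_(0 <= j < e) F j.+1 x ^+ 2.
Proof. by have [_ ->] := Fo; rewrite dform_cons rmorph1 mul1r dform_nseq. Qed.

Lemma frameB j x y : F j (fun i => x i - y i) = F j x - F j y.
Proof.
have [Fl _] := Fo.
transitivity (F j (fun i => 1 * x i + (- 1) * y i)).
  by apply: (rat_linear_ext (Fl j)) => i _; rewrite mul1r mulN1r.
by rewrite (rat_linear_lin _ _ _ _ (Fl j)) mul1r mulN1r.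
Qed.

Lemma frame_normsq u : ratr D * \sum_(0 <= j < e) F j.+1 (U u) ^+ 2 = S ^+ 2 - F 0%N (U u) ^+ 2.
Proof.
have := HU u; rewrite frame_form frameB F1_0.
rewrite (eq_big_nat _ _ (F2 := fun j => F j.+1 (U u) ^+ 2)) => [|j /andP[_ je]]; first lra.
by rewrite frameB F1_j // subr0.
Qed.

(** Stereographic projection of a sphere of radius S whose axis is the coordinate F 0, from the
    point at height S. *)
Definition stereo u j : R := F j.+1 (U u) / (S - F 0%N (U u)).

Lemma stereo_normsq u :
  ratr D * \sum_(0 <= j < e) stereo u j ^+ 2 = (S + F 0%N (U u)) / (S - F 0%N (U u)).
Proof.
have d0 := den0 u.
under eq_bigr do rewrite /stereo expr_div_n.
by rewrite -mulr_suml mulrA frame_normsq; field.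
Qed.

(** On the sphere the inner products of the last coordinates are determined by the distance and
    by the two heights. *)
Lemma stereo_dist u v : ratr D * \sum_(0 <= j < e) (stereo u j - stereo v j) ^+ 2 =
  dform s (fun i => U u i - U v i) / ((S - F 0%N (U u)) * (S - F 0%N (U v))).
Proof.
have du := den0 u; have dv := den0 v.
have hu := frame_normsq u; have hv := frame_normsq v.
pose p := \sum_(0 <= j < e) F j.+1 (U u) * F j.+1 (U v).
have -> : \sum_(0 <= j < e) (stereo u j - stereo v j) ^+ 2 =
  (\sum_(0 <= j < e) F j.+1 (U u) ^+ 2) / (S - F 0%N (U u)) ^+ 2 +
  (\sum_(0 <= j < e) F j.+1 (U v) ^+ 2) / (S - F 0%N (U v)) ^+ 2 -
  2 * p / ((S - F 0%N (U u)) * (S - F 0%N (U v))).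
  rewrite /p mulr_sumr !mulr_suml -big_split -sumrB; apply: eq_bigr => j _ /=.
  by rewrite /stereo; field; rewrite ?du ?dv.
rewrite frame_form frameB.
have -> : \sum_(0 <= j < e) F j.+1 (fun i => U u i - U v i) ^+ 2 =
  \sum_(0 <= j < e) F j.+1 (U u) ^+ 2 + \sum_(0 <= j < e) F j.+1 (U v) ^+ 2 - 2 * p.
  rewrite /p mulr_sumr -big_split -sumrB; apply: eq_bigr => j _ /=.
  by rewrite frameB; ring.
move: hu hv du dv; set a := \sum_(0 <= j < e) _; set b := \sum_(0 <= j < e) _.
move: (F 0%N (U u)) (F 0%N (U v)) (ratr D) a b p => x y d a b p ha hb dx dy.
have -> : d * (a / (S - x) ^+ 2 + b / (S - y) ^+ 2 - 2 * p / ((S - x) * (S - y))) =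
  (d * a) / (S - x) ^+ 2 + (d * b) / (S - y) ^+ 2 - 2 * (d * p) / ((S - x) * (S - y)) by ring.
have -> : (x - y) ^+ 2 + d * (a + b - 2 * p) = (x - y) ^+ 2 + d * a + d * b - 2 * (d * p) by ring.
by rewrite ha hb; field; rewrite ?dx ?dy.
Qed.

(** A functional that vanishes at the centre U1 becomes affine after division by S - F 0. *)
Lemma stereo_dual (kappa : nat -> rat) : exists k' : nat -> rat, forall u,
  \sum_(0 <= i < size s) ratr (kappa i) * (U u i - U1 i) =
  (S - F 0%N (U u)) * (ratr (k' 0%N) + \sum_(0 <= j < e) ratr (k' j.+1) * stereo u j).
Proof.
have [k' hk] := frame_dual kappa sp Fo.
exists (fun j => if j is j'.+1 then k' j else - k' 0%N) => u.
rewrite hk /= size_nseq big_nat_recl //= frameB F1_0 rmorphN [RHS]mulrDr mulr_sumr.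
congr (_ + _); first by ring.
apply: eq_big_nat => j /andP[_ je]; rewrite frameB F1_j // subr0 /stereo.
by have := den0 u; move: (S - F 0%N (U u)) (F j.+1 (U u)) => d x d0; field.
Qed.

(** Dividing the coefficients of a dependency by S - F 0 lifts it to the sphere, since the
    squared norm of the projection is an affine function of 1 / (S - F 0). *)
Lemma stereo_spherically_free :
  (forall (u : 'I_e.+2 -> I) (c : 'I_e.+2 -> R), injective u -> \sum_i c i = 0 ->
     (forall j, (j < e.+1)%N -> \sum_i c i * F j (U (u i)) = 0) -> forall i, c i = 0) ->
  spherically_free e stereo.
Proof.
move=> hfree u c uinj c0 cY cQ i.
pose c' i := c i / (S - F 0%N (U (u i))).
suff : c' i = 0.
  by rewrite /c' => /eqP; rewrite mulf_eq0 invr_eq0 (negbTE (den0 _)) orbF => /eqP.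
have cE j : c j = c' j * (S - F 0%N (U (u j))) by rewrite /c' divfK ?den0.
have h1 : S * \sum_i c' i - \sum_i c' i * F 0%N (U (u i)) = 0.
  rewrite -[RHS]c0 mulr_sumr -sumrB; apply: eq_bigr => j _; rewrite cE; ring.
have h2 : S * \sum_i c' i + \sum_i c' i * F 0%N (U (u i)) = 0.
  rewrite mulr_sumr -big_split; transitivity (ratr D * \sum_i c i * \sum_(0 <= j < e) stereo (u i) j ^+ 2).
    rewrite mulr_sumr; apply: eq_bigr => j _ /=.
    by rewrite [RHS]mulrCA stereo_normsq /c'; ring.
  by rewrite cQ mulr0.
have h3 : \sum_i c' i = 0.
  have : 2 * S * \sum_i c' i = 0 by lra.
  by move/eqP; rewrite !mulf_eq0 pnatr_eq0 (gt_eqF S0) /= => /eqP.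
apply: (hfree u) => // -[|j] je; first by move: h2; rewrite h3 mulr0 add0r.
rewrite -[RHS](cY j je); apply: eq_bigr => a _; rewrite /c' /stereo; ring.
Qed.

(** A dependency between d + 1 projected points lifts to one on the sphere in which the centre
    U1 takes part. *)
Lemma stereo_affinely_free :
  (forall (u : 'I_e.+1 -> I) (c0 : R) (c : 'I_e.+1 -> R), injective u -> c0 + \sum_i c i = 0 ->
     (forall j, (j < e.+1)%N -> c0 * F j U1 + \sum_i c i * F j (U (u i)) = 0) -> forall i, c i = 0) ->
  affinely_free e stereo.
Proof.
move=> hfree u c uinj c0 cY i.
pose c' i := c i / (S - F 0%N (U (u i))).
suff : c' i = 0.
  by rewrite /c' => /eqP; rewrite mulf_eq0 invr_eq0 (negbTE (den0 _)) orbF => /eqP.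
have cE j : c j = c' j * (S - F 0%N (U (u j))) by rewrite /c' divfK ?den0.
have h1 : S * \sum_i c' i - \sum_i c' i * F 0%N (U (u i)) = 0.
  rewrite -[RHS]c0 mulr_sumr -sumrB; apply: eq_bigr => j _; rewrite cE; ring.
apply: (hfree u (- \sum_i c' i)) => //; first by rewrite addNr.
case=> [|j] je; first by rewrite F1_0; lra.
rewrite F1_j // mulr0 add0r -[RHS](cY j je).
apply: eq_bigr => a _; rewrite /c' /stereo; ring.
Qed.
End Stereographic.

(** * Greedy selection of points *)

Lemma unbounded_injective (P : nat -> Prop) L : (forall n, exists2 v, (n <= v)%N & P v) ->
  exists f : 'I_L -> nat, injective f /\ forall i, P (f i).
Proof.
move=> h.
have {}h n : exists v, (n <= v)%N /\ P v by have [v nv Pv] := h n; exists v.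
have [g gP] := choice h.
pose f n := iter n (fun v => g v.+1) (g 0%N).
have fS n : (f n < f n.+1)%N by have [] := gP (f n).+1.
have fmono m n : (m < n)%N -> (f m < f n)%N.
  by elim: n => // n IH; rewrite ltnS leq_eqVlt => /predU1P[->//|/IH/ltn_trans]; apply.
exists (fun i => f i); split=> [i j fij|i]; last by case: (nat_of_ord i) => [|n]; [have [] := gP 0%N|have [] := gP (f n).+1].
by apply/val_inj => /=; case: (ltngtP i j) => // /fmono; rewrite fij ltnn.
Qed.

Section Greedy.
Variables (F : fieldType) (N : nat) (phi : nat -> nat -> F).
Hypothesis phi0 : forall v, phi v 0%N = 1.
Hypothesis phi_free : forall lam : nat -> F, (exists2 j, (j < N.+1)%N & lam j != 0) ->
  exists n, forall v, (n <= v)%N -> \sum_(j < N.+1) lam j * phi v j != 0.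

Lemma annihilator (f : 'I_N -> nat) : exists lam : nat -> F,
  (exists2 j, (j < N.+1)%N & lam j != 0) /\
  forall i, \sum_(j < N.+1) lam j * phi (f i) j = 0.
Proof.
pose M : 'M[F]_(N.+1, N) := \matrix_(j, i) phi (f i) j.
have kM : kermx M != 0.
  rewrite -mxrank_eq0 mxrank_ker subn_eq0 -ltnNge ltnS.
  by apply: leq_trans (rank_leq_col M) _.
have [r r0] : exists r, row r (kermx M) != 0.
  apply/existsP; apply: contraR kM; rewrite negb_exists => /forallP h.
  by apply/eqP/row_matrixP => r; have := h r; rewrite negbK row0 => /eqP.
exists (fun j => (row r (kermx M)) 0 (inord j)); split.
  have /rV0Pn[j hj] := r0; exists (j : nat) => //.
  by rewrite inord_val.
move=> i; have : row r (kermx M) *m M = 0 by rewrite -row_mul mulmx_ker row0.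
move/(congr1 (fun A : 'rV_N => A 0 i)); rewrite !mxE => hh; rewrite -[RHS]hh.
by apply: eq_bigr => j _; rewrite inord_val [M j i]mxE.
Qed.

(** Each new point is chosen off the finitely many hyperplanes through N earlier points. A
    nontrivial dependency would be contradicted at the point of largest index that occurs in it. *)
Lemma greedy : exists n : nat -> nat, forall (idx : 'I_N.+1 -> nat) (c : 'I_N.+1 -> F),
  injective idx -> (forall j, (j < N.+1)%N -> \sum_i c i * phi (n (idx i)) j = 0) ->
  forall i, c i = 0.
Proof.
have [lam lamP] := choice annihilator.
have [bd bdP] := choice (fun f => phi_free (lamP f).1).
pose fn M (f : {ffun 'I_N -> 'I_M}) (i : 'I_N) : nat := f i.
pose beta M := maxn M (\max_(f : {ffun 'I_N -> 'I_M}) bd (fn M f)).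
have betaP M f : (forall i, f i < M)%N -> \sum_(j < N.+1) lam f j * phi (beta M) j != 0.
  move=> fM; have -> : f = fn M [ffun i => Ordinal (fM i)].
    by apply: funext => i; rewrite /fn ffunE.
  apply: bdP; rewrite leq_max; apply/orP; right.
  exact: (leq_bigmax (F := fun f : {ffun 'I_N -> 'I_M} => bd (fn M f))).
pose n i := iter i (fun v => beta v.+1) 0%N.
have nS i : (n i < n i.+1)%N by rewrite /= leq_max leqnn.
have nmono i j : (i <= j)%N -> (n i <= n j)%N.
  move=> /subnK <-; elim: (j - i)%N => // k IH.
  by apply: leq_trans IH (ltnW (nS _)).
exists n => idx c idxI hc i.
apply/eqP; apply: contrapT => /negP ci.
have [a ca amax] := @arg_maxnP _ i (fun a => c a != 0) idx ci.
case ia: (idx a) => [|p].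
  have := hc 0%N isT; rewrite (bigD1 a) //= phi0 mulr1 big1 ?addr0 => [/eqP|b ba].
    by rewrite (negbTE ca).
  apply/eqP; rewrite phi0 mulr1; apply: contraTT ba => /amax; rewrite ia /= leqn0 => /eqP ib.
  by rewrite negbK; apply/eqP/idxI; rewrite ia.
pose f (b : 'I_N) := if (idx (lift a b) <= p)%N then n (idx (lift a b)) else 0%N.
have fM b : (f b < (n p).+1)%N.
  by rewrite /f ltnS; case: ifP => // /nmono.
have := betaP (n p).+1 f fM; rewrite -[beta _]/(n p.+1) -ia => /negP; apply; apply/eqP.
apply: (mulfI ca); rewrite mulr0.
transitivity (\sum_b c b * \sum_(j < N.+1) lam f j * phi (n (idx b)) j).
  rewrite [RHS](bigD1 a) //= [X in _ = _ + X]big1 ?addr0 // => b ba.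
  have [->|cb] := eqVneq (c b) 0; first by rewrite mul0r.
  have ib : (idx b <= p)%N.
    have := amax b cb; rewrite ia /= leq_eqVlt => /predU1P[e|//].
    by case/eqP: ba; apply: idxI; rewrite ia.
  have [b' bE] : exists b', b = lift a b'.
    by case: (unliftP a b) ba => [b' ->|->]; [exists b'|rewrite eqxx].
  have [_ /(_ b')] := lamP f; rewrite /f -bE ib => ->.
  by rewrite mulr0.
under eq_bigr do rewrite mulr_sumr.
rewrite exchange_big big1 //= => j _.
rewrite (eq_bigr (fun b => lam f j * (c b * phi (n (idx b)) j))); last by move=> b _; rewrite mulrCA.
by rewrite -mulr_sumr hc ?mulr0.
Qed.
End Greedy.

(** * The three families of points *)

Section CurveFrames.
Variable R : rcfType.
Local Open Scope complex_scope.
Local Notation C := (R[i]).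
Local Notation cj := (@conjc R).
Implicit Types (P : nat -> nat -> R).

Lemma curve_frame_free (delta : R) k N s t F (w : 'I_N -> C) (c : 'I_N -> R) :
  N = (2 * k).+1 -> delta != 0 -> {in s, forall a, 0 < a} -> size s = (2 * k)%N -> orth_frame s t F ->
  injective w -> (forall i, on_circle (w i)) ->
  \sum_i c i = 0 -> (forall j, (j < size t)%N -> \sum_i c i * F j (curve delta k 0 (w i)) = 0) ->
  forall i, c i = 0.
Proof.
move=> eN; subst N => d0 sp ss Fo winj wu c0 hF.
have hU n : (n < 2 * k)%N -> \sum_i c i * curve delta k 0 (w i) n = 0.
  move=> nk; have [Fl _] := Fo.
  apply: (frame_inj sp Fo (x := fun n => \sum_i c i * curve delta k 0 (w i) n)); last by rewrite ss.
  by move=> j jt; rewrite -[RHS](hF j jt); apply: rat_linear_comb (Fl j).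
apply: (trig_free winj wu) => -[|n] nk.
- by rewrite -[RHS]c0; apply: eq_bigr => i _; rewrite expr0 mulr1.
- rewrite -[RHS](hU n); last by lia.
  by apply: eq_bigr => i _; rewrite /curve nk.
- by rewrite big1 // => i _; rewrite expr0 /= mulr0.
have := hU (k + n)%N; rewrite /curve.
have -> : (k + n < k)%N = false by lia.
rewrite addKn => h; apply: (mulIf (invr_neq0 d0)); rewrite mul0r mulr_suml -[RHS]h; last by lia.
by apply: eq_bigr => i _; rewrite mulrA.
Qed.

Lemma stereo_dist_cancel (d T r a1 a2 b1 b2 : R) : d != 0 -> T != 0 -> a1 != 0 -> a2 != 0 ->
  b1 != 0 -> b2 != 0 ->
  4 * d * r ^+ 2 / (b1 * b2) / (2 * d * a1 ^+ 2 / (T * b1) * (2 * d * a2 ^+ 2 / (T * b2))) =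
  d * (T * r / (d * a1 * a2)) ^+ 2.
Proof. by move=> d0 T0 a10 a20 b10 b20; field; rewrite ?d0 ?T0 ?a10 ?a20 ?b10 ?b20. Qed.

Lemma param_of_height (d T r n h x den Q L : R) : T != 0 -> n != 0 -> den != 0 ->
  den = 2 * d * h ^+ 2 / (T * n) -> h ^+ 2 = r ^+ 2 + den * (x + L) -> d * Q = 2 * T / den - 1 ->
  n = (d * r / T) ^+ 2 * Q + 2 * d / T * L + (d * r ^+ 2 / T ^+ 2 + 2 * d / T * x).
Proof.
move=> T0 n0 den0 e1 e2 e3.
have e1' : den * (T * n) = 2 * d * h ^+ 2 by rewrite e1 divfK ?mulf_neq0.
have -> : n = 2 * d * h ^+ 2 / (T * den).
  by rewrite -e1'; field; rewrite ?T0 ?den0.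
rewrite e2.
have -> : (d * r / T) ^+ 2 * Q = d * r ^+ 2 / T ^+ 2 * (d * Q) by field.
by rewrite e3; field; rewrite ?T0 ?den0.
Qed.

(** There are k = 2 m + 1 weights and w = y / conj y for y = u + i delta. The distances between
    curve points are rational up to the norms |y|. These cancel in the stereographic projection
    from w = 1, because the distance to that point contains |y| as well; the projection has
    dimension 2 k - 1. Any 2 k + 1 points of the curve are affinely independent, by [trig_free].
    The last formula prepares for [inverted_family]. The height S - F 0 of the curve point is 2
    D h^2 / (S |y|^2) for h = [dirichlet m q w]. Here h^2 is a trigonometric polynomial of
    degree 2 m < k, hence affine in the curve point, so that u^2 = |y|^2 - D is affine in the
    projection and its squared norm. *)
Theorem odd_family m : exists (Y : rat -> nat -> R) (A : rat) (beta : nat -> rat) (E : rat),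
  let d := (4 * m).+1 in
  [/\ rational_family d Y, affinely_free d Y, spherically_free d Y, 0 < A &
   forall u, ratr u ^+ 2 = ratr A ^+ 2 * (\sum_(0 <= j < d) Y u j ^+ 2) +
     \sum_(0 <= j < d) ratr (beta j) * Y u j + ratr E].
Proof.
have [q [sigma [q0 sg0 qs bpos bunit]]] := odd_coefficients m.
pose k := m.*2.+1; pose B := coefs k 0 m q.
have sB : size B = k by rewrite size_mkseq.
have Bp : {in B, forall a, 0 < a}.
  by move=> a /mapP[n]; rewrite mem_iota => /andP[_ nk] ->; apply: bpos; lia.
have Bsum : \sum_(a <- B) a = sigma ^+ 2.
  rewrite (big_nth 0) sB.
  have e := @coefs_sum R k 0 m q (fun n => (0 < n)%N%:R) erefl (or_introl erefl).
  apply: (fmorph_inj (ratr : {rmorphism rat -> R})) => /=.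
  rewrite rmorph_sum /=.
  transitivity (\sum_(0 <= i < k) ratr B`_i * ((0 < 0 + i.+1)%N%:R : R)).
    by apply: eq_bigr => i _; rewrite mulr1.
  rewrite e (bform_sum _ _ (h := fun n => (0 < n)%N%:R)) //.
  rewrite -qs rmorph_sum; apply: eq_bigr => u _ /=.
  rewrite (bigD1 u) //= subnn ltnn !subr0 rmorphXn /= big1 ?addr0.
    have -> : (0 < m.*2.+1 - (u + u))%N by have := ltn_ord u; lia.
    by rewrite mulr1 expr2.
  move=> v vu; have um := ltn_ord u; have vm := ltn_ord v.
  have -> : (0 < m.*2.+1 - (u + v))%N by lia.
  have [uv|uv] := ltnP u v.
    have -> : (0 < v - u)%N by lia.
    have -> : (0 < u - v)%N = false by lia.
    by rewrite subr0 subrr mulr0.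
  have uv' : (v < u)%N by rewrite ltn_neqAle uv andbT; apply: contra vu => /eqP e'; apply/eqP/val_inj.
  have -> : (0 < v - u)%N = false by lia.
  have -> : (0 < u - v)%N by lia.
  by rewrite subr0 subrr mulr0.
have [D D0 [F [Fo F0]]] : exists2 D, 0 < D & exists F : nat -> (nat -> R) -> R,
    orth_frame (hdouble D B) (1 :: nseq (2 * m.*2).+1 D) F /\
    forall x, F 0%N x = \sum_(0 <= i < k) ratr (B`_i / sigma) * x i.
  have := @odd_frame R; move: sB Bp Bsum; case eB: B => [|b s] // [ss] Bp Bsum /(_ b s sigma Bp sg0 Bsum).
  rewrite ss; apply; first by lia.
  have [om|om] := boolP (odd m); [right|by left; lia].
  by have := bunit om; rewrite -eB /B /coefs /mkseq big_map big_add1 /index_iota subn0.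
pose delta : R := Num.sqrt (ratr D).
have rD0 : 0 < ratr D :> R by rewrite ltr0q.
have delta0 : delta != 0 by rewrite gt_eqF // sqrtr_gt0.
have deltaD : delta ^+ 2 = ratr D by rewrite sqr_sqrtr // ltW.
pose y (u : rat) : C := ratr u +i* delta.
have y0 u : y u != 0 by apply: contraNneq delta0 => /(congr1 (@complex.Im _)) /= ->.
have Ky u : inK delta (y u) by exists u, 1; rewrite rmorph1 mulr1.
pose w u := y u / cj (y u).
have cw u : on_circle (w u) by exact: conj_frac.
have Kw u : inK delta (w u) by exact: (inK_frac deltaD (y0 u) (Ky u)).
have winj : injective w.
  move=> u v /(congr1 (fun z => z * (cj (y u) * cj (y v)))).
  have c0 x : cj (y x) != 0 by rewrite conjc_eq0.
  have -> : w u * (cj (y u) * cj (y v)) = y u * cj (y v) by rewrite mulrA /w divfK.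
  have -> : w v * (cj (y u) * cj (y v)) = y v * cj (y u) by rewrite mulrCA /w divfK // mulrC.
  move/(congr1 (@complex.Im _)); rewrite !cImM /= => e.
  by apply: (fmorph_inj (ratr : {rmorphism rat -> R})) => /=; apply: (mulIf delta0); lra.
pose e := (4 * m).+1.
have em : (2 * m.*2).+1 = e by rewrite /e; lia.
rewrite em in Fo; have [Fl FE] := Fo.
set s := hdouble D B in Fo Fl FE.
have ss : size s = (2 * k)%N by rewrite /s size_cat sB size_map sB; lia.
have sp : {in s, forall a, 0 < a}.
  move=> a; rewrite mem_cat => /orP[/Bp //|/mapP[b /Bp b0 ->]]; exact: mulr_gt0.
pose U u := curve delta k 0 (w u); pose U1 := curve delta k 0 1.
pose S : R := ratr sigma.
have S0 : 0 < S by rewrite ltr0q.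
have F0E x : F 0%N x = (\sum_(0 <= i < k) ratr B`_i * x i) / S.
  rewrite F0 mulr_suml; apply: eq_bigr => i _; rewrite fmorph_div /=; ring.
have SB : \sum_(0 <= i < k) ratr B`_i = S ^+ 2 :> R.
  by rewrite /S -rmorphXn -Bsum rmorph_sum [RHS](big_nth 0) sB.
have F1_0 : F 0%N U1 = S.
  rewrite F0E; rewrite (eq_big_nat _ _ (F2 := fun i => ratr B`_i)) => [|i /andP[_ ik]].
    by rewrite SB expr2 mulfK // gt_eqF.
  by rewrite /U1 /curve ik expr1n /= mulr1.
have F1_j j : (j < e)%N -> F j.+1 U1 = 0.
  move=> je; have := FE U1; rewrite (dform_cons 1 (nseq e D)) rmorph1 mul1r dform_nseq F1_0 /s dform_hdouble.
  have -> : dform B U1 = S ^+ 2.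
    rewrite -SB /dform sB; apply: eq_big_nat => i /andP[_ ik].
    by rewrite /U1 /curve ik expr1n /= expr1n mulr1.
  have -> : dform B (fun i => U1 (size B + i)%N) = 0.
    rewrite /dform big1 // => i _; rewrite /U1 /curve sB.
    by rewrite ltnNge leq_addr /= expr1n /= mul0r expr0n mulr0.
  rewrite mulr0 => /addrI /esym/eqP; rewrite mulf_eq0 (gt_eqF rD0) /= big_mkord.
  rewrite psumr_eq0 => [/allP /(_ (Ordinal je))|i _]; last exact: sqr_ge0.
  by rewrite mem_index_enum => /(_ isT) /=; rewrite sqrf_eq0 => /eqP.
have c1 : on_circle (1 : C) by rewrite /on_circle rmorph1 mulr1.
have HU u : dform s (fun i => U u i - U1 i) = 2 * S * (S - F 0%N (U u)).
  have := dform_curve delta0 deltaD 0 B (cw u) c1.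
  rewrite sB -/(U u) -/U1 /s => ->.
  rewrite rmorph1 mulr1 F0E.
  have -> : 2 * S * (S - (\sum_(0 <= i < k) ratr B`_i * U u i) / S) =
    2 * (S ^+ 2 - \sum_(0 <= i < k) ratr B`_i * U u i) by field; rewrite gt_eqF.
  rewrite -SB -sumrB; congr (_ * _); apply: eq_big_nat => i /andP[_ ik].
  by rewrite /U /curve ik mulrBr mulr1.
have den0 u : S - F 0%N (U u) != 0.
  apply/eqP => d0; have := HU u; rewrite d0 mulr0 => /(dform_eq0 sp) U0.
  have wE : w u = 1.
    apply: complex_ext.
      have := U0 0%N; rewrite ss /U /U1 /curve /= => /(_ isT)/eqP.
      by rewrite subr_eq0 => /eqP.
    have := U0 k; rewrite ss /U /U1 /curve ltnn subnn expr1n /= mul0r subr0 => hk.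
    have kk : (k < 2 * k)%N by lia.
    by move: (hk kk) => /eqP; rewrite mulf_eq0 invr_eq0 (negbTE delta0) orbF => /eqP.
  have := congr1 (fun z => complex.Im (z * cj (y u))) wE; rewrite /w divfK ?conjc_eq0 // mul1r /=.
  by move/eqP; rewrite -subr_eq0 opprK -mulr2n mulrn_eq0 /= (negbTE delta0).
pose h u := dirichlet m q (w u); pose n u := normsq (y u).
have n0 u : n u != 0 by rewrite gt_eqF // normsq_gt0.
have hden u : S - F 0%N (U u) = 2 * ratr D * h u ^+ 2 / (S * n u).
  have := curve_dist1 delta0 deltaD q (erefl : k = m.*2.+1) (y0 u) (Ky u) erefl.
  rewrite -/s -/(U u) -/U1 HU -/(h u) -/(n u) => E1; have Sn := gt_eqF S0; apply: (mulfI (_ : 2 * S != 0)).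
    by rewrite mulf_eq0 pnatr_eq0 Sn.
  by rewrite E1; field; rewrite ?Sn ?n0.
have h0 u : h u != 0.
  by apply: contraNneq (den0 u) => h0; rewrite hden h0 expr0n /= mulr0 mul0r.
have Re_rat u j : rational_value (complex.Re (w u ^+ j)).
  by have [c [_ [-> _]]] := inKX deltaD j (Kw u); exists c.
have ratq x : rational_value (ratr x : R) by exists x.
have h_rat u : rational_value (h u).
  apply: rational_value_sum => i; apply: rational_valueM => //.
  apply: rational_valueD; first by exists 1; rewrite rmorph1.
  apply: rational_valueM; first by exists 2; rewrite ratr_nat.
  by apply: rational_value_sum.
have FU_rat u j : rational_value (F j (U u)).
  by apply: rational_value_linear (Fl j) _ => i; apply: (curve_rational delta0 deltaD).
(* the expansion of h^2 in cosines, used for the formula for u^2 *)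
have [a ha] := cos_polyM (cos_poly_dirichlet R m q) (cos_poly_dirichlet R m q).
pose r := \sum_(u < m.+1) q u * (1 + 2 * (m - u)%N%:R).
have r0 : 0 < r.
  rewrite /r big_ord_recr /= subnn mulr0 addr0 mulr1 ltr_wpDl ?q0 //.
  apply: sumr_ge0 => i _; rewrite mulr_ge0 ?ltW ?q0 ?ltr_pwDl ?mulr_ge0 //; last by rewrite ltnW.
have h1 : dirichlet m q (1 : C) = ratr r.
  rewrite /dirichlet /r rmorph_sum; apply: eq_bigr => u _ /=.
  rewrite rmorphM rmorphD rmorph1 rmorphM /= !ratr_nat; congr (_ * (_ + _ * _)).
  rewrite (eq_bigr (fun=> 1)) => [|j _]; last by rewrite expr1n.
  by rewrite sumr_const card_ord.
have [k' hk'] := stereo_dual sp Fo F1_0 F1_j den0 (fun i => if (i < m.*2)%N then a i.+1 else 0).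
exists (stereo U (ratr sigma) F), (D * r / sigma), (fun j => 2 * D / sigma * k' j.+1),
  (D * r ^+ 2 / sigma ^+ 2 + 2 * D / sigma * k' 0%N - D).
rewrite -/S -/e; split.
- split=> [u j|u v].
    apply: rational_valueM; first exact: FU_rat.
    apply: rational_valueV; apply: rational_valueD; first exact: ratq.
    by apply: rational_valueN; exact: FU_rat.
  have [rho hrho] := @curve_dist _ _ _ delta0 deltaD k 0 m q _ _ erefl (or_introl erefl) (y0 u) (y0 v) (Ky u) (Ky v).
  have sd := stereo_dist Fo F1_0 F1_j HU den0 u v.
  have {hrho} hr : dform s (fun i => U u i - U v i) = 4 * ratr D * ratr rho ^+ 2 / (n u * n v) by exact: hrho.
  have [hu hhu] := h_rat u; have [hv hhv] := h_rat v.
  exists (sigma * rho / (D * hu * hv)).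
  apply: (mulfI (_ : ratr D != 0 :> R)); first by rewrite gt_eqF.
  have aE : ratr (sigma * rho / (D * hu * hv)) = S * ratr rho / (ratr D * h u * h v).
    by rewrite hhu hhv fmorph_div !rmorphM.
  rewrite aE. 
  apply: (eq_trans sd).
  rewrite hr (congr2 ( *%R) (hden u) (hden v)).
  by apply: stereo_dist_cancel => //; rewrite gt_eqF.
- apply: (stereo_affinely_free (U1 := U1)) => // u c0 c uinj hc hF.
  pose w' (i : 'I_e.+2) := if unlift ord0 i is Some j then w (u j) else 1.
  pose c' (i : 'I_e.+2) := if unlift ord0 i is Some j then c j else c0.
  have c'0 : c' ord0 = c0 by rewrite /c' unlift_none.
  have w'0 : w' ord0 = 1 by rewrite /w' unlift_none.
  have c'S i : c' (lift ord0 i) = c i by rewrite /c' liftK.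
  have w'S i : w' (lift ord0 i) = w (u i) by rewrite /w' liftK.
  have w1 v : w v != 1.
    apply: contra (den0 v) => /eqP wv; rewrite /U wv; apply/eqP; rewrite -[curve _ _ _ 1]/U1 F1_0 subrr //.
  move=> i; rewrite -c'S.
  apply: (@curve_frame_free delta k e.+2 s (1 :: nseq e D) F w' c') => //; first by rewrite /e /k; lia.
  + move=> a1 a2; case: (unliftP ord0 a1) => [b1 ->|->]; case: (unliftP ord0 a2) => [b2 ->|->] //.
    * by rewrite !w'S => /winj/uinj ->.
    * by rewrite w'S w'0 => /eqP; rewrite (negbTE (w1 _)).
    * by rewrite w'S w'0 => /esym/eqP; rewrite (negbTE (w1 _)).
  + move=> a1; case: (unliftP ord0 a1) => [b1 ->|->]; by rewrite ?w'S ?w'0.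
  + by rewrite big_ord_recl c'0 -[RHS]hc; congr (_ + _); apply: eq_bigr => b _; rewrite c'S.
  move=> j; rewrite /= size_nseq => je; rewrite big_ord_recl c'0 w'0 -[RHS](hF j je); congr (_ + _).
  by apply: eq_bigr => b _; rewrite c'S w'S.
- apply: (stereo_spherically_free (U1 := U1) (s := s) (D := D)) => // u c uinj hc hF.
  apply: (@curve_frame_free delta k e.+2 s (1 :: nseq e D) F (w \o u) c) => //; first by rewrite /e /k; lia.
  + exact: inj_comp.
  + by move=> a1; apply: cw.
  by move=> j; rewrite /= size_nseq => je; rewrite -[RHS](hF j je).
- by rewrite divr_gt0 ?mulr_gt0.
move=> u.
have key : h u ^+ 2 = ratr r ^+ 2 + (S - F 0%N (U u)) * (ratr (k' 0%N) +
    \sum_(0 <= j < e) ratr (k' j.+1) * stereo U S F u j).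
  rewrite -hk' [h u ^+ 2]expr2 /h ha // -h1 [X in _ = X + _]expr2 ha // addnn ss.
  rewrite !big_ord_recl !expr0 -addrA; congr (_ + _); apply/eqP; rewrite addrC -subr_eq; apply/eqP.
  rewrite (@big_cat_nat _ _ _ m.*2) //=; last by lia.
  rewrite [X in _ = _ + X]big_nat_cond [X in _ = _ + X]big1 => [|i /andP[/andP[hi _] _]]; last first.
    by rewrite ltnNge hi /= rmorph0 mul0r.
  rewrite addr0 big_mkord -sumrB; apply: eq_bigr => i _; have im := ltn_ord i.
  rewrite im /U /U1 /curve.
  have -> : (i < k)%N by lia.
  by rewrite mulrBr /bump !add0n !add1n.
have -> : ratr u ^+ 2 = n u - ratr D by rewrite /n /normsq /= deltaD addrK.
have QE : ratr D * \sum_(0 <= j < e) stereo U S F u j ^+ 2 = 2 * S / (S - F 0%N (U u)) - 1.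
  rewrite (stereo_normsq Fo F1_0 F1_j HU den0); apply: (mulIf (den0 u)).
  by rewrite mulrBl !divfK //; ring.
rewrite (param_of_height (_ : S != 0) (n0 u) (den0 u) (hden u) key QE); last by rewrite gt_eqF.
have := ratr_nat R 2; move: (2 : rat) => tw tw2.
rewrite !(rmorphB, rmorphD, rmorphM, fmorphV, rmorphXn) /= tw2 -/S -!addrA; congr (_ + (_ + _)).
rewrite mulr_sumr; apply: eq_bigr => j _.
by rewrite !(rmorphM, fmorphV) /= tw2 mulrA.
Qed.
End CurveFrames.

Section EvenFamily.
Variable R : rcfType.
Local Open Scope complex_scope.
Local Notation C := (R[i]).
Local Notation cj := (@conjc R).

(** The functions 1, Re w^n, Im w^n with 2 <= n <= k + 1; the frequency 1 is missing, so that a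
    nonzero combination may have 2 k + 2 zeros, more than the dimension allows for a curve in
    general position. *)
Definition lacunary (delta : R) k w j : R := if j is i.+1 then curve delta k 1 w i else 1.

Lemma lacunary_separated (delta : R) k (w : 'I_(2 * k.+1).+1 -> C) (lam : nat -> R) :
  delta != 0 -> injective w -> (forall i, on_circle (w i)) ->
  (forall i, \sum_(j < (2 * k).+1) lam j * lacunary delta k (w i) j = 0) ->
  forall j, (j < (2 * k).+1)%N -> lam j = 0.
Proof.
move=> d0 winj wu h.
pose K := k.+1.
pose lam' i := if i == 0%N then lam 0%N else if (i == 1%N) || (i == K.+1) then 0
  else if (i <= K)%N then lam i.-1 else lam (i - 2)%N / delta.
have h' i : \sum_(j < (2 * K).+1) lam' j * trig K j (w i) = 0.
  rewrite -[RHS](h i).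
  rewrite -(big_mkord xpredT (fun j => lam' j * trig K j (w i))).
  rewrite -(big_mkord xpredT (fun j => lam j * lacunary delta k (w i) j)).
  rewrite (@big_cat_nat _ _ _ K.+1) /=; [|lia|lia].
  rewrite [RHS](@big_cat_nat _ _ _ k.+1) /=; [|lia|lia].
  congr (_ + _).
    rewrite big_nat_recl // [RHS]big_nat_recl // big_nat_recl //.
    have -> : lam' 1%N = 0 by [].
    rewrite mul0r add0r {1}/lam' /trig /=; congr (_ * _ + _).
    apply: eq_big_nat => j /andP[_ jk]; rewrite /lam' /curve jk /=.
    have -> : (j.+2 == K.+1) = false by lia.
    have -> : (j.+2 <= K)%N by [].
    by rewrite add1n.
  have -> : (2 * K).+1 = (K.+1 + K)%N by lia.
  have -> : (2 * k).+1 = (k.+1 + k)%N by lia.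
  rewrite -{1}[K.+1]add0n -{1}[k.+1]add0n !big_addn !addKn big_nat_recl //.
  have -> : lam' (0 + K.+1)%N = 0 by rewrite /lam' add0n eqxx orbT.
  rewrite mul0r add0r; apply: eq_big_nat => j /andP[_ jk].
  have -> : lam' (j.+1 + K.+1)%N = lam (j + k.+1)%N / delta.
    rewrite /lam' !ifF; try (rewrite /K; lia).
    by congr (lam _ / _); rewrite /K; lia.
  have -> : trig K (j.+1 + K.+1) (w i) = complex.Im (w i ^+ (j.+2)).
    rewrite /trig ifF; last by lia.
    by congr (complex.Im (_ ^+ _)); lia.
  rewrite addnS /= /curve ifF; last by lia.
  have -> : (1 + (j + k - k).+1 = j.+2)%N by lia.
  by rewrite mulrAC mulrA.
have H := trig_separated winj wu h'.
case=> [|j] jk; first by have := H 0%N isT.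
have [jk'|jk'] := ltnP j k.
  have := H j.+2; rewrite /lam' /=.
  have -> : (j.+2 == K.+1) = false by lia.
  have -> : (j.+2 <= K)%N by [].
  by apply; rewrite /K; lia.
have := H j.+3; rewrite /lam' /=.
have -> : (j.+3 == K.+1) = false by lia.
have -> : (j.+3 <= K)%N = false by lia.
move=> /(_ _)/eqP; rewrite mulf_eq0 invr_eq0 (negbTE d0) orbF => hh.
by apply/eqP/hh; rewrite /K; lia.
Qed.

Lemma frac_frac_eq (Y Y' : C) : Y != 0 -> Y' != 0 ->
  Y / cj Y / cj (Y / cj Y) = Y' / cj Y' / cj (Y' / cj Y') ->
  complex.Re (Y * cj Y') * complex.Im (Y * cj Y') = 0.
Proof.
move=> Y0 Y0'.
have sq X : X != 0 -> X / cj X / cj (X / cj X) = (X / cj X) ^+ 2.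
  by move=> X0; rewrite [cj (X / _)]rmorphM fmorphV /= conjcK invf_div expr2.
rewrite !sq // => e.
have {}e : (Y * cj Y') ^+ 2 = (cj (Y * cj Y')) ^+ 2.
  have c0 : cj Y != 0 by rewrite conjc_eq0.
  have c0' : cj Y' != 0 by rewrite conjc_eq0.
  have := congr1 (fun t => t * (cj Y * cj Y') ^+ 2) e; rewrite -!exprMn.
  by rewrite mulrA divfK // mulrCA divfK // rmorphM /= conjcK.
move: (Y * cj Y') e => X /(congr1 (@complex.Im _)).
by rewrite !expr2 !cImM cReJ cImJ; lra.
Qed.

(** There are k = 2 m + 2 weights, for the frequencies 2, ..., k + 1, and w = z^2 with z = y /
    conj y on the circle. The distances are then rational because |z| = 1. The points are
    selected with [greedy]. *)
Theorem even_family m : exists P : nat -> nat -> R,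
  rational_family (4 * m.+1) P /\ affinely_free (4 * m.+1) P.
Proof.
have [q [b1 bpos bunit]] := even_coefficients m.
pose M := m.+1; pose k := M.*2; pose B := coefs k 1 M q.
have sB : size B = k by rewrite size_mkseq.
have Bp : {in B, forall a, 0 < a}.
  by move=> a /mapP[n]; rewrite mem_iota => /andP[_ nk] ->; apply: bpos; lia.
have [D D0 iso] : exists2 D, 0 < D & isometric R (hdouble D B) (nseq (2 * k) D).
  rewrite -sB; apply: isometric_sum_squares => //; first by rewrite sB odd_double.
  rewrite sB; have [om|om] := boolP (odd m); [left; lia|right].
  have := bunit om; rewrite /B /coefs /mkseq big_map 2!big_add1 /index_iota subn0.
  by [].
have [F Fo] := isometric_frame iso; have [Fl FE] := Fo.
pose delta : R := Num.sqrt (ratr D).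
have rD0 : 0 < ratr D :> R by rewrite ltr0q.
have delta0 : delta != 0 by rewrite gt_eqF // sqrtr_gt0.
have deltaD : delta ^+ 2 = ratr D by rewrite sqr_sqrtr // ltW.
pose y (u : nat) : C := u%:R +i* delta.
have y0 u : y u != 0 by apply: contraNneq delta0 => /(congr1 (@complex.Im _)) /= ->.
have Ky u : inK delta (y u) by exists u%:R, 1; rewrite rmorph1 mulr1 ratr_nat.
pose z u := y u / cj (y u).
have cz u : on_circle (z u) by exact: conj_frac.
have z0 u : z u != 0 by exact: on_circle_neq0.
have Kz u : inK delta (z u) by exact: (inK_frac deltaD (y0 u) (Ky u)).
pose w u := z u / cj (z u).
have cw u : on_circle (w u) by exact: conj_frac.
have Kw u : inK delta (w u) by exact: (inK_frac deltaD (z0 u) (Kz u)).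
have winj : injective w.
  move=> u v e.
  have := frac_frac_eq (y0 u) (y0 v) e; rewrite cReM cImM /= => /eqP; rewrite mulf_eq0 => /orP[/eqP h|/eqP h]; last first.
    by apply/eqP; rewrite -(eqr_nat R); apply/eqP; apply: (mulIf delta0); lra.
  have : 0 < (u%:R * v%:R + delta ^+ 2 : R) by rewrite deltaD ltr_wpDl // mulr_ge0.
  by rewrite (_ : _ + _ = 0) ?ltxx // -h; ring.
set s := hdouble D B in iso Fo Fl FE.
have ss : size s = (2 * k)%N by rewrite /s size_cat sB size_map sB; lia.
have sp : {in s, forall a, 0 < a}.
  by move=> a; rewrite mem_cat => /orP[/Bp //|/mapP[b /Bp b0 ->]]; exact: mulr_gt0.
have free lam : (exists2 j, (j < (2 * k).+1)%N & lam j != 0) ->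
    exists N, forall v, (N <= v)%N -> \sum_(j < (2 * k).+1) lam j * lacunary delta k (w v) j != 0.
  move=> [j jk lj]; apply: contrapT => hn.
  have unb N : exists2 v, (N <= v)%N & \sum_(j < (2 * k).+1) lam j * lacunary delta k (w v) j = 0.
    apply: contrapT => h; apply: hn; exists N => v Nv; apply/eqP => h0.
    by apply: h; exists v.
  have [f [finj f0]] := unbounded_injective (2 * k.+1).+1 unb.
  case/eqP: lj; apply: (@lacunary_separated delta k (w \o f)) => //; first exact: inj_comp.
  by move=> i; apply: cw.
have [n nfree] := @greedy R (2 * k) (fun v => lacunary delta k (w v)) (fun=> erefl) free.
have FB j a b : F j (fun i => a i - b i) = F j a - F j b.
  transitivity (F j (fun i => 1 * a i + (- 1) * b i)).
    by apply: (rat_linear_ext (Fl j)) => i _; rewrite mul1r mulN1r.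
  by rewrite (rat_linear_lin _ _ _ _ (Fl j)) mul1r mulN1r.
have kd : (4 * m.+1 = 2 * k)%N by rewrite /k /M; lia.
rewrite kd; exists (fun u j => F j (curve delta k 1 (w (n u)))); split.
  split=> [u j|u v].
    by apply: rational_value_linear (Fl j) _ => i; apply: (curve_rational delta0 deltaD).
  have nz x : normsq (z x) = 1 by exact: on_circleP.
  have [rho] := @curve_dist _ _ _ delta0 deltaD k 1 M q _ _ erefl (or_intror (conj erefl b1))
    (z0 (n u)) (z0 (n v)) (Kz (n u)) (Kz (n v)).
  rewrite -/s FE dform_nseq !nz mulr1 divr1 => h; exists (2 * rho).
  apply: (mulfI (_ : ratr D != 0 :> R)); first by rewrite gt_eqF.
  rewrite rmorphM /= ratr_nat; transitivity (4 * ratr D * ratr rho ^+ 2 : R); last by ring.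
  by rewrite -h; congr (_ * _); apply: eq_bigr => j _; rewrite FB.
move=> u c uinj c0 hF.
have hU j : (j < 2 * k)%N -> \sum_i c i * curve delta k 1 (w (n (u i))) j = 0.
  move=> jk; apply: (frame_inj sp Fo (x := fun j => \sum_i c i * curve delta k 1 (w (n (u i))) j)); last by rewrite ss.
  move=> a; rewrite size_nseq => ak; rewrite -[RHS](hF a ak).
  exact: (rat_linear_comb c (fun i => curve delta k 1 (w (n (u i)))) (Fl a)).
apply: (nfree u) => // -[|j] jk; last exact: hU.
by rewrite -[RHS]c0; apply: eq_bigr => i _; rewrite mulr1.
Qed.
End EvenFamily.

Section Inversion.
Variable R : rcfType.

(** Inversion at the origin divides the distance of two points by the product of their norms. *)
Lemma inversion_dist d (V V' : nat -> R) (g g' : R) : g != 0 -> g' != 0 ->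
  \sum_(0 <= j < d) V j ^+ 2 = g ^+ 2 -> \sum_(0 <= j < d) V' j ^+ 2 = g' ^+ 2 ->
  \sum_(0 <= j < d) (V j / g ^+ 2 - V' j / g' ^+ 2) ^+ 2 =
  (\sum_(0 <= j < d) (V j - V' j) ^+ 2) / (g * g') ^+ 2.
Proof.
move=> g0 g0' hV hV'; pose p := \sum_(0 <= j < d) V j * V' j.
have -> : \sum_(0 <= j < d) (V j - V' j) ^+ 2 = g ^+ 2 + g' ^+ 2 - 2 * p.
  rewrite -hV -hV' /p mulr_sumr -big_split -sumrB; apply: eq_bigr => j _ /=; ring.
transitivity ((\sum_(0 <= j < d) V j ^+ 2) / g ^+ 4 + (\sum_(0 <= j < d) V' j ^+ 2) / g' ^+ 4 -
    2 * p / (g ^+ 2 * g' ^+ 2)).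
  rewrite /p mulr_sumr !mulr_suml -big_split -sumrB; apply: eq_bigr => j _ /=.
  by field; rewrite ?g0 ?g0'.
by rewrite hV hV'; field; rewrite ?g0 ?g0'.
Qed.

Lemma square_difference (c : rat) : exists nu eta : rat, [/\ nu != 0, eta != 0 & c + eta ^+ 2 = nu ^+ 2].
Proof.
pose m := `|c| + 1; have m0 : 0 < m by rewrite ltr_wpDl.
have cm : `|c| < m ^+ 2.
  by have := normr_ge0 c; rewrite /m; nra.
have := ler_norm c; have := ler_norm (- c); rewrite normrN => c1 c2.
exists ((m ^+ 2 + c) / (2 * m)), ((c - m ^+ 2) / (2 * m)).
have mm : 2 * m != 0 by rewrite mulf_neq0 // gt_eqF.
split; last by field; rewrite gt_eqF.
  by rewrite mulf_neq0 ?invr_eq0 // gt_eqF //; lra.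
by rewrite mulf_neq0 ?invr_eq0 // lt_eqF //; lra.
Qed.

(** Completing the square in the formula of [odd_family] gives a point b and a constant c with
    |Y u - b|^2 = u^2 / A^2 + c. Place the points in a hyperplane at distance eta from the
    centre of an inversion above b, with c + eta^2 = nu^2. The distance to the centre is
    rational for those u for which u / A, nu are the legs of a rational right triangle. A
    dependency among the inverted points becomes one between the coordinates, the squared norm
    and 1 at the points Y u. *)
Theorem inverted_family m : exists P : nat -> nat -> R,
  rational_family (4 * m).+2 P /\ affinely_free (4 * m).+2 P.
Proof.
have [Y [A [beta [E [[Yrat Ydist] _ Yfree A0 Yu]]]]] := odd_family R m.
move: (4 * m).+1 Yrat Ydist Yfree Yu => d Yrat Ydist Yfree Yu.
pose b j := - beta j / (2 * A ^+ 2).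
pose c := \sum_(0 <= j < d) b j ^+ 2 - E / A ^+ 2.
have [nu [eta [nu0 eta0 cE]]] := square_difference c.
pose lam (n : nat) : rat := n%:R + 1.
have lam0 n : 0 < lam n by rewrite ltr_wpDl.
(* u / A, nu and g are proportional to lam^2 - 1, 2 lam and lam^2 + 1. *)
pose u n := A * nu * (lam n ^+ 2 - 1) / (2 * lam n).
pose g n := nu * (lam n ^+ 2 + 1) / (2 * lam n).
have g0 n : g n != 0.
  rewrite !mulf_neq0 ?invr_eq0 ?mulf_neq0 ?(gt_eqF (lam0 n)) //.
  by rewrite gt_eqF // ltr_wpDl // sqr_ge0.
have uinj : injective u.
  move=> i j /(congr1 (fun x => x * 2 / (A * nu))).
  have uE n : u n * 2 / (A * nu) = lam n - (lam n)^-1.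
    by rewrite /u; field; rewrite ?nu0 ?(gt_eqF A0) ?(gt_eqF (lam0 n)).
  rewrite !uE => e; suff : lam i = lam j by move/addIr/eqP; rewrite eqr_nat => /eqP.
  have li := lam0 i; have lj := lam0 j.
  have : (lam i - lam j) * (1 + (lam i * lam j)^-1) = 0.
    have -> : (lam i - lam j) * (1 + (lam i * lam j)^-1) = (lam i - (lam i)^-1) - (lam j - (lam j)^-1).
      by field; rewrite ?(gt_eqF li) ?(gt_eqF lj).
    by rewrite e subrr.
  move/eqP; rewrite mulf_eq0 [X in _ || X]gt_eqF ?orbF ?subr_eq0 => [/eqP //|].
  by rewrite addr_gt0 // invr_gt0 mulr_gt0.
have uE n : u n ^+ 2 / A ^+ 2 + nu ^+ 2 = g n ^+ 2.
  by rewrite /u /g; field; rewrite ?(gt_eqF A0) ?(gt_eqF (lam0 n)).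
clearbody u g.
pose V n j : R := if j == d then ratr eta else Y (u n) j - ratr (b j).
have rA : ratr A != 0 :> R by rewrite fmorph_eq0 gt_eqF.
have VE n : \sum_(0 <= j < d.+1) V n j ^+ 2 = ratr (g n) ^+ 2.
  rewrite big_nat_recr //= {2}/V eqxx.
  rewrite (eq_big_nat _ _ (F2 := fun j => Y (u n) j ^+ 2 + (ratr (beta j) * Y (u n) j) / ratr A ^+ 2 + ratr (b j) ^+ 2)); last first.
    move=> j /andP[_ jd]; rewrite /V ltn_eqF // /b fmorph_div rmorphN rmorphM /= ratr_nat rmorphXn.
    by field.
  rewrite !big_split /= -mulr_suml.
  have hu := Yu (u n).
  have -> : \sum_(0 <= j < d) Y (u n) j ^+ 2 =
    (ratr (u n) ^+ 2 - \sum_(0 <= j < d) ratr (beta j) * Y (u n) j - ratr E) / ratr A ^+ 2.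
    by rewrite hu; field.
  have hc : \sum_(0 <= j < d) ratr (b j) ^+ 2 - ratr E / ratr A ^+ 2 + ratr eta ^+ 2 = ratr nu ^+ 2 :> R.
    have := congr1 (ratr : rat -> R) cE; rewrite /c rmorphD rmorphB rmorph_sum fmorph_div !rmorphXn /= => <-.
    by congr (_ - _ + _); apply: eq_bigr => j _; rewrite rmorphXn.
  have hg : ratr (u n) ^+ 2 / ratr A ^+ 2 + ratr nu ^+ 2 = ratr (g n) ^+ 2 :> R.
    by have := congr1 (ratr : rat -> R) (uE n); rewrite rmorphD fmorph_div !rmorphXn.
  by rewrite -hg -hc; field.
have rg n : ratr (g n) != 0 :> R by rewrite fmorph_eq0.
exists (fun n j => V n j / ratr (g n) ^+ 2); split.
  split=> [n j|n n'].
    apply: rational_valueM; last by exists (g n ^+ 2)^-1; rewrite fmorphV rmorphXn.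
    rewrite /V; case: eqP => _; first by exists eta.
    by apply: rational_valueD => //; apply: rational_valueN; exists (b j).
  rewrite (inversion_dist (rg n) (rg n') (VE n) (VE n')).
  have [a ha] := Ydist (u n) (u n').
  rewrite big_nat_recr //= {3 4}/V eqxx subrr expr0n addr0.
  exists (a / (g n * g n')); rewrite fmorph_div rmorphM /= expr_div_n -ha; congr (_ / _).
  apply: eq_big_nat => j /andP[_ jd]; rewrite /V ltn_eqF //; congr (_ ^+ _); ring.
move=> idx k kinj k0 hP.
pose k' i := k i / ratr (g (idx i)) ^+ 2.
have k'0 : \sum_i k' i = 0.
  have := hP d (ltnSn d); rewrite (eq_bigr (fun i => ratr eta * k' i)) => [|i _].
    by rewrite -mulr_sumr => /eqP; rewrite mulf_eq0 fmorph_eq0 (negbTE eta0) /= => /eqP.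
  by rewrite /V eqxx /k'; ring.
have k'Y j : (j < d)%N -> \sum_i k' i * Y (u (idx i)) j = 0.
  move=> jd; transitivity (\sum_i (k i * (V (idx i) j / ratr (g (idx i)) ^+ 2) + ratr (b j) * k' i)).
    by apply: eq_bigr => i _; rewrite /V ltn_eqF // /k'; ring.
  by rewrite big_split -mulr_sumr /= k'0 hP ?mulr0 ?addr0 // ltnW.
suff hk i : k' i = 0.
  by move=> i; have /eqP := hk i; rewrite /k' mulf_eq0 invr_eq0 expf_eq0 (negbTE (rg _)) andbF orbF => /eqP.
apply: (Yfree (u \o idx)) => //; first exact: inj_comp.
transitivity (\sum_i (k i - (ratr eta ^+ 2 + \sum_(0 <= j < d) ratr (b j) ^+ 2) * k' i +
   \sum_(0 <= j < d) 2 * ratr (b j) * (k' i * Y (u (idx i)) j))).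
  apply: eq_bigr => {}i _ /=.
  have -> : k i = k' i * \sum_(0 <= j < d.+1) V (idx i) j ^+ 2.
    by rewrite VE /k' divfK // expf_neq0.
  have -> : \sum_(0 <= j < d) 2 * ratr (b j) * (k' i * Y (u (idx i)) j) =
      k' i * \sum_(0 <= j < d) 2 * ratr (b j) * Y (u (idx i)) j.
    by rewrite mulr_sumr; apply: eq_bigr => j _; ring.
  have -> : \sum_(0 <= j < d) Y (u (idx i)) j ^+ 2 = \sum_(0 <= j < d) V (idx i) j ^+ 2 +
      \sum_(0 <= j < d) 2 * ratr (b j) * Y (u (idx i)) j - \sum_(0 <= j < d) ratr (b j) ^+ 2.
    rewrite -big_split -sumrB; apply: eq_big_nat => j /andP[_ jd] /=.
    by rewrite /V ltn_eqF //; ring.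
  by rewrite big_nat_recr //= {3}/V eqxx; ring.
rewrite !big_split /= sumrN -mulr_sumr k0 k'0 mulr0 subr0 add0r exchange_big big_nat big1 //= => j jd.
by rewrite -mulr_sumr k'Y ?mulr0.
Qed.
End Inversion.

Local Open Scope classical_set_scope.
Local Open Scope ring_scope.

(** * From families to point sets *)

Section Realization.
Variable R : realType.

Definition points d (P : nat -> nat -> R) : set 'rV[R]_d :=
  range (fun u : nat => \row_(j < d) P u j).

Lemma affinely_free_inj d (P : nat -> nat -> R) : (0 < d)%N -> affinely_free d P ->
  forall u v, (forall j, (j < d)%N -> P u j = P v j) -> u = v.
Proof.
move=> d0 free u v uv; apply/eqP; apply: contraT => /eqP nuv; exfalso.
pose f (i : 'I_d.+1) : nat := if i == 0%N :> nat then u else if i == 1%N :> nat then v else (u + v + i)%N.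
pose c (i : 'I_d.+1) : R := if i == 0%N :> nat then 1 else if i == 1%N :> nat then - 1 else 0.
have sumc (G : 'I_d.+1 -> R) : \sum_i c i * G i = G (inord 0) - G (inord 1).
  rewrite (bigD1 (inord 0)) //= (bigD1 (inord 1)) /=; last by rewrite -val_eqE /= !inordK.
  rewrite /c !inordK // mul1r mulN1r big1 ?addr0 // => i.
  rewrite -!val_eqE /= !inordK // => /andP[/negbTE -> /negbTE ->]; exact: mul0r.
have finj : injective f.
  move=> i j; rewrite /f; do !case: eqP => ?; move=> h; apply/val_inj => /=; lia.
have c0 : \sum_i c i = 0.
  rewrite -[RHS](subrr 1) -[RHS](sumc (fun=> 1)); apply: eq_bigr => i _.
  exact: (esym (mulr1 _)).
have cP j : (j < d)%N -> \sum_i c i * P (f i) j = 0.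
  by move=> jd; rewrite (sumc (fun i => P (f i) j)) /f !inordK //= uv // subrr.
by have /eqP := free f c finj c0 cP (inord 0); rewrite /c inordK //= oner_eq0.
Qed.

Variables (d : nat) (P : nat -> nat -> R).
Hypotheses (d0 : (0 < d)%N) (Prat : rational_family d P) (Pfree : affinely_free d P).

Lemma points_infinite : infinite_set (points P : set 'rV[R]_d).
Proof.
rewrite /points (eq_finite_set (inj_card_eq _)); first exact: infinite_nat.
move=> u v _ _ /rowP uv; apply: (affinely_free_inj d0 Pfree) => j jd.
by have := uv (Ordinal jd); rewrite !mxE.
Qed.

Lemma points_rational : points P `<=` @rational_points R d.
Proof.
move=> _ [u _ <-] j; rewrite mxE; have [a ->] := Prat.1 u j.
by exists a.
Qed.

Lemma points_rational_distances : rational_distances (points P : set 'rV[R]_d).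
Proof.
move=> _ _ [u _ <-] [v _ <-]; have [a ha] := Prat.2 u v.
exists `|a| => //; rewrite /edist.
have -> : \sum_(i < d) ((\row_j P u j) ord0 i - (\row_j P v j) ord0 i) ^+ 2 = (ratr a : R) ^+ 2.
  by rewrite -ha big_mkord; apply: eq_bigr => i _; rewrite !mxE.
by rewrite sqrtr_sqr ratr_norm.
Qed.

Lemma points_index n (p : 'I_n -> 'rV[R]_d) : injective p -> (forall i, points P (p i)) ->
  exists u : 'I_n -> nat, injective u /\ forall i, p i = \row_(j < d) P (u i) j.
Proof.
move=> pinj hp.
have h i : exists u : nat, p i = \row_(j < d) P u j by have [u _ <-] := hp i; exists u.
have [u hu] := choice h; exists u; split=> // i j uij.
by apply: pinj; rewrite !hu uij.
Qed.

Lemma points_affine_general_position : affine_general_position (points P : set 'rV[R]_d).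
Proof.
move=> p pinj hp c c0 cp; have [u [uinj hu]] := points_index pinj hp.
apply: (Pfree uinj c0) => j jd.
have := congr1 (fun x : 'rV_d => x ord0 (Ordinal jd)) cp.
rewrite summxE mxE => h; rewrite -[RHS]h; apply: eq_bigr => i _.
by rewrite hu !mxE.
Qed.

(** A system of d + 1 equations in d + 2 unknowns has a nontrivial solution, so d + 2 points
    satisfy a dependency; on a sphere the squared norm is an affine function and satisfies it
    too. *)
Lemma points_general_position : spherically_free d P -> general_position (points P : set 'rV[R]_d).
Proof.
move=> sfree; split; first exact: points_affine_general_position.
move=> p pinj hp [x [r [r0 hx]]]; have [u [uinj hu]] := points_index pinj hp.
pose M : 'M[R]_(d.+2, d.+1) := \matrix_(i, j) (if j == 0%N :> nat then 1 else P (u i) j.-1).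
have : kermx M != 0.
  rewrite -mxrank_eq0 mxrank_ker subn_eq0 -ltnNge ltnS.
  exact: rank_leq_col.
case/eqP; apply/row_matrixP => k; rewrite row0.
have : row k (kermx M) *m M = 0 by rewrite -row_mul mulmx_ker row0.
move: (row k _) => c cM; apply/rowP => i; rewrite mxE.
have hM (j : 'I_d.+1) : \sum_i c 0 i * M i j = 0.
  by have := congr1 (fun A : 'rV_d.+1 => A 0 j) cM; rewrite !mxE.
have c0 : \sum_i c 0 i = 0.
  by rewrite -[RHS](hM ord0); apply: eq_bigr => a _; rewrite mxE mulr1.
have cP j : (j < d)%N -> \sum_i c 0 i * P (u i) j = 0.
  move=> jd; rewrite -[RHS](hM (Ordinal (jd : (j.+1 < d.+1)%N))).
  by apply: eq_bigr => a _; rewrite mxE.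
apply: (sfree u (fun i => c 0 i)) => //.
have hr a : \sum_(0 <= j < d) P (u a) j ^+ 2 =
    r ^+ 2 - (\sum_(j < d) x ord0 j ^+ 2) + \sum_(j < d) 2 * x ord0 j * P (u a) j.
  have := hx a; rewrite /sphere /= /edist hu => /(congr1 (fun t => t ^+ 2)).
  rewrite sqr_sqrtr => [<-|]; last by apply: sumr_ge0 => j _; apply: sqr_ge0.
  rewrite big_mkord -sumrB -big_split; apply: eq_bigr => j _ /=.
  by rewrite mxE; ring.
under eq_bigr do rewrite hr mulrDr mulr_sumr.
rewrite big_split /= -mulr_suml c0 mul0r add0r exchange_big big1 //= => j _.
rewrite (eq_bigr (fun a => 2 * x ord0 j * (c 0 a * P (u a) j))) => [|a _]; last by rewrite mulrCA.
by rewrite -mulr_sumr cP ?mulr0.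
Qed.
End Realization.

Theorem theorem1p3 (R : realType) :
  (forall d : nat, (2 <= d)%N -> ~~ odd d ->
     exists X : set 'rV[R]_d,
       [/\ infinite_set X, X `<=` @rational_points R d,
           affine_general_position X & rational_distances X]) /\
  (forall d : nat, (1 <= d)%N -> d = 1 %[mod 4] ->
     exists X : set 'rV[R]_d,
       [/\ infinite_set X, X `<=` @rational_points R d,
           general_position X & rational_distances X]).
Proof.
split=> d d0.
  move=> ed.
  have [P [Pr Pf]] : exists P : nat -> nat -> R, rational_family d P /\ affinely_free d P.
    have [d4|d4] : (exists m, d = 4 * m.+1)%N \/ (exists m, d = (4 * m).+2)%N.
    - have [d4|d4] := boolP (4 %| d)%N.
        by left; exists (d %/ 4).-1; lia.
      by right; exists (d %/ 4)%N; lia.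
    - by have [m ->] := d4; apply: even_family.
    - by have [m ->] := d4; apply: inverted_family.
  have {}d0 : (0 < d)%N by apply: leq_trans d0.
  exists (points P); split.
  - exact: points_infinite.
  - exact: points_rational.
  - exact: points_affine_general_position.
  - exact: points_rational_distances.
move=> d1; have [m ->] : exists m, (d = (4 * m).+1)%N by exists (d %/ 4)%N; lia.
have [Y [_ [_ [_ [[Yr1 Yr2] Yf Ys _ _]]]]] := odd_family R m.
have natinj : injective (fun n : nat => n%:R : rat).
  by move=> a b /eqP; rewrite eqr_nat => /eqP.
pose P (n : nat) := Y n%:R.
have Pf : affinely_free (4 * m).+1 P.
  move=> u c uinj c0 cP; apply: (Yf (fun i => (u i)%:R)) => //.
  exact: (inj_comp natinj uinj).
have Ps : spherically_free (4 * m).+1 P.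
  move=> u c uinj c0 cP cQ; apply: (Ys (fun i => (u i)%:R)) => //.
  exact: (inj_comp natinj uinj).
have Pr : rational_family (4 * m).+1 P by split=> [u j|u v]; [exact: Yr1|exact: Yr2].
exists (points P); split.
- exact: points_infinite.
- exact: points_rational.
- exact: points_general_position.
- exact: points_rational_distances.
Qed.
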